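(* For any integer $k>5$, there is a generic quadratic submanifold $M$ in $\mathbb{C}^{2k-1}$ of codimension $k$ such that $4$-jets are required (and not less) to determine uniquely germs of biholomorphisms sending $M$ to $M$.
   Context: A quadratic submanifold of codimension $k$ in $\mathbb{C}^N$ is a real submanifold given, in coordinates $(z,w)\in\mathbb{C}^{N-k}\times\mathbb{C}^k$, by $\operatorname{Im} w_j=zH_jz^*$, $j=1,\dots,k$, where the $H_j$ are Hermitian matrices and $^*$ denotes conjugate transpose. Generic is used in the sense: Levi generating with non-degenerate Levi map, i.e. the $H_j$ are linearly independent over $\mathbb{R}$ and have trivial common kernel. ''$4$-jets are required (and not less) to determine uniquely germs of biholomorphisms sending $M$ to $M$'' means: any two germs at $0$ of biholomorphic maps of the ambient complex space sending $M$ into $M$ with the same $4$-jet at $0$ coincide, while there are two distinct such germs having the same $3$-jet at $0$. *)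

(* Defs.v *)
From HB Require Import structures.
From mathcomp Require Export all_boot all_order all_algebra.
From mathcomp Require Export complex.
From mathcomp Require Export all_classical all_reals all_analysis.
Export numFieldNormedType.Exports.

Set Implicit Arguments.
Unset Strict Implicit.
Unset Printing Implicit Defensive.

Import Order.TTheory GRing.Theory Num.Theory.

Local Open Scope classical_set_scope.
Local Open Scope sesquilinear_scope.
Local Open Scope ring_scope.

Section Germs.
Variables (C : numClosedFieldType) (N : nat).

Definition multi_index := {ffun 'I_N -> nat}.

Definition mdegree (al : multi_index) : nat := (\sum_i al i)%N.

Definition monomial (al : multi_index) (x : 'rV[C]_N) : C :=
  \prod_i x 0 i ^+ al i.

(* A power series in N variables with coefficients in C^N. *)
Definition vseries := multi_index -> 'rV[C]_N.

(* Cubic partial sums, over the al with al i < n for all i; the order of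
   summation is immaterial because absolute convergence is required below. *)
Definition partial_sum (V : nmodType) (u : multi_index -> V) (n : nat) : V :=
  \sum_(al : {ffun 'I_N -> 'I_n}) u [ffun i => nat_of_ord (al i)].

(* Holomorphy in several variables is taken in the sense of convergent power
   series: holomorphic germs at p are the elements of C{x - p}. *)
Definition has_taylor_series (F : 'rV[C]_N -> 'rV[C]_N) (p : 'rV[C]_N)
    (a : vseries) : Prop :=
  \forall x \near p,
    cvgn (partial_sum (fun al => `| monomial al (x - p) *: a al |)) /\
    partial_sum (fun al => monomial al (x - p) *: a al) @ \oo --> F x.

Definition holomorphic_at (F : 'rV[C]_N -> 'rV[C]_N) (p : 'rV[C]_N) : Prop :=
  exists a : vseries, has_taylor_series F p a.

(* Germs are represented by total functions, of which only the values near
   the base point matter. *)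
Definition same_germ (p : 'rV[C]_N) (F G : 'rV[C]_N -> 'rV[C]_N) : Prop :=
  \forall x \near p, F x = G x.

Definition biholomorphic_at (F : 'rV[C]_N -> 'rV[C]_N) (p : 'rV[C]_N) : Prop :=
  holomorphic_at F p /\
  exists G : 'rV[C]_N -> 'rV[C]_N,
    [/\ holomorphic_at G (F p),
        \forall x \near p, G (F x) = x
      & \forall y \near F p, F (G y) = y].

Definition maps_into_at (p : 'rV[C]_N) (M : set 'rV[C]_N)
    (F : 'rV[C]_N -> 'rV[C]_N) : Prop :=
  \forall x \near p, M x -> M (F x).

(* Equality of m-jets, that is, of the Taylor coefficients of order <= m;
   Taylor series are unique, so the existential quantifiers are harmless. *)
Definition same_jet (m : nat) (p : 'rV[C]_N)
    (F G : 'rV[C]_N -> 'rV[C]_N) : Prop :=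
  exists a b : vseries,
    [/\ has_taylor_series F p a, has_taylor_series G p b
      & forall al, (mdegree al <= m)%N -> a al = b al].

(* The condition F 0 = 0 is not imposed: a germ may move the base point along
   M. *)
Definition biholo_germ_into (M : set 'rV[C]_N) (F : 'rV[C]_N -> 'rV[C]_N) :
  Prop := biholomorphic_at F 0 /\ maps_into_at 0 M F.

Definition jets_determine (m : nat) (M : set 'rV[C]_N) : Prop :=
  forall F G : 'rV[C]_N -> 'rV[C]_N,
    biholo_germ_into M F -> biholo_germ_into M G ->
    same_jet m 0 F G -> same_germ 0 F G.

End Germs.

Section Quadrics.
Variables (C : numClosedFieldType) (n k : nat).

(* The point x of C^N, N = n + k, has coordinates z = lsubmx x, w = rsubmx x. *)
Definition quadric (H : 'I_k -> 'M[C]_n) : set 'rV[C]_(n + k) :=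
  [set x | forall j : 'I_k,
     'Im (rsubmx x 0 j) = (lsubmx x *m H j *m (lsubmx x)^t*) 0 0].

Definition real_independent (H : 'I_k -> 'M[C]_n) : Prop :=
  forall c : 'I_k -> C, (forall j, c j \is Num.real) ->
    \sum_j c j *: H j = 0 -> forall j, c j = 0.

(* Matrices act on row vectors; for Hermitian H j the left and right kernels
   correspond under conjugation. *)
Definition trivial_common_kernel (H : 'I_k -> 'M[C]_n) : Prop :=
  forall z : 'rV[C]_n, (forall j, z *m H j = 0) -> z = 0.

Definition generic_quadric (H : 'I_k -> 'M[C]_n) : Prop :=
  [/\ forall j, H j \is hermsymmx, real_independent H
    & trivial_common_kernel H].

End Quadrics.

(* Main.v *)
(* Take z = (zeta, eta) with zeta a column in C^2, and let w consist of a 2 x 2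
   matrix W with (W - W^* )/2i = zeta zeta^* and of further coordinates v with
   Im v_0 = 2 Re <eta, zeta> and Im v_j = 2 Re (eta_(j+1) conj zeta_0).

   Non-determination by 3-jets: det W is affine along rank-one directions, so
   the field det W * adj W zeta d/d eta + (det W)^2 d/d v_0 is tangent to the
   quadric; it has degree 4 and depends only on coordinates that it does not
   move, hence id plus this field is an automorphism.

   Determination by 4-jets: let F and G have the same 4-jet, translate G(0) to 0
   and give z, w the weights 1, 2.  The leading weighted part of F - G, after
   composition with the inverse of the leading part (z A, w B) of G, is a
   polynomial field (f, g) tangent to the quadric, all of whose terms have
   degree >= 5.  Componentwise, tangency reads Im g = 2 Re <f, zeta>.  After
   polarization this is an identity in z, chi = conj z and w, in which W moves
   along the rank-one direction zeta chi^T.  Rescaling (zeta, chi) to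
   (t zeta, chi / t) shows that g is quadratic and f at zeta = 0 affine along
   such lines, and that the remaining freedom is a form K(W)[zeta, chi] constant along them;
   since every 2 x 2 matrix is a sum of two matrices of rank one, f and g have
   degree at most 4, so they vanish. *)
Require Import Defs.
From mathcomp Require Import ring zify.
Import Order.TTheory GRing.Theory Num.Theory.
Set Implicit Arguments.
Unset Strict Implicit.
Unset Printing Implicit Defensive.
Local Open Scope classical_set_scope.
Local Open Scope sesquilinear_scope.
Local Open Scope ring_scope.

(** * Polynomial functions of one variable *)

(** The number 4 is a sum of degrees along rank-one lines. The value [h] of [g] on the axis
    [zeta = 0] is quadratic on each such line and two lines reach every 2 x 2 matrix, which gives 2
    + 2; the square of the determinant attains this. The field at [zeta = 0] is affine along
    rank-one directions built from its own argument and at most quadratic along the others, which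
    gives 1 + 2. The same count holds for [K], and each of these meets at most one further factor of
    the scaling parameter. One scalar equation serves all components: the first two forms kill two
    components of [f], after which the remaining forms pair [f] with [zeta] only. The leading part
    of [F - G] solves an equation linearized at the leading part of [G], so the latter must be shown
    to be an invertible linear automorphism of the quadric; here the inverse germ and the
    independence of the forms enter. Functions of many variables are seen only through their
    restrictions to polynomial curves, so all degree arguments concern one variable. *)

Section PolynomialFunctions.
Variable C : numFieldType.
Implicit Types p q r : C -> C.

Definition polyfun p := exists P : {poly C}, forall t, p t = P.[t].

Definition deg_le (n : nat) p :=
  exists2 P : {poly C}, (size P <= n.+1)%N & forall t, p t = P.[t].

(** Positive integers are both nonzero and real: one test settles identities known off [t = 0] and
    identities known at real parameters only. *)
Lemma poly_eq_natS (P Q : {poly C}) :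
  (forall i : nat, P.[i.+1%:R] = Q.[i.+1%:R]) -> P = Q.
Proof.
move=> h; apply/eqP; rewrite -subr_eq0; apply/negPn/negP => nz.
pose s : seq C := [seq i.+1%:R | i <- iota 0 (size (P - Q))].
have us : uniq s.
  by rewrite map_inj_uniq ?iota_uniq // => i j /eqP; rewrite eqr_nat => /eqP [].
have rs : all (root (P - Q)) s.
  by apply/allP => x /mapP [i _ ->]; rewrite /root hornerD hornerN h subrr.
by have := max_poly_roots nz rs us; rewrite size_map size_iota ltnn.
Qed.

Lemma poly_eq_nonzero (P Q : {poly C}) :
  (forall t, t != 0 -> P.[t] = Q.[t]) -> P = Q.
Proof. by move=> h; apply: poly_eq_natS => i; apply: h; rewrite pnatr_eq0. Qed.

Lemma poly_eq_fun (P Q : {poly C}) : (forall t, P.[t] = Q.[t]) -> P = Q.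
Proof. by move=> h; apply: poly_eq_nonzero => t _; apply: h. Qed.

Lemma polyfun_ext p q : p =1 q -> polyfun p -> polyfun q.
Proof. by move=> e [P hP]; exists P => t; rewrite -e. Qed.

Lemma polyfun_cst c : polyfun (fun=> c).
Proof. by exists c%:P => t; rewrite hornerC. Qed.

Lemma polyfun_id : polyfun id.
Proof. by exists 'X => t; rewrite hornerX. Qed.

Lemma polyfunD p q : polyfun p -> polyfun q -> polyfun (fun t => p t + q t).
Proof. by move=> [P hP] [Q hQ]; exists (P + Q) => t; rewrite hornerD hP hQ. Qed.

Lemma polyfunM p q : polyfun p -> polyfun q -> polyfun (fun t => p t * q t).
Proof. by move=> [P hP] [Q hQ]; exists (P * Q) => t; rewrite hornerM hP hQ. Qed.

Lemma polyfunB p q : polyfun p -> polyfun q -> polyfun (fun t => p t - q t).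
Proof. by move=> [P hP] [Q hQ]; exists (P - Q) => t; rewrite hornerD hornerN hP hQ. Qed.

Lemma polyfun_sum I (s : seq I) (P : pred I) (F : I -> C -> C) :
  (forall i, P i -> polyfun (F i)) -> polyfun (fun t => \sum_(i <- s | P i) F i t).
Proof.
move=> h; elim: s => [|i s IH].
  by apply: polyfun_ext (polyfun_cst 0) => t; rewrite big_nil.
have [Pi|nPi] := boolP (P i).
  by apply: polyfun_ext (polyfunD (h i Pi) IH) => t; rewrite big_cons Pi.
by apply: polyfun_ext IH => t; rewrite big_cons (negbTE nPi).
Qed.

Lemma polyfun_prod I (s : seq I) (F : I -> C -> C) :
  (forall i, polyfun (F i)) -> polyfun (fun t => \prod_(i <- s) F i t).
Proof.
move=> h; elim: s => [|i s IH].
  by apply: polyfun_ext (polyfun_cst 1) => t; rewrite big_nil.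
by apply: polyfun_ext (polyfunM (h i) IH) => t; rewrite big_cons.
Qed.

Lemma polyfunX p n : polyfun p -> polyfun (fun t => p t ^+ n).
Proof. by move=> [P hP]; exists (P ^+ n) => t; rewrite horner_exp hP. Qed.

Lemma deg_le_ext n p q : p =1 q -> deg_le n p -> deg_le n q.
Proof. by move=> e [P sP hP]; exists P => // t; rewrite -e. Qed.

Lemma deg_leW m n p : (m <= n)%N -> deg_le m p -> deg_le n p.
Proof. by move=> mn [P sP hP]; exists P => //; apply: leq_trans sP _. Qed.

Lemma deg_le_cst c : deg_le 0 (fun=> c).
Proof. by exists c%:P => [|t]; rewrite ?hornerC ?size_polyC_leq1. Qed.

Lemma deg_leD n p q : deg_le n p -> deg_le n q -> deg_le n (fun t => p t + q t).
Proof.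
move=> [P sP hP] [Q sQ hQ]; exists (P + Q) => [|t]; last by rewrite hornerD hP hQ.
by rewrite (leq_trans (size_polyD _ _)) // geq_max sP.
Qed.

Lemma deg_leZ n c p : deg_le n p -> deg_le n (fun t => c * p t).
Proof.
move=> [P sP hP]; exists (c *: P) => [|t]; last by rewrite hornerZ hP.
by rewrite (leq_trans (size_scale_leq _ _)).
Qed.

Lemma deg_leB n p q : deg_le n p -> deg_le n q -> deg_le n (fun t => p t - q t).
Proof.
move=> hp hq; apply: deg_le_ext (deg_leD hp (deg_leZ (-1) hq)) => t.
by rewrite mulN1r.
Qed.

Lemma deg_leX n p : deg_le n p -> deg_le n.+1 (fun t => t * p t).
Proof.
move=> [P sP hP]; exists (P * 'X) => [|t]; last by rewrite hornerMX hP mulrC.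
by rewrite (leq_trans (size_polyMleq _ _)) // size_polyX addn2.
Qed.

Lemma deg_le1 p : deg_le 1 p -> forall t, p t = p 0 + t * (p 1 - p 0).
Proof.
move=> [P sP hP] t; rewrite !hP !(horner_coef_wide _ sP) !big_ord_recl !big_ord0 /=.
rewrite /bump /=; ring.
Qed.

(** Interpolation at [0], [1] and [-1]: the coefficients are combinations of values of [p], so in a
    function of two variables they inherit a degree bound in the second variable. *)
Lemma deg_le2 p : deg_le 2 p -> forall t,
  p t = p 0 + t * ((p 1 - p (-1)) / 2) + t * (t * ((p 1 + p (-1)) / 2 - p 0)).
Proof.
move=> [P sP hP] t; rewrite !hP !(horner_coef_wide _ sP) !big_ord_recl !big_ord0 /=.
by rewrite /bump /=; field; rewrite ?pnatr_eq0.
Qed.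

Lemma affine_deg_le a b : deg_le 1 (fun t => a + t * b).
Proof.
apply: deg_leD; first exact: deg_leW (deg_le_cst a).
exact: deg_leX (deg_le_cst b).
Qed.

Lemma deg_le_bivariate1 n (P : C -> C -> C) :
  (forall t, deg_le 1 (P^~ t)) -> (forall s, deg_le n (P s)) ->
  deg_le n.+1 (fun t => P t t).
Proof.
move=> h1 h2.
apply: (@deg_le_ext _ (fun t => P 0 t + t * (P 1 t - P 0 t))).
  by move=> t; rewrite -(deg_le1 (h1 t)).
apply: deg_leD; first exact: deg_leW (h2 0).
by apply: deg_leX; apply: deg_leB.
Qed.

Lemma deg_le_bivariate2 n (P : C -> C -> C) :
  (forall t, deg_le 2 (P^~ t)) -> (forall s, deg_le n (P s)) ->
  deg_le n.+2 (fun t => P t t).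
Proof.
move=> h1 h2.
apply: (deg_le_ext (fun t => esym (deg_le2 (h1 t) t))).
apply: deg_leD; first apply: deg_leD.
- by apply: deg_leW (h2 0); lia.
- apply: (@deg_leW n.+1) => //; apply: deg_leX.
  apply: (@deg_le_ext _ (fun t => 2^-1 * (P 1 t - P (-1) t))); last exact/deg_leZ/deg_leB.
  by move=> t; rewrite mulrC.
- do 2!apply: deg_leX; apply: deg_leB => //.
  apply: (@deg_le_ext _ (fun t => 2^-1 * (P 1 t + P (-1) t))); last exact/deg_leZ/deg_leD.
  by move=> t; rewrite mulrC.
Qed.

(** The left side has no negative power of [t] and the right side none above 2, so both are one
    quadratic with its coefficients reversed. The rescaling and homogeneity arguments below rest on
    this. *)
Lemma quadratic_reciprocal p r : polyfun p -> polyfun r ->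
  (forall t, t != 0 -> p t = t ^+ 2 * r t^-1) ->
  exists c : C * C * C,
    (forall t, p t = c.1.1 + c.1.2 * t + c.2 * t ^+ 2) /\
    (forall t, r t = c.2 + c.1.2 * t + c.1.1 * t ^+ 2).
Proof.
move=> [P hP] [Q hQ] h.
(* [S] is [Q] reversed, with [S.[t] = t ^ N * Q.[1 / t]]; the margin in [N] keeps it above 2 when
   coefficients are compared. *)
pose N := (size Q).+3.
pose S := \poly_(i < N.+1) Q`_(N - i).
have [sQ N2] : (size Q <= N.+1)%N /\ (2 < N)%N by rewrite /N; lia.
have e : P * 'X^N = S * 'X^2.
  apply: poly_eq_nonzero => t t0.
  rewrite (hornerM P) (hornerM S) !hornerXn -hP h // hQ mulrC mulrCA mulrC; congr (_ * _).
  rewrite horner_poly (horner_coef_wide _ sQ) mulr_sumr (reindex_inj rev_ord_inj) /=.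
  apply: eq_bigr => i _; rewrite subSS exprVn mulrCA; congr (_ * _).
  have hi : (i <= N)%N by rewrite -ltnS.
  rewrite -{1}(subnK hi) exprD.
  by rewrite mulrC mulrA mulVf ?mul1r // expf_neq0.
have cP i : P`_i = if (i <= 2)%N then Q`_(2 - i) else 0.
  have := congr1 (fun R : {poly C} => R`_(i + N)) e;
    rewrite !coefMXn ltnNge leq_addl /= addnK => ->.
  have -> : (i + N < 2)%N = false by lia.
  rewrite coef_poly; case: (leqP i 2) => hi; last by rewrite ifF //; lia.
  by rewrite ifT; [congr (Q`_ _); lia | lia].
have cQ i : (2 < i)%N -> Q`_i = 0.
  move=> hi; case: (ltnP i (size Q)) => [hs|hs]; last by rewrite nth_default.
  have := congr1 (fun R : {poly C} => R`_(N + 2 - i)) e; rewrite !coefMXn.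
  have -> : (N + 2 - i < N)%N by lia.
  have -> : (N + 2 - i < 2)%N = false by lia.
  rewrite coef_poly ifT; last by lia.
  by have -> : (N - (N + 2 - i - 2) = i)%N by lia.
exists (P`_0, P`_1, P`_2) => /=; split=> t.
  rewrite hP (@horner_coef_wide _ 3); last by apply/leq_sizeP => j hj; rewrite cP ifF //; lia.
  by rewrite !big_ord_recl big_ord0 /bump /=; ring.
rewrite hQ (@horner_coef_wide _ 3); last by apply/leq_sizeP => j hj; apply: cQ.
by rewrite !big_ord_recl big_ord0 /bump /= !cP /=; ring.
Qed.

(** [A] and [B] stand for a form evaluated at [chi] and [chi'] on a plane of directions; the last
    hypothesis is affinity at [chi + y chi'] along its own direction. For [j > 2] the coefficient of
    [y ^ j] receives nothing from [B], and the contribution of [A], a combination of [s ^ j] and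
    [s ^ (j + 1)], is affine in [s] only if it vanishes. *)
Lemma deg_le2_of_diagonal_affine (A B : C -> C -> C) :
  polyfun (A 0) -> polyfun (A 1) ->
  (forall t, deg_le 1 (A^~ t)) -> (forall s, deg_le 1 (B s)) ->
  (forall y, deg_le 1 (fun s => A s (s * y) + y * B s (s * y))) ->
  deg_le 2 (A 0).
Proof.
move=> [a0 ha0] [a1' ha1'] hA hB hAB.
pose a1 := a1' - a0.
pose b1 s := B s 1 - B s 0.
have EA s t : A s t = a0.[t] + s * a1.[t].
  by rewrite (deg_le1 (hA t)) /a1 hornerD hornerN -ha0 -ha1'.
have EB s t : B s t = B s 0 + t * b1 s by rewrite (deg_le1 (hB s)).
clearbody a1 b1.
pose scl (a : {poly C}) (s : C) := \poly_(i < size a) (a`_i * s ^+ i).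
have sclE a s y : (scl a s).[y] = a.[s * y].
  rewrite /scl horner_poly horner_coef; apply: eq_bigr => i _.
  by rewrite exprMn mulrA.
have sclC a s i : (scl a s)`_i = a`_i * s ^+ i.
  by rewrite coef_poly; case: ltnP => // h; rewrite nth_default ?mul0r.
(* The expression of the last hypothesis at fixed [s], as a polynomial in [y]. *)
pose L s := scl a0 s + s *: scl a1 s + B s 0 *: 'X + (s * b1 s) *: 'X^2.
have key s : L s = (1 - s) *: L 0 + s *: L 1.
  apply: poly_eq_fun => y.
  have := deg_le1 (hAB y) s;
    rewrite !EA (EB s (s * y)) (EB 0 (0 * y)) (EB 1 (1 * y)) /L !(hornerD, hornerZ, hornerX,
      hornerXn) !sclE => E.
  transitivity (a0.[s * y] + s * a1.[s * y] + y * (B s 0 + s * y * b1 s)).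
    by ring.
  rewrite E; ring.
have cE j s : (2 < j)%N -> a0`_j * s ^+ j + a1`_j * s ^+ j.+1 = (a0`_j + a1`_j) * s.
  move=> hj; have := congr1 (fun p : {poly C} => p`_j) (key s).
  rewrite !(coefD, coefZ, coefX, coefXn, sclC).
  have [-> ->] : (j == 1)%N = false /\ (j == 2)%N = false by lia.
  rewrite !expr1n expr0n exprSr.
  have -> : (j == 0)%N = false by lia.
  rewrite !(mulr0, addr0, add0r, mul0r, mulr1, mul1r) => E.
  by rewrite [RHS]mulrC -E; ring.
have z j : (2 < j)%N -> a0`_j = 0.
  move=> hj.
  have e : (a0`_j)%:P * 'X^j + (a1`_j)%:P * 'X^(j.+1) = (a0`_j + a1`_j)%:P * 'X.
    by apply: poly_eq_fun => s; rewrite !(hornerD, hornerM, hornerC, hornerX, hornerXn) cE.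
  have := congr1 (fun p : {poly C} => p`_j) e.
  rewrite !(coefD, coefCM, coefX, coefXn) eqxx.
  have [-> ->] : (j == j.+1)%N = false /\ (j == 1)%N = false by lia.
  by rewrite !mulr0 mulr1 addr0.
exists a0 => //; apply/leq_sizeP => j hj; exact: z.
Qed.

End PolynomialFunctions.

(** * Polarized tangency along rank-one lines *)

Section NullLines.
Variables (C : numFieldType) (U V : lmodType C) (q : U -> U -> V).
Hypothesis qDl : forall a x y z, q (x + a *: y) z = q x z + a *: q y z.
Hypothesis qDr : forall a x y z, q x (y + a *: z) = q x y + a *: q x z.

Definition linear_form (f : U -> C) := forall a x y, f (x + a *: y) = f x + a * f y.

Let q0l z : q 0 z = 0.
Proof.
have := qDl 1 0 0 z; rewrite !scale1r addr0 => /eqP.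
by rewrite -[X in X == _]addr0 (inj_eq (addrI _)) => /eqP.
Qed.

Let q0r z : q z 0 = 0.
Proof.
have := qDr 1 z 0 0; rewrite !scale1r addr0 => /eqP.
by rewrite -[X in X == _]addr0 (inj_eq (addrI _)) => /eqP.
Qed.

Let qZl a x z : q (a *: x) z = a *: q x z.
Proof. by rewrite -[a *: x]add0r qDl q0l add0r. Qed.

Let qZr a x z : q x (a *: z) = a *: q x z.
Proof. by rewrite -[a *: z]add0r qDr q0r add0r. Qed.

Lemma linear_form0 f : linear_form f -> f 0 = 0.
Proof.
move=> hf; have := hf 1 0 0; rewrite scale1r addr0 mul1r => /eqP.
by rewrite -[X in X == _]addr0 (inj_eq (addrI _)) => /eqP.
Qed.

Lemma linear_formZ f a x : linear_form f -> f (a *: x) = a * f x.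
Proof. by move=> hf; rewrite -[a *: x]add0r hf linear_form0 // add0r. Qed.

(** Homogeneity makes [t f (y + t x)] and [f (x + t y)] reciprocal; the former vanishes at [0], so
    the latter is affine. Comparison of the two lines at [t = 1] and [t = 2] identifies its slope
    with [f y]. *)
Lemma homogeneous1_additive (f : U -> C) :
  (forall x y, polyfun (fun t => f (x + t *: y))) ->
  (forall a x, f (a *: x) = a * f x) -> linear_form f.
Proof.
move=> fpoly fZ.
have aff x y : exists c, forall t, f (x + t *: y) = f x + t * c.
  have [|[[c0 c1] c2] [/= h1 h2]] :=
    quadratic_reciprocal (polyfunM (polyfun_id C) (fpoly y x)) (fpoly x y).
    move=> t t0; rewrite expr2 -mulrA; congr (_ * _).
    by rewrite -fZ scalerDr scalerA mulfV // scale1r addrC.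
  have e0 : c0 = 0 by have := h1 0; rewrite !(mul0r, mulr0, expr0n, addr0).
  have ex : f x = c2.
    by have := h2 0; rewrite scale0r !(mulr0, expr0n, addr0).
  by exists c1 => t; rewrite h2 e0 ex mul0r addr0 mulrC.
move=> a x y; have [c hc] := aff x y; have [d hd] := aff y x.
have E t : t != 0 -> f x + t * c = t * f y + d.
  move=> t0; rewrite -hc; have := hd t^-1 => /(congr1 ( *%R t)).
  by rewrite -fZ scalerDr scalerA mulfV // scale1r addrC mulrDr mulVKf.
have -> : f y = c.
  have E1 := E 1 (oner_neq0 _); have E2 : f x + 2 * c = 2 * f y + d by apply: E;
    rewrite pnatr_eq0.
  suff -> : f y = (2 * f y + d) - (1 * f y + d) by rewrite -E1 -E2; ring.
  ring.
exact: hc.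
Qed.

(** In the application [Phi] and [Phi'] are the field and its conjugate, paired with a second
    vector, and [h] is [g] at [zeta = 0]; [eta] and the tail coordinates are set to 0. *)
Variables (Phi Phi' : U -> U -> V -> C) (h : V -> C).
Hypothesis Phi_lin : forall zeta W, linear_form (fun chi => Phi zeta chi W).
Hypothesis Phi'_lin : forall chi W, linear_form (fun zeta => Phi' chi zeta W).
Hypothesis Phi_poly : forall zeta zeta' chi W W',
  polyfun (fun t => Phi (zeta + t *: zeta') chi (W + t *: W')).
Hypothesis Phi'_poly : forall chi chi' zeta W W',
  polyfun (fun t => Phi' (chi + t *: chi') zeta (W + t *: W')).
Hypothesis Phi_eq : forall zeta chi W,
  Phi zeta chi W + Phi' chi zeta (W - q zeta chi) =
  h W - h (W - q zeta chi) + Phi' 0 zeta W + Phi 0 chi (W - q zeta chi).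

(** For a function quadratic in its first argument, these two are the homogeneous parts of degree
    one and two. *)
Definition odd_part (f : U -> U -> V -> C) x y W := (f x y W - f (- x) y W) / 2.
Definition even_part (f : U -> U -> V -> C) x y W :=
  (f x y W + f (- x) y W) / 2 - f 0 y W.

Let F1 := odd_part Phi.
Let F2 := even_part Phi.
Let G1 := odd_part Phi'.
Let G2 := even_part Phi'.

Let polyPhi zeta chi W : polyfun (fun t => Phi (t *: zeta) chi W).
Proof.
apply: polyfun_ext (Phi_poly 0 zeta chi W 0) => t.
by rewrite add0r scaler0 addr0.
Qed.

Let polyPhi' chi zeta W : polyfun (fun t => Phi' (t *: chi) zeta W).
Proof.
apply: polyfun_ext (Phi'_poly 0 chi zeta W 0) => t.
by rewrite add0r scaler0 addr0.
Qed.

(* The equation at [(t *: zeta, t^-1 *: chi)]: the shift [q zeta chi] is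
   unchanged, so both sides are Laurent polynomials in [t]. *)
Lemma scaling_expansion zeta chi W W' : W' = W - q zeta chi ->
  [/\ forall t, Phi (t *: zeta) chi W = Phi 0 chi W + t * F1 zeta chi W + t ^+ 2 * F2 zeta chi W,
      forall t, Phi' (t *: chi) zeta W' = Phi' 0 zeta W' + t * G1 chi zeta W' +
        t ^+ 2 * G2 chi zeta W',
      F1 zeta chi W + G1 chi zeta W' = h W - h W',
      F2 zeta chi W = Phi' 0 zeta W - Phi' 0 zeta W'
    & G2 chi zeta W' = Phi 0 chi W' - Phi 0 chi W].
Proof.
move=> eW'.
have [|||[[c0 c1] c2] [/= h1 h2]] := @quadratic_reciprocal _
  (fun t => Phi (t *: zeta) chi W - (Phi 0 chi W' + t * (h W - h W')))
  (fun t => Phi' 0 zeta W - Phi' (t *: chi) zeta W').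
- apply: polyfunB => //; apply: polyfunD; first exact: polyfun_cst.
  by apply: polyfunM (polyfun_cst _); apply: polyfun_id.
- by apply: polyfunB => //; apply: polyfun_cst.
- move=> t t0; have := Phi_eq (t *: zeta) (t^-1 *: chi) W.
  rewrite qZl qZr scalerA mulfV // scale1r -eW'.
  rewrite (linear_formZ _ _ (Phi_lin (t *: zeta) W)) (linear_formZ _ _ (Phi'_lin _ W')).
  rewrite (linear_formZ _ _ (Phi'_lin _ W)) (linear_formZ _ _ (Phi_lin _ W')).
  move=> /(congr1 ( *%R t)) E.
  suff : Phi (t *: zeta) chi W = t * (t^-1 * Phi (t *: zeta) chi W +
    t * Phi' (t^-1 *: chi) zeta W')
     - t * t * Phi' (t^-1 *: chi) zeta W' by rewrite E => ->; field.
  by field.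
have a0 : Phi 0 chi W = c0 + Phi 0 chi W'.
  by have := h1 0; rewrite scale0r !(mul0r, mulr0, expr0n, addr0) => /eqP; rewrite subr_eq =>
    /eqP.
have b0 : Phi' 0 zeta W' = Phi' 0 zeta W - c2.
  have := h2 0; rewrite scale0r !(mul0r, mulr0, expr0n, addr0) => <-; ring.
have hP t : Phi (t *: zeta) chi W = c0 + c1 * t + c2 * t ^+ 2 + (Phi 0 chi W' + t * (h W - h W')).
  by rewrite -h1 subrK.
have hP' t : Phi' (t *: chi) zeta W' = Phi' 0 zeta W - (c2 + c1 * t + c0 * t ^+ 2).
  by rewrite -h2 opprB addrC subrK.
have e1 : F1 zeta chi W = c1 + (h W - h W').
  by rewrite /F1 /odd_part -[zeta]scale1r -scaleN1r scalerA mulr1 !hP; field; rewrite ?pnatr_eq0.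
have e2 : F2 zeta chi W = c2.
  by rewrite /F2 /even_part -[zeta]scale1r -scaleN1r scalerA mulr1 !hP a0; field;
    rewrite ?pnatr_eq0.
have e1' : G1 chi zeta W' = - c1.
  by rewrite /G1 /odd_part -[chi]scale1r -scaleN1r scalerA mulr1 !hP'; field; rewrite ?pnatr_eq0.
have e2' : G2 chi zeta W' = - c0.
  by rewrite /G2 /even_part -[chi]scale1r -scaleN1r scalerA mulr1 !hP' b0; field;
    rewrite ?pnatr_eq0.
split.
- by move=> t; rewrite hP e1 e2 a0; ring.
- by move=> t; rewrite hP' e1' e2' b0; ring.
- by rewrite e1 e1'; ring.
- by rewrite e2 b0; ring.
- by rewrite e2' a0; ring.
Qed.

Let PhiE t zeta chi W :
  Phi (t *: zeta) chi W = Phi 0 chi W + t * F1 zeta chi W + t ^+ 2 * F2 zeta chi W.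
Proof. by have [+ _ _ _ _] := @scaling_expansion zeta chi W _ erefl; apply. Qed.

Let Phi'E t chi zeta W :
  Phi' (t *: chi) zeta W = Phi' 0 zeta W + t * G1 chi zeta W + t ^+ 2 * G2 chi zeta W.
Proof.
have [|_ + _ _ _] := @scaling_expansion zeta chi (W + q zeta chi) W; last by apply.
by rewrite addrK.
Qed.

Let F1Z a zeta chi W : F1 (a *: zeta) chi W = a * F1 zeta chi W.
Proof. by rewrite {1}/F1 /odd_part -scaleNr !PhiE; field; rewrite ?pnatr_eq0. Qed.

Let G1Z a chi zeta W : G1 (a *: chi) zeta W = a * G1 chi zeta W.
Proof. by rewrite {1}/G1 /odd_part -scaleNr !Phi'E; field; rewrite ?pnatr_eq0. Qed.

Let F1lin chi W : linear_form (fun zeta => F1 zeta chi W).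
Proof.
apply: homogeneous1_additive => [x y|a x]; last exact: F1Z.
apply: polyfunM (polyfun_cst _); apply: polyfunB.
  by apply: polyfun_ext (Phi_poly x y chi W 0) => t; rewrite scaler0 addr0.
apply: polyfun_ext (Phi_poly (- x) (- y) chi W 0) => t.
by rewrite scaler0 addr0 scalerN opprD.
Qed.

Let G1lin zeta W : linear_form (fun chi => G1 chi zeta W).
Proof.
apply: homogeneous1_additive => [x y|a x]; last exact: G1Z.
apply: polyfunM (polyfun_cst _); apply: polyfunB.
  by apply: polyfun_ext (Phi'_poly x y zeta W 0) => t; rewrite scaler0 addr0.
apply: polyfun_ext (Phi'_poly (- x) (- y) zeta W 0) => t.
by rewrite scaler0 addr0 scalerN opprD.
Qed.

Let F1linr zeta W : linear_form (fun chi => F1 zeta chi W).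
Proof. by move=> a x y; rewrite /F1 /odd_part !Phi_lin; field; rewrite ?pnatr_eq0. Qed.

Let G1linr chi W : linear_form (fun zeta => G1 chi zeta W).
Proof. by move=> a x y; rewrite /G1 /odd_part !Phi'_lin; field; rewrite ?pnatr_eq0. Qed.

Let F2linr zeta W : linear_form (fun chi => F2 zeta chi W).
Proof. by move=> a x y; rewrite /F2 /even_part !Phi_lin; field; rewrite ?pnatr_eq0. Qed.

Let G2linr chi W : linear_form (fun zeta => G2 chi zeta W).
Proof. by move=> a x y; rewrite /G2 /even_part !Phi'_lin; field; rewrite ?pnatr_eq0. Qed.

(** The sum of [F1] and [G1] is controlled by differences of [h]; this is the complementary
    combination, for which the equation yields invariance along null lines. *)
Let K zeta chi W := F1 zeta chi W - G1 chi zeta W.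

Let Klinl chi W : linear_form (fun zeta => K zeta chi W).
Proof. by move=> a x y; rewrite /K F1lin G1linr; ring. Qed.

Let Klinr zeta W : linear_form (fun chi => K zeta chi W).
Proof. by move=> a x y; rewrite /K G1lin F1linr; ring. Qed.

Let F1G1 c zeta chi W :
  c * (F1 zeta chi W + G1 chi zeta (W - c *: q zeta chi)) = h W - h (W - c *: q zeta chi).
Proof.
rewrite -qZl; have [_ _ <- _ _] := @scaling_expansion (c *: zeta) chi W _ erefl.
by rewrite F1Z (linear_formZ _ _ (G1linr _ _)) mulrDr.
Qed.

(** The segment read from either end gives two expressions for the same difference of [h], with [F1]
    and [G1] exchanging their base points. *)
Let K_null c zeta chi W : K zeta chi (W + c *: q zeta chi) = K zeta chi W.
Proof.
have [->|c0] := eqVneq c 0; first by rewrite scale0r addr0.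
have := F1G1 c zeta chi (W + c *: q zeta chi); rewrite addrK => E1.
have := F1G1 (- c) zeta chi W; rewrite scaleNr opprK => E2.
apply: (mulfI c0); apply/eqP; rewrite -subr_eq0 /K.
set X := h _ in E1 E2; set Y := h _ in E1 E2.
have -> : 0 = (X - Y) + (Y - X) by ring.
by rewrite -E1 -E2; apply/eqP; ring.
Qed.

Let h_diff s t zeta chi W :
  h (W + s *: q zeta chi) - h (W + t *: q zeta chi) = (s - t) *
   (F1 zeta chi (W + s *: q zeta chi) + F1 zeta chi (W + t *: q zeta chi) - K zeta chi W).
Proof.
have := F1G1 (s - t) zeta chi (W + s *: q zeta chi).
have -> : W + s *: q zeta chi - (s - t) *: q zeta chi = W + t *: q zeta chi.
  by rewrite scalerBl opprB addrA addrAC addrK.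
by move=> <-; rewrite -(K_null t zeta chi W) /K; ring.
Qed.

(** The differences of [h] between the parameters [s], [1] and [0] add up; [h_diff] turns this into
    a linear relation among three values of [F1], in which [K] cancels. *)
Let F1_affine zeta chi W s : F1 zeta chi (W + s *: q zeta chi) =
  F1 zeta chi W + s * (F1 zeta chi (W + q zeta chi) - F1 zeta chi W).
Proof.
have E1 := h_diff s 0 zeta chi W; have E2 := h_diff 1 0 zeta chi W.
have := h_diff s 1 zeta chi W; rewrite !scale1r !scale0r !addr0 in E1 E2 *.
set H := h _ in E1 *; set H1 := h _ in E2 *.
have -> : H - H1 = (H - h W) - (H1 - h W) by ring.
rewrite E1 E2 => /eqP; rewrite -subr_eq0 => /eqP E.
by apply/eqP; rewrite -subr_eq0 -[0]E; apply/eqP; ring.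
Qed.

Lemma h_null_line zeta chi W : deg_le 2 (fun s => h (W + s *: q zeta chi)).
Proof.
set b := F1 zeta chi (W + q zeta chi) - F1 zeta chi W.
apply: (@deg_le_ext _ _ (fun s => h W + s * (2 * F1 zeta chi W - K zeta chi W + s * b))).
  move=> s; have := h_diff s 0 zeta chi W; rewrite scale0r addr0 F1_affine subr0 -/b => /eqP.
  by rewrite subr_eq => /eqP ->; ring.
apply: deg_leD; first by apply: deg_leW (deg_le_cst _).
exact/deg_leX/affine_deg_le.
Qed.

(** Symmetric end points average the affine [F1] to its midpoint value, and subtracting [K] turns
    [2 F1] into [F1 + G1]. *)
Let h_sym zeta chi W :
  h (W + q zeta chi) - h (W - q zeta chi) = 2 * (F1 zeta chi W + G1 chi zeta W).
Proof.
have := h_diff 1 (-1) zeta chi W; rewrite scale1r scaleN1r => ->.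
have := F1_affine zeta chi W (-1); rewrite scaleN1r => ->.
by rewrite /K; ring.
Qed.

(** The lower end of the segment stays fixed while [zeta] is scaled; the increment is given by [G2],
    which is linear in [zeta]. *)
Let Phi_null_line chi zeta W : deg_le 1 (fun s => Phi 0 chi (W + s *: q zeta chi)).
Proof.
apply: (deg_le_ext _ (affine_deg_le (Phi 0 chi W) (- G2 chi zeta W))) => s.
have [|_ _ _ _] := @scaling_expansion (s *: zeta) chi (W + s *: q zeta chi) W.
  by rewrite qZl addrK.
by rewrite (linear_formZ _ _ (G2linr _ _)) mulrN => ->; ring.
Qed.

(** Here the upper end is fixed and [chi] is scaled, hence the factor [- s]. *)
Let Phi'_null_line chi zeta W : deg_le 1 (fun s => Phi' 0 zeta (W + s *: q zeta chi)).
Proof.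
apply: (deg_le_ext _ (affine_deg_le (Phi' 0 zeta W) (F2 zeta chi W))) => s.
have [|_ _ _ + _] := @scaling_expansion zeta (- s *: chi) W (W + s *: q zeta chi).
  by rewrite qZr scaleNr opprK.
by rewrite (linear_formZ _ _ (F2linr _ _)) => /eqP; rewrite mulNr eqr_oppLR => /eqP ->; ring.
Qed.

Let polyV (f : U -> U -> V -> C) x y W W' :
  (forall x x' y W W', polyfun (fun t => f (x + t *: x') y (W + t *: W'))) ->
  polyfun (fun t => f x y (W + t *: W')).
Proof.
by move=> hf; apply: polyfun_ext (hf x 0 y W W') => t; rewrite scaler0 addr0.
Qed.

(** The direction need not be built from [chi]. Linearity in [chi] and affinity along the directions
    of [chi], [chi'] and [chi + y chi'] together bound the degree. *)
Let Phi_deg2 chi chi' zeta W : deg_le 2 (fun s => Phi 0 chi (W + s *: q zeta chi')).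
Proof.
pose pt a b := W + a *: q zeta chi + b *: q zeta chi'.
apply: (@deg_le_ext _ _ (fun b => Phi 0 chi (pt 0 b))).
  by move=> b; rewrite /pt scale0r addr0.
apply: (@deg_le2_of_diagonal_affine _ (fun a b => Phi 0 chi (pt a b)) (fun a b =>
  Phi 0 chi' (pt a b))).
- by apply: polyV => *; apply: Phi_poly.
- by apply: polyV => *; apply: Phi_poly.
- move=> b; apply: deg_le_ext (Phi_null_line chi zeta (W + b *: q zeta chi')) => a.
  by rewrite /pt addrAC.
- by move=> a; exact: Phi_null_line.
- move=> y; apply: deg_le_ext (Phi_null_line (chi + y *: chi') zeta W) => s.
  by rewrite Phi_lin qDr scalerDr scalerA addrA.
Qed.

Let Phi'_deg2 zeta zeta' chi W : deg_le 2 (fun s => Phi' 0 zeta (W + s *: q zeta' chi)).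
Proof.
pose pt a b := W + a *: q zeta chi + b *: q zeta' chi.
apply: (@deg_le_ext _ _ (fun b => Phi' 0 zeta (pt 0 b))).
  by move=> b; rewrite /pt scale0r addr0.
apply: (@deg_le2_of_diagonal_affine _ (fun a b => Phi' 0 zeta (pt a b)) (fun a b =>
  Phi' 0 zeta' (pt a b))).
- by apply: polyV => *; apply: Phi'_poly.
- by apply: polyV => *; apply: Phi'_poly.
- move=> b; apply: deg_le_ext (Phi'_null_line chi zeta (W + b *: q zeta' chi)) => a.
  by rewrite /pt addrAC.
- by move=> a; exact: Phi'_null_line.
- move=> y; apply: deg_le_ext (Phi'_null_line chi (zeta + y *: zeta') W) => s.
  by rewrite Phi'_lin qDl scalerDr scalerA addrA.
Qed.

Let polyK zeta chi W W' : polyfun (fun t => K zeta chi (W + t *: W')).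
Proof.
apply: polyfunB; (apply: polyfunM (polyfun_cst _); apply: polyfunB);
  by apply: polyV => *; [apply: Phi_poly || apply: Phi'_poly].
Qed.

(** The invariance at [chi + y chi'] is polarized; the invariance of each term along its own
    direction removes one of the two displacements. *)
Let K_deg1 zeta chi chi' W : deg_le 1 (fun s => K zeta chi (W + s *: q zeta chi')).
Proof.
apply: (deg_le_ext _ (affine_deg_le (K zeta chi W) (K zeta chi' W - K zeta chi' (W +
  q zeta chi)))) => y.
have := K_null 1 zeta (chi + y *: chi') W; rewrite !Klinr qDr scale1r.
rewrite (_ : K zeta chi _ = K zeta chi (W + y *: q zeta chi')); last first.
  by rewrite addrCA addrC -[q zeta chi]scale1r K_null.
rewrite addrA -(scale1r (q zeta chi)) -addrA addrA K_null scale1r => E.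
by apply/eqP; rewrite -(inj_eq (addIr (y * K zeta chi' (W + q zeta chi)))) E; apply/eqP; ring.
Qed.

Let K_deg2 zeta chi zeta' chi' W : deg_le 2 (fun s => K zeta chi (W + s *: q zeta' chi')).
Proof.
pose pt a b := W + a *: q zeta chi' + b *: q zeta' chi'.
apply: (@deg_le_ext _ _ (fun b => K zeta chi (pt 0 b))).
  by move=> b; rewrite /pt scale0r addr0.
apply: (@deg_le2_of_diagonal_affine _ (fun a b => K zeta chi (pt a b)) (fun a b =>
  K zeta' chi (pt a b))).
- exact: polyK.
- exact: polyK.
- move=> b; apply: deg_le_ext (K_deg1 zeta chi chi' (W + b *: q zeta' chi')) => a.
  by rewrite /pt addrAC.
- by move=> a; exact: K_deg1.
- move=> y; apply: deg_le_ext (K_deg1 (zeta + y *: zeta') chi chi' W) => s.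
  by rewrite Klinl qDl scalerDr scalerA addrA.
Qed.

Variables e0 e1 : U.
Hypothesis span : forall u, exists a b, u = a *: e0 + b *: e1.
Hypothesis rows : forall W, exists x y, W = q e0 x + q e1 y.
Hypothesis cols : forall W, exists x y, W = q x e0 + q y e1.

Let deg_span n (f : U -> V -> C) : (forall W, linear_form (f^~ W)) -> forall P : C -> V,
  deg_le n (fun t => f e0 (P t)) -> deg_le n (fun t => f e1 (P t)) ->
  forall u, deg_le n (fun t => f u (P t)).
Proof.
move=> lf P h0 h1 u; have [a [b ->]] := span u.
apply: deg_le_ext (deg_leD (deg_leZ a h0) (deg_leZ b h1)) => t.
by rewrite lf (linear_formZ _ _ (lf _)).
Qed.

Lemma h_deg4 W W' : deg_le 4 (fun t => h (W + t *: W')).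
Proof.
have [x [y ->]] := rows W'.
apply: (@deg_le_ext _ _ (fun t => h (W + t *: q e0 x + t *: q e1 y))).
  by move=> t; rewrite scalerDr addrA.
apply: (@deg_le_bivariate2 _ 2 (fun s t => h (W + s *: q e0 x + t *: q e1 y))) => t.
  by apply: deg_le_ext (h_null_line e0 x (W + t *: q e1 y)) => s; rewrite addrAC.
exact: h_null_line.
Qed.

(** At [chi = e0] the form is affine along the summand [q x e0] of the direction and quadratic along
    the other; at [e1] the roles are exchanged, and linearity covers the rest. *)
Lemma Phi_deg3 chi W W' : deg_le 3 (fun t => Phi 0 chi (W + t *: W')).
Proof.
have [x [y ->]] := cols W'.
apply: (@deg_span _ (Phi 0)) => //.
  apply: (@deg_le_ext _ _ (fun t => Phi 0 e0 (W + t *: q x e0 + t *: q y e1))).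
    by move=> t; rewrite scalerDr addrA.
  apply: (@deg_le_bivariate1 _ 2 (fun s t => Phi 0 e0 (W + s *: q x e0 + t *: q y e1))) => t.
    by apply: deg_le_ext (Phi_null_line e0 x (W + t *: q y e1)) => s; rewrite addrAC.
  exact: Phi_deg2.
apply: (@deg_le_ext _ _ (fun t => Phi 0 e1 (W + t *: q y e1 + t *: q x e0))).
  by move=> t; rewrite scalerDr addrA addrAC.
apply: (@deg_le_bivariate1 _ 2 (fun s t => Phi 0 e1 (W + s *: q y e1 + t *: q x e0))) => t.
  by apply: deg_le_ext (Phi_null_line e1 y (W + t *: q x e0)) => s; rewrite addrAC.
exact: Phi_deg2.
Qed.

Lemma Phi'_deg3 zeta W W' : deg_le 3 (fun t => Phi' 0 zeta (W + t *: W')).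
Proof.
have [x [y ->]] := rows W'.
apply: (@deg_span _ (Phi' 0)) => //.
  apply: (@deg_le_ext _ _ (fun t => Phi' 0 e0 (W + t *: q e0 x + t *: q e1 y))).
    by move=> t; rewrite scalerDr addrA.
  apply: (@deg_le_bivariate1 _ 2 (fun s t => Phi' 0 e0 (W + s *: q e0 x + t *: q e1 y))) => t.
    by apply: deg_le_ext (Phi'_null_line x e0 (W + t *: q e1 y)) => s; rewrite addrAC.
  exact: Phi'_deg2.
apply: (@deg_le_ext _ _ (fun t => Phi' 0 e1 (W + t *: q e1 y + t *: q e0 x))).
  by move=> t; rewrite scalerDr addrA addrAC.
apply: (@deg_le_bivariate1 _ 2 (fun s t => Phi' 0 e1 (W + s *: q e1 y + t *: q e0 x))) => t.
  by apply: deg_le_ext (Phi'_null_line y e1 (W + t *: q e0 x)) => s; rewrite addrAC.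
exact: Phi'_deg2.
Qed.

Let K_deg3 zeta chi W W' : deg_le 3 (fun t => K zeta chi (W + t *: W')).
Proof.
have [x [y ->]] := rows W'.
apply: (@deg_span _ (fun u => K u chi)) => //.
  apply: (@deg_le_ext _ _ (fun t => K e0 chi (W + t *: q e0 x + t *: q e1 y))).
    by move=> t; rewrite scalerDr addrA.
  apply: (@deg_le_bivariate1 _ 2 (fun s t => K e0 chi (W + s *: q e0 x + t *: q e1 y))) => t.
    by apply: deg_le_ext (K_deg1 e0 chi x (W + t *: q e1 y)) => s; rewrite addrAC.
  exact: K_deg2.
apply: (@deg_le_ext _ _ (fun t => K e1 chi (W + t *: q e1 y + t *: q e0 x))).
  by move=> t; rewrite scalerDr addrA addrAC.
apply: (@deg_le_bivariate1 _ 2 (fun s t => K e1 chi (W + s *: q e1 y + t *: q e0 x))) => t.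
  by apply: deg_le_ext (K_deg1 e1 chi y (W + t *: q e0 x)) => s; rewrite addrAC.
exact: K_deg2.
Qed.

(** A separate count would give 5: [F1 + G1] and [F2] are differences of functions of degree 4 and
    3, preceded by [t] and [t ^ 2]. One factor [t] is therefore moved into [q], where it joins the
    scaled displacement. *)
Lemma Phi_deg4 zeta chi W : deg_le 4 (fun t => Phi (t *: zeta) chi (t *: W)).
Proof.
have hS : deg_le 4 (fun t => t * (F1 zeta chi (t *: W) + G1 chi zeta (t *: W))).
  apply: (@deg_le_ext _ _ (fun t => 2^-1 * (h (0 + t *: (W + q zeta chi)) - h (0 +
    t *: (W - q zeta chi))))).
    move=> t; rewrite !add0r scalerDr scalerBr -qZl h_sym F1Z (linear_formZ _ _ (G1linr _ _)).
    by field; rewrite ?pnatr_eq0.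
  by apply: deg_leZ; apply: deg_leB; apply: h_deg4.
have hK : deg_le 4 (fun t => t * K zeta chi (t *: W)).
  by apply/deg_leX/deg_le_ext/(K_deg3 zeta chi 0 W) => t; rewrite add0r.
have h2 : deg_le 4 (fun t => t * (t * F2 zeta chi (t *: W))).
  apply: deg_leX.
  apply: (@deg_le_ext _ _ (fun t => Phi' 0 zeta (0 + t *: W) - Phi' 0 zeta (0 +
    t *: (W - q zeta chi)))).
    move=> t; rewrite !add0r scalerBr -qZr -(linear_formZ _ _ (F2linr _ _)).
    by have [_ _ _ -> _] := @scaling_expansion zeta (t *: chi) (t *: W) _ erefl.
  by apply: deg_leB; apply: Phi'_deg3.
have h0 : deg_le 4 (fun t => Phi 0 chi (t *: W)).
  by apply/(@deg_leW _ 3)/deg_le_ext/(Phi_deg3 chi 0 W) => // t; rewrite add0r.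
apply: deg_le_ext (deg_leD (deg_leD h0 (deg_leZ 2^-1 (deg_leD hS hK))) h2) => t.
by rewrite PhiE /K; field; rewrite ?pnatr_eq0.
Qed.

End NullLines.

(** * Independence of the field from the tail coordinates *)

Section TailHalf.
Variables (C : numFieldType) (U E V V1 : lmodType C) (L : E -> U -> V1).
Hypothesis LZl : forall a x y, L (a *: x) y = a *: L x y.
Hypothesis LZr : forall a x y, L x (a *: y) = a *: L x y.
Variables (Psi : U -> E -> U -> V -> V1 -> C) (g : U -> V -> V1 -> C).
Hypothesis Psi_lin : forall zeta eta W v, linear_form (fun chi => Psi zeta eta chi W v).
Hypothesis Psi_poly : forall zeta eta chi W v,
  polyfun (fun t => Psi zeta (t *: eta) chi W v).
Hypothesis Psi_shift : forall zeta eta chi W v,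
  Psi zeta eta chi W v - Psi zeta 0 chi W (v - L eta chi) =
  g zeta W v - g zeta W (v - L eta chi).

(* Letting [t] tend to [0] in the shift relation at [(t *: eta, t^-1 *: chi)],
   where [L eta chi] does not change. *)
Lemma tail_translation zeta eta chi W v :
  Psi zeta 0 chi W v = Psi zeta 0 chi W (v - L eta chi).
Proof.
have [P hP] := Psi_poly zeta eta chi W v.
set c := Psi _ _ _ _ (v - _); pose D := g zeta W v - g zeta W (v - L eta chi).
have eP : P = c%:P + D *: 'X.
  apply: poly_eq_nonzero => t t0; rewrite -hP.
  have := Psi_shift zeta (t *: eta) (t^-1 *: chi) W v.
  rewrite LZl LZr scalerA mulfV // scale1r -/D.
  rewrite !(linear_formZ _ _ (Psi_lin _ _ _ _)) -mulrBr -/c => <-.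
  by rewrite hornerD hornerC hornerZ hornerX mulrAC mulVf // mul1r addrC subrK.
by have := hP 0; rewrite scale0r eP hornerD hornerC hornerZ hornerX mulr0 addr0.
Qed.

Variables e0 e1 : U.
Hypothesis span : forall u, exists a b, u = a *: e0 + b *: e1.
Hypothesis Lsurj : forall c l, exists eta, L eta (e0 + c *: e1) = l.

(** Every tail translation is available for [e0 + c e1] but not for [e1] alone, so [e1] is obtained
    by comparing [c = 1] with [c = 0]. *)
Lemma tail_independent zeta chi W v : Psi zeta 0 chi W v = Psi zeta 0 chi W 0.
Proof.
have reg c : Psi zeta 0 (e0 + c *: e1) W v = Psi zeta 0 (e0 + c *: e1) W 0.
  by have [eta he] := Lsurj c v; rewrite (tail_translation _ eta) he subrr.
have E0 : Psi zeta 0 e0 W v = Psi zeta 0 e0 W 0.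
  by have := reg 0; rewrite scale0r addr0.
have [a [b ->]] := span chi; rewrite !Psi_lin !(linear_formZ _ _ (Psi_lin _ _ _ _)) E0.
have := reg 1; rewrite !Psi_lin E0 !mul1r => /addrI ->.
by [].
Qed.

End TailHalf.

(** * Degree bounds from the full polarized equation *)

Section DegreeBound.
Variables (C : numFieldType) (U E V V1 : lmodType C).
Variables (q : U -> U -> V) (L : E -> U -> V1).
Hypothesis qDl : forall a x y z, q (x + a *: y) z = q x z + a *: q y z.
Hypothesis qDr : forall a x y z, q x (y + a *: z) = q x y + a *: q x z.
Hypothesis LZl : forall a x y, L (a *: x) y = a *: L x y.
Hypothesis LZr : forall a x y, L x (a *: y) = a *: L x y.
Variables e0 e1 : U.
Hypothesis span : forall u, exists a b, u = a *: e0 + b *: e1.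
Hypothesis Lsurj : forall c l, exists eta, L eta (e0 + c *: e1) = l.
Hypothesis rows : forall W, exists x y, W = q e0 x + q e1 y.
Hypothesis cols : forall W, exists x y, W = q x e0 + q y e1.

Variables (g g' : U -> E -> V -> V1 -> C) (Psi Psi' : U -> E -> U -> V -> V1 -> C).
Hypothesis Psi_lin : forall zeta eta W v, linear_form (fun chi => Psi zeta eta chi W v).
Hypothesis Psi'_lin : forall chi kappa W v, linear_form (fun zeta => Psi' chi kappa zeta W v).
Hypothesis Psi_poly : forall zeta zeta' eta eta' chi W W' v v', polyfun (fun t =>
  Psi (zeta + t *: zeta') (eta + t *: eta') chi (W + t *: W') (v + t *: v')).
Hypothesis Psi'_poly : forall zeta zeta' eta eta' chi W W' v v', polyfun (fun t =>
  Psi' (zeta + t *: zeta') (eta + t *: eta') chi (W + t *: W') (v + t *: v')).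
Hypothesis polarized : forall zeta eta chi kappa W v,
  let W' := W - q zeta chi in let v' := v - L eta chi - L kappa zeta in
  g zeta eta W v - g' chi kappa W' v' = Psi zeta eta chi W v + Psi' chi kappa zeta W' v'.

Let q0l z : q 0 z = 0.
Proof. by have := qDl (-1) 0 0 z; rewrite scaler0 addr0 scaleN1r subrr. Qed.

Let q0r z : q z 0 = 0.
Proof. by have := qDr (-1) z 0 0; rewrite scaler0 addr0 scaleN1r subrr. Qed.

Let L0l z : L 0 z = 0.
Proof. by rewrite -[X in L X](scale0r 0) LZl scale0r. Qed.

Let L0r z : L z 0 = 0.
Proof. by rewrite -[X in L _ X](scale0r 0) LZr scale0r. Qed.

(** At [chi = kappa = 0] all shifts vanish. In particular [g] does not depend on [eta]. *)
Let gE zeta eta W v : g zeta eta W v = g' 0 0 W v + Psi' 0 0 zeta W v.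
Proof.
have := polarized zeta eta 0 0 W v; rewrite /= q0r L0r L0l !subr0.
by rewrite (linear_form0 (Psi_lin _ _ _ _)) add0r => <-; rewrite addrC subrK.
Qed.

Let g'E chi kappa W v : g' chi kappa W v = g 0 0 W v - Psi 0 0 chi W v.
Proof.
have := polarized 0 0 chi kappa W v; rewrite /= q0l L0r L0l !subr0.
by rewrite (linear_form0 (Psi'_lin _ _ _ _)) addr0 => <-; rewrite opprB addrC subrK.
Qed.

Let g0E W v : g' 0 0 W v = g 0 0 W v.
Proof. by rewrite g'E (linear_form0 (Psi_lin _ _ _ _)) subr0. Qed.

Let shift zeta eta chi W v :
  Psi zeta eta chi W v - Psi zeta 0 chi W (v - L eta chi) =
  g zeta 0 W v - g zeta 0 W (v - L eta chi).
Proof.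
have := polarized zeta eta chi 0 W v; have := polarized zeta 0 chi 0 W (v - L eta chi).
rewrite /= !L0l !subr0 (gE zeta eta) -(gE zeta 0).
move=> /eqP; rewrite subr_eq => /eqP -> /eqP; rewrite subr_eq => /eqP ->.
by ring.
Qed.

(** Cast in the form of [Psi_shift], with [- L] and [- g'] for [L] and [g], so that the tail
    argument applies to the conjugate field too. *)
Let shift' chi kappa zeta W v :
  Psi' chi kappa zeta W v - Psi' chi 0 zeta W (v - - L kappa zeta) =
  - g' chi 0 W v - - g' chi 0 W (v - - L kappa zeta).
Proof.
have := polarized zeta 0 chi kappa (W + q zeta chi) (v + L kappa zeta).
have := polarized zeta 0 chi 0 (W + q zeta chi) (v + L kappa zeta).
have kE : g' chi kappa W v = g' chi 0 W v by rewrite !g'E.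
rewrite /= !L0l !subr0 !opprK !addrK kE => E1 E2.
set B := Psi _ _ _ _ _ in E1 E2.
transitivity ((B + Psi' chi kappa zeta W v) - (B + Psi' chi 0 zeta W (v + L kappa zeta))).
  by ring.
by rewrite -E1 -E2; ring.
Qed.

Let polyPsi0 zeta eta chi W v : polyfun (fun t => Psi zeta (t *: eta) chi W v).
Proof.
apply: polyfun_ext (Psi_poly zeta 0 0 eta chi W 0 v 0) => t.
by rewrite !scaler0 !addr0 add0r.
Qed.

Let polyPsi'0 zeta eta chi W v : polyfun (fun t => Psi' zeta (t *: eta) chi W v).
Proof.
apply: polyfun_ext (Psi'_poly zeta 0 0 eta chi W 0 v 0) => t.
by rewrite !scaler0 !addr0 add0r.
Qed.

Let Psi0 zeta chi W v : Psi zeta 0 chi W v = Psi zeta 0 chi W 0.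
Proof.
exact: (tail_independent LZl LZr Psi_lin polyPsi0 shift span Lsurj).
Qed.

Let Psi'0 chi zeta W v : Psi' chi 0 zeta W v = Psi' chi 0 zeta W 0.
Proof.
apply: (tail_independent (L := fun x y => - L x y) _ _ Psi'_lin polyPsi'0 shift' span).
- by move=> a x y; rewrite LZl scalerN.
- by move=> a x y; rewrite LZr scalerN.
- by move=> c l; have [eta he] := Lsurj c (- l); exists eta; rewrite he opprK.
Qed.

Let Phi zeta chi W := Psi zeta 0 chi W 0.
Let Phi' chi zeta W := Psi' chi 0 zeta W 0.
Let h W := g 0 0 W 0.

Let Phi_eq_v zeta chi W v :
  Phi zeta chi W + Phi' chi zeta (W - q zeta chi) =
  g 0 0 W v - g 0 0 (W - q zeta chi) v + Phi' 0 zeta W + Phi 0 chi (W - q zeta chi).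
Proof.
have := polarized zeta 0 chi 0 W v.
rewrite /= !L0l !subr0 (gE zeta) (g'E chi) g0E !Psi0 !Psi'0 -/(Phi _ _ _) -/(Phi _ _ _) => eq0.
by rewrite -eq0 /Phi /Phi'; ring.
Qed.

Let Phi_eq zeta chi W := Phi_eq_v zeta chi W 0.

Let h1 v := g 0 0 0 v - g 0 0 0 0.

(** The left side of [Phi_eq_v] is free of [v], so the dependence of [g 0 0] on [v] is unchanged
    when a rank-one matrix is subtracted from [W]; two subtractions reach [W = 0]. *)
Let gh W v : g 0 0 W v = h W + h1 v.
Proof.
have step W1 zeta chi : g 0 0 W1 v - h W1 = g 0 0 (W1 - q zeta chi) v - h (W1 - q zeta chi).
  have := Phi_eq_v zeta chi W1 v; rewrite (Phi_eq_v zeta chi W1 0).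
  move=> /addIr /addIr e; transitivity (g 0 0 W1 v - g 0 0 (W1 - q zeta chi) v
    + g 0 0 (W1 - q zeta chi) v - h W1); first by ring.
  by rewrite -e /h; ring.
have [x [y hW]] := rows W.
have := step W e1 y; rewrite hW addrK (step (q e0 x) e0 x) subrr => e.
by rewrite /h1 -/(h 0) -e; ring.
Qed.

(** In the shift relation, scaling [e0] by [s] moves [v] by [s] times an arbitrary vector, while the
    [Psi] side is linear in [s]. *)
Let h1Z t l : h1 (t *: l) = t * h1 l.
Proof.
have lin l' : exists c, forall t, h1 (- (t *: l')) = t * c.
  have [eta he] := Lsurj 0 l'; rewrite scale0r addr0 in he.
  exists (- (Psi 0 eta e0 0 0 - Psi 0 0 e0 0 0)) => s.
  have := shift 0 eta (s *: e0) 0 0; rewrite LZr he sub0r Psi0 !gh.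
  rewrite !(linear_formZ _ _ (Psi_lin _ _ _ _)) => /eqP.
  rewrite -mulrBr => /eqP e; rewrite mulrN e {2}/h1 subrr; ring.
have [c hc] := lin (- l).
have e s : h1 (s *: l) = s * c by have := hc s; rewrite scalerN opprK.
by have := e 1; rewrite scale1r mul1r => ->; exact: e.
Qed.

Let Phi_lin zeta W : linear_form (fun chi => Phi zeta chi W).
Proof. exact: Psi_lin. Qed.

Let Phi'_lin zeta W : linear_form (fun chi => Phi' zeta chi W).
Proof. exact: Psi'_lin. Qed.

Let Phi_poly zeta zeta' chi W W' :
  polyfun (fun t => Phi (zeta + t *: zeta') chi (W + t *: W')).
Proof.
apply: polyfun_ext (Psi_poly zeta zeta' 0 0 chi W W' 0 0) => t.
by rewrite !scaler0 !addr0.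
Qed.

Let Phi'_poly zeta zeta' chi W W' :
  polyfun (fun t => Phi' (zeta + t *: zeta') chi (W + t *: W')).
Proof.
apply: polyfun_ext (Psi'_poly zeta zeta' 0 0 chi W W' 0 0) => t.
by rewrite !scaler0 !addr0.
Qed.

Lemma Psi_deg4 zeta eta chi W v :
  deg_le 4 (fun t => Psi (t *: zeta) (t *: eta) chi (t *: W) (t *: v)).
Proof.
apply: (@deg_le_ext _ _ (fun t => Phi (t *: zeta) chi (t *: W) +
  t * (h1 v - h1 (v - L eta chi)))).
  move=> t; have /eqP := shift (t *: zeta) (t *: eta) chi (t *: W) (t *: v).
  rewrite Psi0 !gE !g0E !gh !Psi'0 LZl -scalerBr !h1Z subr_eq => /eqP ->.
  by rewrite /Phi; ring.
apply: deg_leD; last by apply: deg_leX; apply: deg_leW (deg_le_cst _).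
exact: (Phi_deg4 qDl qDr Phi_lin Phi'_lin Phi_poly Phi'_poly Phi_eq span rows cols).
Qed.

Lemma g_deg4 zeta eta W v :
  deg_le 4 (fun t => g (t *: zeta) (t *: eta) (t *: W) (t *: v)).
Proof.
apply: (@deg_le_ext _ _ (fun t => h (0 + t *: W) + t * h1 v + t * Phi' 0 zeta (0 + t *: W))).
  by move=> t; rewrite gE g0E gh Psi'0 h1Z (linear_formZ _ _ (Psi'_lin _ _ _ _)) add0r.
apply: deg_leD; first apply: deg_leD.
- exact: (h_deg4 qDl qDr Phi_lin Phi'_lin Phi_poly Phi'_poly Phi_eq rows).
- by apply: deg_leX; apply: deg_leW (deg_le_cst _).
- apply: deg_leX.
  exact: (Phi'_deg3 qDl qDr Phi_lin Phi'_lin Phi_poly Phi'_poly Phi_eq span rows).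
Qed.

End DegreeBound.

(** * The model quadric *)

(** Testing on all polynomial curves is stable under linear substitution and conjugation, and
    restricts to one variable at once. *)
Definition polymap (C : numClosedFieldType) (N : nat) (P : 'rV[C]_N -> C) :=
  forall x : C -> 'rV[C]_N, (forall i, polyfun (fun t => x t 0 i)) ->
  polyfun (fun t => P (x t)).

Lemma polyfun_conj (C : numClosedFieldType) (p : C -> C) :
  polyfun p -> polyfun (fun t => (p t^*)^*).
Proof.
case=> P hP; exists (map_poly Num.conj P) => t.
by rewrite hP -[in RHS](conjCK t) horner_map.
Qed.

Lemma polyfun_real0 (C : numClosedFieldType) (p : C -> C) :
  polyfun p -> (forall t, t \is Num.real -> p t = 0) -> forall t, p t = 0.
Proof.
move=> [P hP] p0 t; rewrite hP.
suff -> : P = 0 by rewrite horner0.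
by apply: poly_eq_natS => i; rewrite horner0 -hP p0 ?realn.
Qed.

Section Model.
Variables (C : numClosedFieldType) (m : nat).
Local Notation n := (m.+4).
Local Notation k := (m.+4.+1).

Definition coord N (z : 'rV[C]_N.+1) (i : nat) : C := z 0 (inord i).

(* On the quadric the matrix [[w0, (w2 - 'i w3) / 2], [(w2 + 'i w3) / 2, w1]]
   has skew-Hermitian part ['i zeta zeta^*], where [zeta] is the column [(z0, z1)];
   each further equation pairs other coordinates of [z] with [zeta]. *)
Definition model_form (j : nat) (u v : nat -> C) : C :=
  match j with
  | 0 => u 0%N * v 0%N
  | 1 => u 1%N * v 1%N
  | 2 => u 0%N * v 1%N + u 1%N * v 0%N
  | 3 => 'i * (u 0%N * v 1%N - u 1%N * v 0%N)
  | 4 => u 2%N * v 0%N + u 0%N * v 2%N + (u 3%N * v 1%N + u 1%N * v 3%N)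
  | j'.+4.+1 => u j'.+4 * v 0%N + u 0%N * v j'.+4
  end.

Definition model (j : 'I_k) : 'M[C]_n :=
  \matrix_(a, b) model_form j (fun i => (i == a)%:R) (fun i => (i == b)%:R).

Lemma model_formE (j : 'I_k) (u v : 'rV[C]_n) :
  (u *m model j *m v^t*) 0 0 = model_form j (coord u) (fun i => (coord v i)^* ).
Proof.
have delta (x : 'rV[C]_n) i : (i < n)%N -> coord x i = \sum_(a < n) x 0 a * (i == a :> nat)%:R.
  move=> hi; rewrite (bigD1 (inord i)) //= inordK // eqxx mulr1 big1 ?addr0 // => a.
  rewrite -val_eqE /= inordK // eq_sym => /negbTE ->.
  by rewrite mulr0.
have hj := ltn_ord j.
have bil a b : (a < n)%N -> (b < n)%N ->
    coord u a * (coord v b)^* =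
    \sum_(d < n) (\sum_(c < n) u 0 c * ((a == c)%:R * (b == d)%:R)) * (v 0 d)^*.
  move=> ha hb; rewrite !delta // rmorph_sum mulr_sumr; apply: eq_bigr => d _ /=.
  rewrite rmorphM rmorph_nat [_^* * _]mulrC mulrA; congr (_ * _).
  by rewrite mulr_suml; apply: eq_bigr => c _; rewrite mulrA.
rewrite mxE; transitivity (\sum_(d < n) (\sum_(c < n) u 0 c *
  model_form j (fun i => (i == c)%:R) (fun i => (i == d)%:R)) * (v 0 d)^* ).
  by apply: eq_bigr => d _; rewrite !mxE; congr (_ * _); apply: eq_bigr => c _; rewrite mxE.
have addE (f g : 'I_n -> 'I_n -> C) :
    \sum_(d < n) (\sum_(c < n) u 0 c * (f c d + g c d)) * (v 0 d)^* =
    \sum_(d < n) (\sum_(c < n) u 0 c * f c d) * (v 0 d)^* +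
    \sum_(d < n) (\sum_(c < n) u 0 c * g c d) * (v 0 d)^*.
  rewrite -big_split /=; apply: eq_bigr => d _; rewrite -mulrDl -big_split /=.
  by congr (_ * _); apply: eq_bigr => c _; rewrite mulrDr.
have scaleE a (f : 'I_n -> 'I_n -> C) :
    \sum_(d < n) (\sum_(c < n) u 0 c * (a * f c d)) * (v 0 d)^* =
    a * \sum_(d < n) (\sum_(c < n) u 0 c * f c d) * (v 0 d)^*.
  rewrite mulr_sumr; apply: eq_bigr => d _; rewrite mulrA; congr (_ * _).
  by rewrite mulr_sumr; apply: eq_bigr => c _; rewrite mulrCA.
case: j hj => [[|[|[|[|[|j]]]]] /= _] hj; rewrite ?addE -?bil //.
rewrite scaleE; congr (_ * _); rewrite -[- _ in RHS]mulN1r !bil // -scaleE -addE.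
apply: eq_bigr => d _; congr (_ * _); apply: eq_bigr => c _; congr (_ * _).
by rewrite mulN1r.
Qed.

Lemma model_form_conj j (u v : nat -> C) :
  (model_form j u v)^* = model_form j (fun i => (v i)^* ) (fun i => (u i)^* ).
Proof.
case: j => [|[|[|[|[|j]]]]] /=; rewrite ?(rmorphM, rmorphD, rmorphB) /= ?conjCi;
  ring.
Qed.

Lemma polyfun_model_form j (u v : C -> nat -> C) :
  (forall i, polyfun (u^~ i)) -> (forall i, polyfun (v^~ i)) ->
  polyfun (fun t => model_form j (u t) (v t)).
Proof.
by move=> hu hv; case: j => [|[|[|[|[|j]]]]] /=;
  repeat first [exact: hu | exact: hv | exact: polyfun_cst
               | apply: polyfunB | apply: polyfunD | apply: polyfunM].
Qed.

(** The complexified forms: [chi] is an independent variable standing for the conjugate of [z], so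
    nothing is conjugated. *)
Definition pairing (z chi : 'rV[C]_n) : 'rV[C]_k :=
  \row_j model_form j (coord z) (coord chi).

Definition conj_fun N (P : 'rV[C]_N -> C) x := (P (map_mx Num.conj x))^*.

Lemma polymap_conj N (P : 'rV[C]_N -> C) : polymap P -> polymap (conj_fun P).
Proof.
move=> hP x hx.
apply: polyfun_ext (polyfun_conj (hP (fun t => map_mx Num.conj (x t^* )) _)) => [t|i].
  by rewrite conjCK.
by apply: polyfun_ext (polyfun_conj (hx i)) => t; rewrite mxE.
Qed.

Lemma polyfun_row_mx n1 n2 (x : C -> 'rV[C]_n1) (y : C -> 'rV[C]_n2) :
  (forall i, polyfun (fun t => x t 0 i)) -> (forall i, polyfun (fun t => y t 0 i)) ->
  forall i, polyfun (fun t => row_mx (x t) (y t) 0 i).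
Proof.
move=> hx hy i; case: (split_ordP i) => j ->.
  by apply: polyfun_ext (hx j) => t; rewrite row_mxEl.
by apply: polyfun_ext (hy j) => t; rewrite row_mxEr.
Qed.

Lemma coord_row N (F : nat -> C) i :
  (i < N.+1)%N -> coord (\row_(j < N.+1) F j) i = F i.
Proof. by move=> hi; rewrite /coord mxE inordK. Qed.

Lemma row_coord N (z : 'rV[C]_N.+1) : z = \row_j coord z j.
Proof. by apply/rowP => j; rewrite mxE /coord inord_val. Qed.

Definition zvec (zeta : 'rV[C]_2) (eta : 'rV[C]_(m.+2)) : 'rV[C]_n :=
  \row_(j < n) match nat_of_ord j with
    | 0 => zeta 0 0 | 1 => zeta 0 1 | j'.+2 => coord eta j' end.

Definition wvec (W : 'M[C]_2) (v : 'rV[C]_(m.+1)) : 'rV[C]_k :=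
  \row_(j < k) match nat_of_ord j with
    | 0 => W 0 0 | 1 => W 1 1 | 2 => W 0 1 + W 1 0 | 3 => 'i * (W 0 1 - W 1 0)
    | j'.+4 => coord v j' end.

(** Half of the forms with index at least 4; the other half arises by exchanging the two points. *)
Definition tail (eta : 'rV[C]_(m.+2)) (chi : 'rV[C]_2) : 'rV[C]_(m.+1) :=
  \row_(j < m.+1) match nat_of_ord j with
    | 0 => coord eta 0 * chi 0 0 + coord eta 1 * chi 0 1
    | j'.+1 => coord eta j'.+2 * chi 0 0 end.

(* The factor [2 'i] absorbs the one in [w - conj w = 2 'i * 'Im w]. *)
Definition point zeta eta W v : 'rV[C]_(n + k) :=
  row_mx (zvec zeta eta) (2 * 'i *: wvec W v).

Lemma coord_zvec zeta eta i : (i < n)%N -> coord (zvec zeta eta) i =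
  match i with 0 => zeta 0 0 | 1 => zeta 0 1 | j'.+2 => coord eta j' end.
Proof. by move=> hi; rewrite /coord mxE inordK. Qed.

Lemma pairing_zvec zeta eta chi kappa :
  pairing (zvec zeta eta) (zvec chi kappa) =
  wvec (zeta^T *m chi) (tail eta chi + tail kappa zeta).
Proof.
apply/rowP => -[j hj]; rewrite !mxE /=.
case: j hj => [|[|[|[|[|j]]]]] hj /=; rewrite !coord_zvec ?(mxE, big_ord1) //.
- by rewrite /= [coord (_ + _) _]/coord !mxE inordK //=; ring.
- by rewrite [coord (_ + _) _]/coord !mxE inordK //=; ring.
Qed.

Lemma wvecB W W' v v' : wvec W v - wvec W' v' = wvec (W - W') (v - v').
Proof.
apply/rowP => -[j hj]; rewrite !mxE /=.
by case: j hj => [|[|[|[|j]]]] hj; rewrite /coord ?mxE //; ring.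
Qed.

Lemma pointZ t zeta eta W v :
  point (t *: zeta) (t *: eta) (t *: W) (t *: v) = t *: point zeta eta W v.
Proof.
rewrite /point scale_row_mx; congr row_mx; apply/rowP => -[j hj]; rewrite !mxE /=.
  by case: j hj => [|[|j]] hj; rewrite /coord ?mxE.
by case: j hj => [|[|[|[|j]]]] hj; rewrite /coord ?mxE //; ring.
Qed.

Lemma point_surj x : exists zeta eta W v, x = point zeta eta W v.
Proof.
pose z := coord (lsubmx x); pose w := coord (rsubmx x).
have i2 : 'i != 0 :> C by exact: neq0Ci.
exists (\row_(j < 2) z j), (\row_(j < m.+2) z j.+2).
exists (\matrix_(a < 2, b < 2) ((2 * 'i)^-1 *
  if (a == 0) && (b == 0) then w 0 else if (a == 1) && (b == 1) then w 1
  else if a == 0 then (w 2 - 'i * w 3) / 2 else (w 2 + 'i * w 3) / 2)).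
exists (\row_(j < m.+1) ((2 * 'i)^-1 * w j.+4)).
rewrite -[x in LHS]hsubmxK /point [lsubmx x]row_coord [rsubmx x]row_coord -/z -/w.
congr row_mx; apply/rowP => -[j hj]; rewrite !mxE /=.
  by case: j hj => [|[|j]] hj //=; rewrite ?mxE // (coord_row (fun j => z j.+2)).
have ii : 'i * 'i = -1 :> C by rewrite -expr2 sqrCi.
case: j hj => [|[|[|[|j]]]] hj /=; rewrite ?mxE /=.
- by field; rewrite ?i2 ?pnatr_eq0.
- by field; rewrite ?i2 ?pnatr_eq0.
- by field; rewrite ?i2 ?pnatr_eq0.
- transitivity (- ('i * 'i) * w 3); first by rewrite ii; ring.
  by field; rewrite ?i2 ?pnatr_eq0.
- by rewrite (coord_row (fun j => (2 * 'i)^-1 * w j.+4)) //; field; rewrite ?i2 ?pnatr_eq0.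
Qed.

Lemma polyfun_point zeta zeta' eta eta' W W' v v' i : polyfun (fun t =>
  point (zeta + t *: zeta') (eta + t *: eta') (W + t *: W') (v + t *: v') 0 i).
Proof.
have aff a b : polyfun (fun t : C => a + t * b).
  by apply: polyfunD (polyfun_cst _) (polyfunM (polyfun_id _) (polyfun_cst _)).
apply: polyfun_row_mx => {}i.
  case: i => [[|[|i]] hi].
  - by apply: polyfun_ext (aff (zeta 0 0) (zeta' 0 0)) => t; rewrite !mxE.
  - by apply: polyfun_ext (aff (zeta 0 1) (zeta' 0 1)) => t; rewrite !mxE.
  - by apply: polyfun_ext (aff (coord eta i) (coord eta' i)) => t;
    rewrite [RHS]mxE /= /coord !mxE.
apply: polyfun_ext (polyfunM (polyfun_cst (2 * 'i))
  (aff (wvec W v 0 i) (wvec W' v' 0 i))) => t.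
rewrite !mxE; congr (_ * _).
by case: i => [[|[|[|[|i]]]] hi]; rewrite /coord /= ?mxE //; ring.
Qed.

(** * The scalar tangency equation and its polarization *)

Section ScalarEquation.
Variables G P0 P1 : 'rV[C]_(n + k) -> C.
Hypotheses (Gpoly : polymap G) (P0poly : polymap P0) (P1poly : polymap P1).
Hypothesis onM : forall x, quadric model x ->
  'Im (G x) = 2 * 'Re (P0 x * (coord (lsubmx x) 0)^* + P1 x * (coord (lsubmx x) 1)^* ).

Let defect (z chi : 'rV[C]_n) (w w' : 'rV[C]_k) :=
  G (row_mx z w) - conj_fun G (row_mx chi w') -
  2 * 'i * (P0 (row_mx z w) * coord chi 0 + P1 (row_mx z w) * coord chi 1 +
    (conj_fun P0 (row_mx chi w') * coord z 0 + conj_fun P1 (row_mx chi w') * coord z 1)).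

(** For real [p], [r], [u] the vector [chi] is conjugate to [z] and the first point lies on the
    quadric: a polynomial parametrization of the quadric by real vectors. *)
Let defect_param (p r : 'rV[C]_n) (u : 'rV[C]_k) :=
  let z := p + 'i *: r in let chi := p - 'i *: r in
  defect z chi (u + 'i *: pairing z chi) (u - 'i *: pairing z chi).

Let defect_real p r u : map_mx Num.conj p = p -> map_mx Num.conj r = r ->
  map_mx Num.conj u = u -> defect_param p r u = 0.
Proof.
move=> hp hr hu; rewrite /defect_param; set z := p + _; set chi := p - _; set b := pairing _ _.
have hchi : chi = map_mx Num.conj z.
  by rewrite /z /chi map_mxD map_mxZ /= hp hr conjCi scaleNr.
clearbody z chi.
have hc i : coord chi i = (coord z i)^* by rewrite hchi /coord mxE.
have hb : map_mx Num.conj b = b.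
  apply/rowP => j; rewrite !mxE model_form_conj hchi.
  by congr model_form; apply/funext => i; rewrite /coord mxE ?conjCK.
set w := u + _.
have -> : u - 'i *: b = map_mx Num.conj w.
  by rewrite /w map_mxD map_mxZ /= hu hb conjCi scaleNr.
have hM : quadric model (row_mx z w).
  move=> j; rewrite row_mxKl row_mxKr model_formE.
  have -> : model_form j (coord z) (fun i => (coord z i)^* ) = b 0 j.
    by rewrite mxE; congr model_form; apply/funext => i; rewrite hc.
  have ru : (u 0 j)^* = u 0 j by rewrite -{2}hu mxE.
  have rb : (b 0 j)^* = b 0 j by have /rowP/(_ j) := hb; rewrite [in LHS]mxE.
  by rewrite /w mxE [('i *: b) 0 j]mxE Im_rect // CrealE ?ru ?rb.
have := onM hM; rewrite row_mxKl ImE ReE.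
rewrite /defect /conj_fun hchi -map_row_mx; set x := row_mx z w.
have -> : map_mx Num.conj (map_mx Num.conj x) = x.
  by apply/rowP => i; rewrite !mxE conjCK.
have hzc i : coord (map_mx Num.conj z) i = (coord z i)^* by rewrite /coord mxE.
rewrite !hzc rmorphD !rmorphM /= !conjCK.
set a := G x; set c := (G x)^*; set S := _ + (_ + _) => E.
have E2 : 'i * (c - a) = 2 * S.
  have -> : 2 * S = 2 * (2 * (S / 2)) by field; rewrite ?pnatr_eq0.
  by rewrite -E; field; rewrite ?pnatr_eq0.
have ii : 'i * 'i = -1 :> C by rewrite -expr2 sqrCi.
transitivity (a - c - 'i * (2 * S)); last first.
  by rewrite -E2 mulrA ii; ring.
by congr (_ - _); rewrite /S; ring.
Qed.

(** Along [re + t im] the defect is a polynomial in [t] that vanishes at real [t], hence also at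
    [t = 'i], where the given complex vectors are recovered. *)
Let defect0 p r u : defect_param p r u = 0.
Proof.
pose re N (x : 'rV[C]_N) := map_mx (fun a => 'Re a) x.
pose im N (x : 'rV[C]_N) := map_mx (fun a => 'Im a) x.
have rect N (x : 'rV[C]_N) : x = re _ x + 'i *: im _ x.
  by apply/rowP => i; rewrite !mxE -Crect.
have recl N (x : 'rV[C]_N) (t : C) : t \is Num.real ->
    map_mx Num.conj (re _ x + t *: im _ x) = re _ x + t *: im _ x.
  move=> ht; apply/rowP => i; rewrite !mxE; apply: conj_Creal.
  by rewrite rpredD ?rpredM ?Creal_Re ?Creal_Im.
rewrite (rect _ p) (rect _ r) (rect _ u).
pose path N (x : 'rV[C]_N) t := re _ x + t *: im _ x.
apply: (@polyfun_real0 _ (fun t => defect_param (path _ p t) (path _ r t) (path _ u t)));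
  last first.
  by move=> t ht; apply: defect_real; apply: recl.
have hpath N (x : 'rV[C]_N) i : polyfun (fun t => path _ x t 0 i).
  apply: (@polyfun_ext _ (fun t => re _ x 0 i + t * im _ x 0 i)).
    by move=> t; rewrite /path !mxE.
  by apply: polyfunD; [|apply: polyfunM]; do ?exact: polyfun_cst; exact: polyfun_id.
have hz a i : polyfun (fun t => (path _ p t + a *: path _ r t) 0 i).
  apply: (@polyfun_ext _ (fun t => path _ p t 0 i + a * path _ r t 0 i)).
    by move=> t; rewrite !mxE.
  by apply: polyfunD => //; apply: polyfunM => //; exact: polyfun_cst.
pose z t := path _ p t + 'i *: path _ r t.
pose chi t := path _ p t - 'i *: path _ r t.
have pz i : polyfun (fun t => z t 0 i) by exact: hz.
have pchi i : polyfun (fun t => chi t 0 i).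
  by apply: polyfun_ext (hz (- 'i) i) => t; rewrite /chi scaleNr.
have hw a i : polyfun (fun t => (path _ u t + a *: pairing (z t) (chi t)) 0 i).
  apply: (@polyfun_ext _ (fun t => path _ u t 0 i +
    a * model_form i (coord (z t)) (coord (chi t)))).
    by move=> t; rewrite !mxE.
  apply: polyfunD => //; apply: polyfunM; first exact: polyfun_cst.
  by apply: polyfun_model_form => j; rewrite /coord.
pose w t := path _ u t + 'i *: pairing (z t) (chi t).
pose w' t := path _ u t - 'i *: pairing (z t) (chi t).
have pw i : polyfun (fun t => w t 0 i) by exact: hw.
have pw' i : polyfun (fun t => w' t 0 i).
  by apply: polyfun_ext (hw (- 'i) i) => t; rewrite /w' scaleNr.
have pzw := polyfun_row_mx pz pw; have pzw' := polyfun_row_mx pchi pw'.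
rewrite /defect_param -/(z _) /defect.
repeat first [apply: polyfunB | apply: polyfunD | apply: polyfunM | apply: polyfun_cst
  | by apply: Gpoly | by apply: P0poly | by apply: P1poly | exact: pz | exact: pchi
  | by apply: (polymap_conj Gpoly) | by apply: (polymap_conj P0poly) | by apply: (polymap_conj P1poly) ].
Qed.

Lemma polarized_equation z chi w : let w' := w - 2 * 'i *: pairing z chi in
  G (row_mx z w) - conj_fun G (row_mx chi w') =
  2 * 'i * (P0 (row_mx z w) * coord chi 0 + P1 (row_mx z w) * coord chi 1 +
    (conj_fun P0 (row_mx chi w') * coord z 0 + conj_fun P1 (row_mx chi w') * coord z 1)).
Proof.
move=> w'; apply/eqP; rewrite -subr_eq0; apply/eqP.
(* The arguments solve [p + 'i r = z], [p - 'i r = chi] and [u + 'i pairing z chi = w]. *)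
have := defect0 (2^-1 *: (z + chi)) ((2 * 'i)^-1 *: (z - chi)) (w - 'i *: pairing z chi).
have i2 : 'i != 0 :> C by exact: neq0Ci.
have e1 : 2^-1 *: (z + chi) + 'i *: ((2 * 'i)^-1 *: (z - chi)) = z.
  by apply/rowP => i; rewrite !mxE; field; rewrite ?i2 ?pnatr_eq0.
have e2 : 2^-1 *: (z + chi) - 'i *: ((2 * 'i)^-1 *: (z - chi)) = chi.
  by apply/rowP => i; rewrite !mxE; field; rewrite ?i2 ?pnatr_eq0.
rewrite /defect_param e1 e2 subrK.
have -> // : w - 'i *: pairing z chi - 'i *: pairing z chi = w'.
by rewrite /w' -addrA -opprD -scalerDl; congr (_ - _ *: _); ring.
Qed.

Let g zeta eta W v := G (point zeta eta W v) / (2 * 'i).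
Let g' zeta eta W v := conj_fun G (point zeta eta W v) / (2 * 'i).
Let Psi zeta eta (chi : 'rV[C]_2) W v :=
  P0 (point zeta eta W v) * chi 0 0 + P1 (point zeta eta W v) * chi 0 1.
Let Psi' zeta eta (chi : 'rV[C]_2) W v :=
  conj_fun P0 (point zeta eta W v) * chi 0 0 + conj_fun P1 (point zeta eta W v) * chi 0 1.
Let q (zeta chi : 'rV[C]_2) : 'M[C]_2 := zeta^T *m chi.

Let polarized zeta eta chi kappa W v :
  let W' := W - q zeta chi in let v' := v - tail eta chi - tail kappa zeta in
  g zeta eta W v - g' chi kappa W' v' = Psi zeta eta chi W v + Psi' chi kappa zeta W' v'.
Proof.
move=> W' v'.
have := polarized_equation (zvec zeta eta) (zvec chi kappa) (2 * 'i *: wvec W v).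
rewrite /= pairing_zvec -scalerBr wvecB opprD addrA -/(q _ _) -/W' -/v'.
rewrite -/(point zeta eta W v) -/(point chi kappa W' v') !coord_zvec //= => E.
have i2 : 2 * 'i != 0 :> C by rewrite mulf_neq0 ?pnatr_eq0 ?neq0Ci.
by rewrite /g /g' -mulrBl E mulrC mulKf.
Qed.

Let e0 : 'rV[C]_2 := delta_mx 0 0.
Let e1 : 'rV[C]_2 := delta_mx 0 1.

Lemma scalar_equation_degree x : [/\ deg_le 4 (fun t => G (t *: x)),
  deg_le 4 (fun t => P0 (t *: x)) & deg_le 4 (fun t => P1 (t *: x))].
Proof.
have qDl a x1 y1 z1 : q (x1 + a *: y1) z1 = q x1 z1 + a *: q y1 z1.
  by rewrite /q linearD linearZ /= mulmxDl -scalemxAl.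
have qDr a x1 y1 z1 : q x1 (y1 + a *: z1) = q x1 y1 + a *: q x1 z1.
  by rewrite /q mulmxDr -scalemxAr.
have LZl a x1 y1 : tail (a *: x1) y1 = a *: tail x1 y1.
  by apply/rowP => -[[|j] hj]; rewrite !mxE /= /coord !mxE; ring.
have LZr a x1 y1 : tail x1 (a *: y1) = a *: tail x1 y1.
  by apply/rowP => -[[|j] hj]; rewrite !mxE /= /coord ?mxE; ring.
have span u : exists a b, u = a *: e0 + b *: e1.
  exists (u 0 0), (u 0 1); apply/rowP => -[[|[|j]] hj] //; rewrite !mxE /=.
    by rewrite mulr1 mulr0 addr0; congr (u _ _); apply/val_inj.
  by rewrite mulr1 mulr0 add0r; congr (u _ _); apply/val_inj.
have Lsurj c l : exists eta, tail eta (e0 + c *: e1) = l.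
  (* The zero in slot 1 removes [c] from the first tail coordinate; the other slots meet the entry 1
     of [e0 + c e1]. *)
  pose eta j : C := match j with 0 => coord l 0 | 1 => 0 | j'.+2 => coord l j'.+1 end.
  exists (\row_(j < m.+2) eta j).
  apply/rowP => -[[|j] hj]; rewrite !mxE /= !(coord_row eta) //= ?mxE /=.
    rewrite mul0r addr0 mulr0 addr0 mulr1 /coord; congr (l _ _).
    by apply/val_inj; rewrite /= inordK.
  rewrite mulr0 addr0 mulr1 /coord; congr (l _ _).
  by apply/val_inj; rewrite /= inordK.
have rows W : exists x1 y1, W = q e0 x1 + q e1 y1.
  exists (row 0 W), (row 1 W); apply/matrixP => a b; rewrite !mxE !big_ord1 !mxE /=.
  case: a => [[|[|a]] ha] //=; rewrite ?mul1r ?mul0r ?addr0 ?add0r.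
    by congr (W _ _); apply/val_inj.
  by congr (W _ _); apply/val_inj.
have cols W : exists x1 y1, W = q x1 e0 + q y1 e1.
  exists (col 0 W)^T, (col 1 W)^T; apply/matrixP => a b; rewrite !mxE !big_ord1 !mxE /=.
  case: b => [[|[|b]] hb] //=; rewrite ?mulr1 ?mulr0 ?addr0 ?add0r.
    by congr (W _ _); apply/val_inj.
  by congr (W _ _); apply/val_inj.
have Psi_lin zeta eta W v : linear_form (fun chi => Psi zeta eta chi W v).
  by move=> a x1 y1; rewrite /Psi !mxE; ring.
have Psi'_lin zeta eta W v : linear_form (fun chi => Psi' zeta eta chi W v).
  by move=> a x1 y1; rewrite /Psi' !mxE; ring.
have Psi_poly zeta zeta' eta eta' chi W W' v v' : polyfun (fun t =>
    Psi (zeta + t *: zeta') (eta + t *: eta') chi (W + t *: W') (v + t *: v')).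
  by apply: polyfunD; apply: polyfunM (polyfun_cst _);
    [apply: P0poly | apply: P1poly] => i; exact: polyfun_point.
have Psi'_poly zeta zeta' eta eta' chi W W' v v' : polyfun (fun t =>
    Psi' (zeta + t *: zeta') (eta + t *: eta') chi (W + t *: W') (v + t *: v')).
  by apply: polyfunD; apply: polyfunM (polyfun_cst _);
    [apply: (polymap_conj P0poly) | apply: (polymap_conj P1poly)] => i; exact: polyfun_point.
have [zeta [eta [W [v ->]]]] := point_surj x.
have Pdeg chi := Psi_deg4 qDl qDr LZl LZr span Lsurj rows cols Psi_lin Psi'_lin
  Psi_poly Psi'_poly polarized zeta eta chi W v.
split.
- apply: deg_le_ext (deg_leZ (2 * 'i) (g_deg4 qDl qDr LZl LZr span Lsurj rows
    Psi_lin Psi'_lin Psi_poly Psi'_poly polarized zeta eta W v)) => t.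
  by rewrite /g pointZ mulrC divfK // mulf_neq0 ?pnatr_eq0 ?neq0Ci.
- apply: deg_le_ext (Pdeg e0) => t.
  by rewrite /Psi pointZ !mxE /= mulr1 mulr0 addr0.
- apply: deg_le_ext (Pdeg e1) => t.
  by rewrite /Psi pointZ !mxE /= mulr1 mulr0 add0r.
Qed.

End ScalarEquation.

End Model.

(** * Weighted expansions of convergent power series *)

Section Expansion.
Variables (C : numClosedFieldType) (N : nat).
Implicit Types (al : multi_index N) (x y p : 'rV[C]_N).

Definition box (b : nat) : seq (multi_index N) :=
  [seq [ffun i => nat_of_ord (be i)] | be : {ffun 'I_N -> 'I_b} <- enum {: {ffun 'I_N -> 'I_b}}].

Lemma mem_box b al : (al \in box b) = [forall i, al i < b]%N.
Proof.
apply/mapP/forallP => [[be _ ->] i|h]; first by rewrite ffunE.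
by exists [ffun i => Ordinal (h i)]; rewrite ?mem_enum //; apply/ffunP => i; rewrite !ffunE.
Qed.

Lemma box_uniq b : uniq (box b).
Proof.
rewrite map_inj_uniq ?enum_uniq // => a1 a2 /ffunP e; apply/ffunP => i.
by apply/val_inj; have := e i; rewrite !ffunE.
Qed.

Lemma partial_sumE (V : nmodType) (u : multi_index N -> V) b :
  partial_sum u b = \sum_(al <- box b) u al.
Proof. by rewrite big_map big_enum. Qed.

Lemma partial_sum_widen (V : nmodType) (u : multi_index N -> V) a b : (a <= b)%N ->
  (forall al, u al != 0 -> forall i, (al i < a)%N) -> partial_sum u b = partial_sum u a.
Proof.
move=> ab hu; rewrite !partial_sumE (bigID (mem (box a))) /=.
rewrite [X in _ + X]big1 ?addr0 => [|al nal]; last first.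
  apply/eqP; apply: contraNT nal => /hu h; rewrite mem_box; exact/forallP.
rewrite -big_filter; apply: perm_big; apply: uniq_perm.
- exact/filter_uniq/box_uniq.
- exact: box_uniq.
move=> al; rewrite mem_filter /= !mem_box.
by apply: andb_idr => /forallP h; apply/forallP => i; apply: leq_trans (h i) ab.
Qed.

Lemma norm_limit_le (V : normedModType C) (f : nat -> V) (l c : V) (B : C) b :
  f @ \oo --> l -> (forall j, (b <= j)%N -> `|f j - c| <= B) -> `|l - c| <= B.
Proof.
move=> /cvgrPdist_lt fl hB.
have B0 : 0 <= B by apply: le_trans (hB b (leqnn b)).
rewrite real_leNgt ?ger0_real //; apply/negP => lt.
have [j [hj1 hj2]] : exists j, `|l - f j| < `|l - c| - B /\ (b <= j)%N.
  apply: (@filter_ex _ \oo); apply: filterI; last exact: nbhs_infty_ge.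
  by apply: fl; rewrite subr_gt0.
have := le_lt_trans (ler_distD (f j) l c) (ltr_leD hj1 (hB j hj2)).
by rewrite subrK ltxx.
Qed.

Variable om : 'I_N -> nat.
Hypothesis om_gt0 : forall i, (0 < om i)%N.

Definition weight al := (\sum_i om i * al i)%N.

Lemma weight_ge al i : (al i <= weight al)%N.
Proof.
rewrite /weight (bigD1 i) //=; apply: leq_trans (leq_addr _ _).
by rewrite leq_pmull.
Qed.

(** With positive weights, all exponents of a monomial of weight [d] are at most [d], so the cube of
    side [d.+1] contains the whole weighted part. *)
Definition hpart (a : vseries C N) (d : nat) x : 'rV[C]_N :=
  partial_sum (fun al => if weight al == d then monomial al x *: a al else 0) d.+1.

Definition truncation (a : vseries C N) (d : nat) x : 'rV[C]_N :=
  partial_sum (fun al => if (weight al < d)%N then monomial al x *: a al else 0) d.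

(** Absolute convergence at the constant point [rho] bounds the sums of [rho ^ mdegree al * |a al|].
    As [rho <= 1] and all weights are positive, with [s = t / rho <= 1] the monomial of [y] is at
    most [s ^ weight al * rho ^ mdegree al]; terms of weight at least [d] thus carry a factor
    [s ^ d]. *)
Lemma taylor_remainder F p a d : has_taylor_series F p a ->
  exists K rho : C, [/\ 0 <= K, 0 < rho & forall t y, 0 < t -> t <= rho ->
    (forall i, `|y 0 i| <= t ^+ om i) ->
    forall i, `|(F (p + y) - truncation a d y) 0 i| <= K * t ^+ d].
Proof.
move=> /nbhs_ballP [e /= e0 he].
(* Positive, below [e] and at most 1. *)
pose rho := e / (1 + e).
have e1 : 0 < 1 + e by rewrite addr_gt0.
have r0 : 0 < rho by rewrite divr_gt0.
have r1 : rho <= 1 by rewrite ler_pdivrMr // mul1r lerDr.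
have re : rho < e by rewrite ltr_pdivrMr // mulrDr mulr1 ltrDl mulr_gt0.
clearbody rho.
have [cv _] : cvgn (partial_sum (fun al => `| monomial al (p + const_mx rho - p) *: a al |)) /\
    partial_sum (fun al => monomial al (p + const_mx rho - p) *: a al) @ \oo --> F (p +
      const_mx rho).
  apply: he; split => // i j; rewrite /ball /= !mxE opprD addNKr normrN gtr0_norm //.
have {cv} [S S0 hS] : exists2 S : C, 0 <= S & forall b,
    \sum_(al <- box b) rho ^+ mdegree al * `|a al| <= S.
  have [M [Mreal hM]] := cvg_seq_bounded cv.
  have h b : \sum_(al <- box b) rho ^+ mdegree al * `|a al| <= `|M| + 1.
    have M1 : M < `|M| + 1 by rewrite (le_lt_trans (real_ler_norm Mreal)) // ltrDl.
    apply: le_trans (hM _ M1 b I); rewrite partial_sumE ger0_norm ?sumr_ge0 //.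
    apply: ler_sum => al _; rewrite normrZ /monomial normr_prod.
    rewrite /mdegree -prodrXr le_eqVlt; apply/orP; left; apply/eqP; congr (_ * _).
    by apply: eq_bigr => i _; rewrite addrC addKr mxE normrX gtr0_norm.
  by exists (`|M| + 1) => //; rewrite addr_ge0.
exists (S / rho ^+ d), rho; split=> //; first by rewrite divr_ge0 // exprn_ge0 // ltW.
move=> t y t0 tr hy i.
have yb i' : `|y 0 i'| <= rho.
  apply: le_trans (hy i') (le_trans _ tr).
  by rewrite -[leRHS]expr1; apply: ler_wiXn2l; [exact: ltW|exact: le_trans tr r1|exact: om_gt0].
have [_ lim] : cvgn (partial_sum (fun al => `| monomial al (p + y - p) *: a al |)) /\
    partial_sum (fun al => monomial al (p + y - p) *: a al) @ \oo --> F (p + y).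
  apply: he; split => // i1 j1; rewrite /ball /= !mxE opprD addNKr normrN (ord1 i1).
  exact: le_lt_trans (yb j1) re.
pose s := t / rho.
have s0 : 0 <= s by rewrite divr_ge0 // ltW.
have s1 : s <= 1 by rewrite ler_pdivrMr // mul1r.
have mon al : `|monomial al y| <= s ^+ weight al * rho ^+ mdegree al.
  rewrite /monomial normr_prod /weight /mdegree -!prodrXr -big_split /=.
  apply: ler_prod => j _; rewrite normr_ge0 normrX /= exprM -exprMn.
  apply: lerXn2r; [exact: normr_ge0|by rewrite nnegrE mulr_ge0 ?exprn_ge0 // ltW|].
  apply: le_trans (hy j) _; rewrite -[t](divfK (lt0r_neq0 r0)) -/s exprMn.
  apply: ler_wpM2l; first exact: exprn_ge0.
  by rewrite -[leRHS]expr1; apply: ler_wiXn2l; [exact: ltW| |exact: om_gt0].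
have bound : `|F (p + y) - truncation a d y| <= S / rho ^+ d * t ^+ d.
  apply: (@norm_limit_le _ _ _ _ _ d lim) => b db.
  rewrite /truncation -(partial_sum_widen db); last first.
    move=> al; case: ltnP => [lt _ j|]; last by rewrite eqxx.
    exact: leq_ltn_trans (weight_ge _ _) lt.
  rewrite !partial_sumE -sumrB; apply: le_trans (ler_norm_sum _ _ _) _.
  have -> : S / rho ^+ d * t ^+ d = s ^+ d * S.
    by rewrite /s expr_div_n mulrAC [RHS]mulrC mulrA.
  apply: le_trans (ler_wpM2l _ (hS b)); last exact: exprn_ge0.
  rewrite mulr_sumr; apply: ler_sum => al _; rewrite (addrC p) addrK.
  case: ltnP => hw.
    by rewrite subrr normr0 !mulr_ge0 ?exprn_ge0 // ltW.
  rewrite subr0 normrZ mulrA; apply: ler_wpM2r => //.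
  apply: le_trans (mon al) _; apply: ler_wpM2r; first by rewrite exprn_ge0 // ltW.
  exact: ler_wiXn2l.
apply: le_trans bound.
rewrite -[leRHS]/(mx_norm (F (p + y) - truncation a d y)) mx_normE -[leLHS]nngE num_le.
exact: (le_bigmax _ (fun ij : 'I_1 * 'I_N => `|(F (p +
  y) - truncation a d y) ij.1 ij.2|%:nng) (0, i)).
Qed.

End Expansion.

(** * Orders of vanishing along positive real parameters *)

Section Orders.
Variable C : numClosedFieldType.

(** In [C] the condition [0 < t] forces [t] to be real, so this is a one-sided real neighbourhood of
    [0]. *)
Definition near0 (Q : C -> Prop) := exists2 e : C, 0 < e & forall t, 0 < t -> t < e -> Q t.

Lemma near0W (Q Q' : C -> Prop) : (forall t, 0 < t -> Q t -> Q' t) -> near0 Q -> near0 Q'.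
Proof. by move=> h [e e0 he]; exists e => // t t0 te; apply: h => //; apply: he. Qed.

Lemma near0_forall (I : finType) (Q : I -> C -> Prop) :
  (forall i, near0 (Q i)) -> near0 (fun t => forall i, Q i t).
Proof.
move=> /fin_all_exists2 [e e0 he].
have s0 : 0 <= \sum_i (e i)^-1 by apply: sumr_ge0 => i _; rewrite invr_ge0 ltW.
(* A positive lower bound of all [e i]; the summand 1 keeps it positive for an empty index type. *)
exists (1 + \sum_i (e i)^-1)^-1; first by rewrite invr_gt0 ltr_wpDr.
move=> t t0 te i; apply: he => //; apply: lt_le_trans te _.
rewrite -[leRHS]invrK lef_pV2 ?posrE ?invr_gt0 ?e0 ?ltr_wpDr //.
rewrite (bigD1 i) //= addrCA lerDl addr_ge0 // sumr_ge0 // => j _.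
by rewrite invr_ge0 ltW.
Qed.

Lemma near0_and (Q Q' : C -> Prop) : near0 Q -> near0 Q' -> near0 (fun t => Q t /\ Q' t).
Proof.
move=> h h'; have := @near0_forall bool (fun b => if b then Q else Q').
case; first by case.
move=> e e0 he; exists e => // t t0 te; split;
  [exact: (he t t0 te true)|exact: (he t t0 te false)].
Qed.

Lemma near0_lt (e : C) : 0 < e -> near0 (fun t => t < e).
Proof. by exists e. Qed.

Definition bigO (d : nat) (u : C -> C) :=
  exists2 K : C, 0 <= K & near0 (fun t => `|u t| <= K * t ^+ d).

Lemma bigO_ext d u v : near0 (fun t => u t = v t) -> bigO d u -> bigO d v.
Proof.
move=> e [K K0 h]; exists K => //.
by apply: near0W (near0_and e h) => t _ [<-].
Qed.

Lemma bigO0 d u : near0 (fun t => u t = 0) -> bigO d u.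
Proof.
move=> e; exists 0 => //.
by apply: near0W e => t _ ->; rewrite normr0 mul0r.
Qed.

Lemma bigOD d u v : bigO d u -> bigO d v -> bigO d (fun t => u t + v t).
Proof.
move=> [K K0 h] [L L0 h']; exists (K + L); first exact: addr_ge0.
apply: near0W (near0_and h h') => t _ [hu hv].
by rewrite mulrDl (le_trans (ler_normD _ _)) // lerD.
Qed.

Lemma bigOM d e u v : bigO d u -> bigO e v -> bigO (d + e) (fun t => u t * v t).
Proof.
move=> [K K0 h] [L L0 h']; exists (K * L); first exact: mulr_ge0.
apply: near0W (near0_and h h') => t t0 [hu hv].
by rewrite exprD mulrACA normrM ler_pM.
Qed.

Lemma bigO_cst c : bigO 0 (fun=> c).
Proof. by exists `|c| => //; exists 1 => // t _ _; rewrite expr0 mulr1. Qed.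

Lemma bigOZ d c u : bigO d u -> bigO d (fun t => c * u t).
Proof. exact: (bigOM (bigO_cst c)). Qed.

Lemma bigOB d u v : bigO d u -> bigO d v -> bigO d (fun t => u t - v t).
Proof.
move=> hu hv; apply: bigO_ext (bigOD hu (bigOZ (-1) hv)).
by exists 1 => // t _ _; rewrite mulN1r.
Qed.

Lemma bigO_sum d (I : finType) (u : I -> C -> C) :
  (forall i, bigO d (u i)) -> bigO d (fun t => \sum_i u i t).
Proof.
move=> h.
elim: (index_enum I) => [|i s IH].
  by apply: bigO0; exists 1 => // t _ _; rewrite big_nil.
by apply: bigO_ext (bigOD (h i) IH); exists 1 => // t _ _; rewrite big_cons.
Qed.

Lemma bigO_conj d u : bigO d u -> bigO d (fun t => (u t)^* ).
Proof. by move=> [K K0 h]; exists K => //; apply: near0W h => t _; rewrite norm_conjC. Qed.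

Lemma bigOW d e u : (d <= e)%N -> bigO e u -> bigO d u.
Proof.
move=> de [K K0 h]; exists K => //.
apply: near0W (near0_and (near0_lt (@ltr01 C)) h) => t t0 [t1 hu].
by apply: le_trans hu _; apply: ler_wpM2l => //; apply: ler_wiXn2l => //; exact: ltW.
Qed.

Lemma bigO_monomial d c : bigO d (fun t => t ^+ d * c).
Proof.
exists `|c| => //; exists 1 => // t t0 _.
by rewrite normrM normrX gtr0_norm // mulrC.
Qed.

Lemma bigO_leading d c : bigO d.+1 (fun t => t ^+ d * c) -> c = 0.
Proof.
move=> [K K0 [e e0 h]]; apply/eqP/negPn/negP => c0.
have nc : 0 < `|c| by rewrite normr_gt0.
(* Below both [e] and [|c| / (K + 1)]; the halving makes the inequalities strict. *)
pose t := (e^-1 + (K + 1) / `|c|)^-1 / 2.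
have K10 : 0 < K + 1 by rewrite ltr_wpDl.
have K1 : 0 < (K + 1) / `|c| by rewrite divr_gt0.
have s0 : 0 < e^-1 + (K + 1) / `|c| by rewrite addr_gt0 ?invr_gt0.
have t0 : 0 < t by rewrite divr_gt0 ?invr_gt0 ?ltr0n.
have ts : t < (e^-1 + (K + 1) / `|c|)^-1.
  by rewrite /t ltr_pdivrMr ?ltr0n // ltr_pMr ?invr_gt0 // ltr1n.
have te : t < e.
  apply: lt_le_trans ts _; rewrite -[leRHS]invrK lef_pV2 ?posrE ?invr_gt0 //.
  by rewrite lerDl ltW.
have hc : `|c| <= t * K.
  rewrite -(ler_pM2l (exprn_gt0 d t0)); have := h t t0 te.
  rewrite normrM normrX gtr0_norm // exprS => /le_trans; apply.
  by rewrite mulrCA mulrA mulrC.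
have tc : t < `|c| / (K + 1).
  apply: lt_le_trans ts _; rewrite -[leRHS]invrK lef_pV2 ?posrE ?invr_gt0 ?divr_gt0 //.
  by rewrite invf_div lerDr invr_ge0 ltW.
have : t * (K + 1) < `|c| by rewrite -ltr_pdivlMr.
rewrite mulrDr mulr1 => lt1.
by have := lt_le_trans lt1 hc; rewrite gtrDl (lt_gtF t0).
Qed.

End Orders.

(** * Weighted dilations and weighted homogeneous parts *)

Section Dilation.
Variables (C : numClosedFieldType) (N : nat) (om : 'I_N -> nat).
Hypothesis om_gt0 : forall i, (0 < om i)%N.
Implicit Types (al : multi_index N) (x : 'rV[C]_N) (a : vseries C N).

Definition dilation (t : C) x : 'rV[C]_N := \row_i (t ^+ om i * x 0 i).

Lemma row_bound x : exists2 kap : C, 1 <= kap & forall i, `|x 0 i| <= kap.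
Proof.
have s0 : 0 <= \sum_i `|x 0 i| by apply: sumr_ge0.
exists (1 + \sum_i `|x 0 i|); first by rewrite lerDl.
move=> i; rewrite (bigD1 i) //= addrCA lerDl addr_ge0 // sumr_ge0 //.
Qed.

Lemma dilation_bound x : exists2 kap : C, 1 <= kap &
  forall t, 0 < t -> forall i, `|dilation t x 0 i| <= (kap * t) ^+ om i.
Proof.
have [kap k1 hk] := row_bound x; exists kap => // t t0 i.
have k0 : 0 <= kap by apply: le_trans k1.
rewrite mxE normrM normrX gtr0_norm // mulrC exprMn.
apply: ler_wpM2r; first by rewrite exprn_ge0 // ltW.
by apply: le_trans (hk i) _; rewrite -[leLHS]expr1; apply: ler_weXn2l.
Qed.

Lemma monomial_dilation al t x :
  monomial al (dilation t x) = t ^+ weight om al * monomial al x.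
Proof.
rewrite /monomial /weight -prodrXr -big_split /=; apply: eq_bigr => i _.
by rewrite mxE exprMn exprM.
Qed.

Lemma hpart_dilation a d t x : hpart om a d (dilation t x) = t ^+ d *: hpart om a d x.
Proof.
rewrite /hpart !partial_sumE scaler_sumr; apply: eq_bigr => al _.
case: eqP => [<-|_]; last by rewrite scaler0.
by rewrite monomial_dilation scalerA.
Qed.

Lemma truncation_dilation a d t x :
  truncation om a d (dilation t x) = \sum_(j < d) t ^+ j *: hpart om a j x.
Proof.
under eq_bigr => j _ do rewrite -hpart_dilation /hpart.
rewrite [RHS](_ : _ = \sum_(j < d) partial_sum (fun al => if weight om al == j
  then monomial al (dilation t x) *: a al else 0) d); last first.
  apply: eq_bigr => j _; rewrite (partial_sum_widen (ltn_ord j)) // => al.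
  case: (weight om al =P j) => [<- _ i|]; last by rewrite eqxx.
  by rewrite ltnS weight_ge.
rewrite /truncation partial_sumE.
under [RHS]eq_bigr => j _ do rewrite partial_sumE.
rewrite exchange_big /=; apply: eq_bigr => al _.
case: ltnP => h.
  rewrite (bigD1 (Ordinal h)) //= eqxx big1 ?addr0 // => j.
  by rewrite -val_eqE /= eq_sym => /negbTE ->.
by rewrite big1 // => j _; rewrite gtn_eqF // (leq_trans (ltn_ord j)).
Qed.

Lemma taylor_expansion F p a x d i : has_taylor_series F p a ->
  bigO d (fun t => (F (p + dilation t x)) 0 i - \sum_(j < d) t ^+ j * hpart om a j x 0 i).
Proof.
move=> /(taylor_remainder om_gt0 d) [K [rho [K0 r0 h]]].
have [kap k1 hk] := dilation_bound x.
have k0 : 0 < kap by apply: lt_le_trans k1.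
exists (K * kap ^+ d); first by rewrite mulr_ge0 // exprn_ge0 // ltW.
exists (rho / kap); first exact: divr_gt0.
move=> t t0; rewrite ltr_pdivlMr // mulrC => tr.
have := h _ _ (mulr_gt0 k0 t0) (ltW tr) (hk t t0) i.
rewrite exprMn mulrA truncation_dilation mxE [X in _ + X]mxE summxE.
by under eq_bigr => j _ do rewrite mxE.
Qed.

Lemma near0_dilation (P : 'rV[C]_N -> Prop) x :
  (\forall y \near (0 : 'rV[C]_N), P y) -> near0 (fun t => P (dilation t x)).
Proof.
move=> /nbhs_ballP [e /= e0 he].
have [kap k1 hk] := dilation_bound x.
have k0 : 0 < kap by apply: lt_le_trans k1.
have ki : 0 < kap^-1 by rewrite invr_gt0.
apply: near0W (near0_and (near0_lt (divr_gt0 e0 k0)) (near0_lt ki)) => t t0.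
rewrite ltr_pdivlMr // -[kap^-1]mul1r ltr_pdivlMr // => -[te t1].
apply: he; split => // i1 j; rewrite /ball /= mxE sub0r normrN (ord1 i1).
apply: le_lt_trans (hk t t0 j) _; apply: le_lt_trans te; rewrite mulrC.
have kt0 : 0 <= t * kap by rewrite mulr_ge0 // ltW.
by rewrite -[leRHS]expr1; apply: ler_wiXn2l => //; apply: ltW.
Qed.

Lemma hpart_polymap a d i : polymap (fun x => hpart om a d x 0 i).
Proof.
move=> x hx; rewrite /hpart.
apply: (@polyfun_ext _ (fun t => \sum_(al <- box N d.+1)
  (if weight om al == d then a al 0 i else 0) * monomial al (x t))).
  move=> t; rewrite partial_sumE summxE; apply: eq_bigr => al _.
  by case: eqP => _; rewrite mxE ?mul0r // mulrC.
apply: polyfun_sum => al _; apply: polyfunM; first exact: polyfun_cst.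
by apply: polyfun_prod => j; apply: polyfunX.
Qed.

Lemma monomialZ al t x : monomial al (t *: x) = t ^+ mdegree al * monomial al x.
Proof.
rewrite /monomial /mdegree -prodrXr -big_split /=; apply: eq_bigr => i _.
by rewrite mxE exprMn.
Qed.

(** This concerns ordinary scaling, not the dilation: equality of jets is a condition on the degree,
    whereas [hpart] sorts by weight. *)
Lemma hpart_vanishing_order a d e x i : (forall al, (mdegree al < e)%N -> a al = 0) ->
  exists2 r : C -> C, polyfun r & forall t, hpart om a d (t *: x) 0 i = t ^+ e * r t.
Proof.
move=> h.
exists (fun t => \sum_(al <- box N d.+1)
  (if weight om al == d then a al 0 i else 0) * (t ^+ (mdegree al - e) * monomial al x)).
  apply: polyfun_sum => al _; apply: polyfunM; first exact: polyfun_cst.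
  by apply: polyfunM (polyfun_cst _); apply/polyfunX/polyfun_id.
move=> t; rewrite /hpart partial_sumE summxE mulr_sumr; apply: eq_bigr => al _.
case: eqP => _; last by rewrite mxE mul0r mulr0.
rewrite mxE monomialZ; have [lt|le] := ltnP (mdegree al) e.
  by rewrite h // mxE mul0r !mulr0.
by rewrite -{1}(subnK le) exprD; ring.
Qed.

Lemma digits_inj (b n : nat) (f g : 'I_n -> nat) :
  (forall i, f i < b)%N -> (forall i, g i < b)%N ->
  (\sum_(i < n) b ^ i * f i = \sum_(i < n) b ^ i * g i)%N -> f =1 g.
Proof.
elim: n f g => [|n IH] f g hf hg; first by move=> _ [].
have b0 : (0 < b)%N by apply: leq_ltn_trans (hf ord0).
rewrite !big_ord_recl !expn0 !mul1n.
have shift (f' : 'I_n.+1 -> nat) :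
    (\sum_(i < n) b ^ bump 0 i * f' (lift ord0 i) =
      (\sum_(i < n) b ^ i * f' (lift ord0 i)) * b)%N.
  by rewrite big_distrl; apply: eq_bigr => i _; rewrite /bump /= add1n expnS; lia.
rewrite !shift => E.
have E0 : f ord0 = g ord0.
  by have := congr1 (modn^~ b) E; rewrite ![(_ + _ * b)%N]addnC !modnMDl !modn_small.
have E1 i : f (lift ord0 i) = g (lift ord0 i).
  apply: (IH (fun i => f (lift ord0 i)) (fun i => g (lift ord0 i))) => //.
  move: E; rewrite E0 => /addnI /eqP; rewrite eqn_pmul2r // => /eqP; exact.
by move=> i; case: (unliftP ord0 i) => [j ->|->].
Qed.

(* Kronecker substitution [x_i = s ^ (b ^ i)]. *)
Lemma monomial_sum_eq0 (b : nat) (u : multi_index N -> C) :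
  (forall x, \sum_(al <- box N b) monomial al x * u al = 0) ->
  forall al, al \in box N b -> u al = 0.
Proof.
move=> h al hal.
pose code (be : multi_index N) := (\sum_(i < N) b ^ i * be i)%N.
have code_inj be : be \in box N b -> (code be == code al) = (be == al).
  move=> hbe; apply/eqP/eqP => [E|-> //]; apply/ffunP; apply: digits_inj E.
    by move: hbe; rewrite mem_box => /forallP.
  by move: hal; rewrite mem_box => /forallP.
have E : \sum_(be <- box N b) (u be)%:P * 'X^(code be) = 0.
  apply: poly_eq_fun => s; rewrite horner0 -[RHS](h (\row_i s ^+ (b ^ i))).
  rewrite horner_sum; apply: eq_bigr => be _.
  rewrite hornerM hornerC hornerXn mulrC; congr (_ * _).
  by rewrite /code -prodrXr; apply: eq_bigr => i _; rewrite mxE exprM.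
have := congr1 (fun P : {poly C} => P`_(code al)) E; rewrite coef0 coef_sum.
rewrite (bigD1_seq al) ?box_uniq //= coefCM coefXn eqxx mulr1 big_seq_cond big1 ?addr0 //.
move=> be /andP [hbe nbe]; rewrite coefCM coefXn eq_sym code_inj //.
by rewrite (negbTE nbe) mulr0.
Qed.

Lemma hpart_eq0 a d i : (forall x, hpart om a d x 0 i = 0) ->
  forall al, weight om al = d -> a al 0 i = 0.
Proof.
move=> h al hal.
have : (if weight om al == d then a al 0 i else 0) = 0.
  apply: (@monomial_sum_eq0 d.+1 (fun al => if weight om al == d then a al 0 i else 0)).
    move=> x; rewrite -[RHS](h x) /hpart partial_sumE summxE; apply: eq_bigr => be _.
    by case: eqP => _; rewrite mxE ?mulr0.
  rewrite mem_box; apply/forallP => j; rewrite ltnS -hal; exact: weight_ge.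
by rewrite hal eqxx.
Qed.

End Dilation.

Section Lipschitz.
Variables (C : numClosedFieldType) (N : nat).

(** With all weights 1 the truncation at order 1 is constant, so the remainder estimate compares
    both values of [F] with the same vector. *)
Lemma taylor_lipschitz F p (a : vseries C N) d (y : C -> 'rV[C]_N) :
  (0 < d)%N -> has_taylor_series F p a -> (forall i, bigO d (fun t => y t 0 i)) ->
  forall i, bigO d (fun t => (F (p + y t) - F p) 0 i).
Proof.
move=> d0 /(@taylor_remainder _ _ (fun=> 1%N) (fun=> isT) F p a 1) [K [rho [K0 r0 h]]].
move=> /fin_all_exists2 [M M0 hM] i.
pose S := 1 + \sum_i M i.
have S1 : 1 <= S by rewrite lerDl sumr_ge0.
have S0 : 0 < S by apply: lt_le_trans S1.
have MS j : M j <= S by rewrite /S (bigD1 j) //= addrCA lerDl addr_ge0 // sumr_ge0.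
exists (2 * K * S); first by rewrite !mulr_ge0 // ltW.
apply: near0W (near0_and (near0_and (near0_lt ltr01) (near0_lt (divr_gt0 r0 S0))) (near0_forall hM)).
move=> t t0 [[t1 tr] ht].
pose s := S * t ^+ d.
have s0 : 0 < s by rewrite mulr_gt0 // exprn_gt0.
have sr : s <= rho.
  move: tr; rewrite ltr_pdivlMr // => /ltW; apply: le_trans.
  rewrite /s mulrC ler_pM2r // -[leRHS]expr1; apply: ler_wiXn2l => //; exact: ltW.
have hT z : truncation (fun=> 1%N) a 1 z = truncation (fun=> 1%N) a 1 0.
  rewrite /truncation !partial_sumE; apply: eq_bigr => al _.
  case: ltnP => // hw; congr (_ *: _); apply: eq_bigr => j _.
  suff -> : al j = 0%N by rewrite !expr0.
  by apply/eqP; rewrite -leqn0 -ltnS; apply: leq_ltn_trans hw; apply: (@weight_ge _ (fun=> 1%N)).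
have h1 : `|(F (p + y t) - truncation (fun=> 1%N) a 1 0) 0 i| <= K * s.
  rewrite -(hT (y t)) -[s]expr1; apply: h => // j; rewrite expr1.
  by apply: le_trans (ht j) _; apply: ler_wpM2r => //; rewrite exprn_ge0 // ltW.
have h2 : `|(F p - truncation (fun=> 1%N) a 1 0) 0 i| <= K * s.
  rewrite -[s]expr1 -{1}[p]addr0; apply: h => // j; rewrite expr1 mxE normr0; exact: ltW.
have -> : (F (p + y t) - F p) 0 i = (F (p + y t) - truncation (fun=> 1%N) a 1 0) 0 i
    - (F p - truncation (fun=> 1%N) a 1 0) 0 i by rewrite !mxE; ring.
apply: le_trans (ler_normB _ _) _.
have -> : 2 * K * S * t ^+ d = K * s + K * s by rewrite /s; ring.
exact: lerD.
Qed.

End Lipschitz.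

(** * Leading parts of germs preserving the quadric *)

Lemma deg_le_order0 (C : numClosedFieldType) d (p r : C -> C) :
  deg_le d p -> polyfun r -> (forall t, p t = t ^+ d.+1 * r t) -> forall t, p t = 0.
Proof.
move=> [P sP hP] [Q hQ] h t.
have e : P = Q * 'X^(d.+1).
  by apply: poly_eq_fun => s; rewrite hornerM hornerXn -hP h hQ mulrC.
have P0 : P = 0.
  apply/polyP => i; rewrite coef0; have [lt|le] := ltnP i d.+1.
    by rewrite e coefMXn lt.
  by rewrite nth_default // (leq_trans sP).
by rewrite hP P0 horner0.
Qed.

Lemma linear_form_row (C : numFieldType) n (f : 'rV[C]_n -> C) : linear_form f ->
  forall z, f z = \sum_i z 0 i * f (delta_mx 0 i).
Proof.
move=> hf z; rewrite [in LHS](row_sum_delta z).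
have: forall s : seq 'I_n, f (\sum_(i <- s) z 0 i *: delta_mx 0 i) =
    \sum_(i <- s) z 0 i * f (delta_mx 0 i); last exact.
elim=> [|i s IH]; first by rewrite !big_nil (linear_form0 hf).
by rewrite !big_cons addrC hf IH addrC.
Qed.

(** * Polynomial functions of weight one and two *)

Section Weights.
Variables (C : numClosedFieldType) (n k : nat).

Definition qweight (i : 'I_(n + k)) : nat := if fintype.split i then 1 else 2.

Lemma qweight_gt0 i : (0 < qweight i)%N.
Proof. by rewrite /qweight; case: fintype.split. Qed.

Lemma dilation_row_mx t (z : 'rV[C]_n) (w : 'rV[C]_k) :
  dilation qweight t (row_mx z w) = row_mx (t *: z) (t ^+ 2 *: w).
Proof.
apply/rowP => i; rewrite mxE /qweight; case: (split_ordP i) => j ->.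
  by rewrite !row_mxEl mxE expr1.
by rewrite !row_mxEr mxE.
Qed.

Variable p : 'rV[C]_(n + k) -> C.
Hypothesis p_poly : polymap p.

Let polyfun_path c0 c1 c2 (z z' z'' : 'rV[C]_n) (w w' w'' : 'rV[C]_k) : polyfun (fun t =>
  p (row_mx (c0 *: z + t *: z' + t ^+ 2 *: z'') (c1 *: w + (c2 * t) *: w' + t ^+ 2 *: w''))).
Proof.
by apply/p_poly/polyfun_row_mx => i; [apply: (@polyfun_ext _ (fun t => c0 * z 0 i + t * z' 0 i
  + t ^+ 2 * z'' 0 i)) | apply: (@polyfun_ext _ (fun t => c1 * w 0 i + c2 * t * w' 0 i
  + t ^+ 2 * w'' 0 i))]; (try by move=> t; rewrite !mxE);
  repeat first [exact: polyfun_cst | exact: polyfun_id | apply: polyfunD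
               | apply: polyfunX | apply: polyfunM].
Qed.

(** [t p (z, t ^ 2 w)] equals [t ^ 2 p (z / t, w)], so it is quadratic in [t]; being odd, it keeps
    only its linear term, and [p (z, t ^ 2 w)] is constant. *)
Lemma weight1_linear : (forall t x, p (dilation qweight t x) = t * p x) ->
  (forall z w, p (row_mx z w) = p (row_mx z 0)) /\ linear_form (fun z => p (row_mx z 0)).
Proof.
move=> hom; split=> [z w|]; last first.
  apply: homogeneous1_additive => [x y|a x].
    apply: polyfun_ext (polyfun_path 1 0 0 x y 0 0 0 0) => t.
    by rewrite !scaler0 !addr0 scale1r.
  by rewrite -hom dilation_row_mx scaler0.
have [||| [[c0 c1] c2] [/= h1 h2]] := @quadratic_reciprocal _
  (fun t => t * p (row_mx z (t ^+ 2 *: w))) (fun t => p (row_mx (t *: z) w)).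
- apply: polyfunM (polyfun_id _) _.
  apply: polyfun_ext (polyfun_path 1 0 0 z 0 0 0 0 w) => t.
  by rewrite !scaler0 !addr0 scale1r add0r.
- apply: polyfun_ext (polyfun_path 0 1 0 0 z 0 w 0 0) => t.
  by rewrite !scaler0 !addr0 scale1r add0r.
- move=> t t0; rewrite [in RHS]expr2 -mulrA; congr (_ * _); rewrite -hom dilation_row_mx.
  by rewrite scalerA mulfV // scale1r.
have e0 : c0 = 0 by have := h1 0; rewrite !(mul0r, mulr0, expr0n, addr0).
have e2 : c2 = 0.
  have := h1 (-1); have := h1 1; rewrite sqrrN !expr1n !scale1r e0.
  set P := p _ => E1 E2; apply: (mulfI (_ : 2 != 0 :> C)); first by rewrite pnatr_eq0.
  transitivity (1 * P + (-1) * P); last by ring.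
  by rewrite E1 E2; ring.
have [Q hQ] := polyfun_path 1 0 0 z 0 0 0 0 w.
have eQ : Q = c1%:P.
  apply: poly_eq_nonzero => t t0; rewrite hornerC -hQ !scaler0 !addr0 scale1r add0r.
  by apply: (mulfI t0); rewrite h1 e0 e2; ring.
have := hQ 1; have := hQ 0.
by rewrite eQ !hornerC !scaler0 !addr0 !scale1r !add0r expr0n /= expr1n scale0r scale1r => -> ->.
Qed.

(** By the same comparison [p (z, w + t ^ 2 w')] is quadratic in [t], and it is even; a square root
    of [s] is then put for [t]. *)
Lemma weight2_affine : (forall t x, p (dilation qweight t x) = t ^+ 2 * p x) ->
  forall z w w' s, p (row_mx z (w + s *: w')) = p (row_mx z w) + s * p (row_mx 0 w').
Proof.
move=> hom z w w' s.
have [||| [[c0 c1] c2] [/= h1 h2]] := @quadratic_reciprocal _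
  (fun t => p (row_mx z (w + t ^+ 2 *: w'))) (fun t => p (row_mx (t *: z) (w' + t ^+ 2 *: w))).
- apply: polyfun_ext (polyfun_path 1 1 0 z 0 0 w 0 w') => t.
  by rewrite !scaler0 !addr0 !scale1r.
- apply: polyfun_ext (polyfun_path 0 1 0 0 z 0 w' 0 w) => t.
  by rewrite !scaler0 !addr0 !scale1r add0r.
- move=> t t0; rewrite -hom dilation_row_mx scalerA mulfV // scale1r.
  by rewrite scalerDr scalerA -exprMn mulfV // expr1n scale1r addrC.
have e0 : p (row_mx z w) = c0.
  by have := h1 0; rewrite expr0n /= scale0r !mulr0 !addr0.
have e2 : p (row_mx 0 w') = c2.
  by have := h2 0; rewrite expr0n /= !scale0r !mulr0 !addr0.
have e1 : c1 = 0.
  have := h1 (-1); have := h1 1; rewrite sqrrN !expr1n.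
  set P := p _ => E1 E2; apply: (mulfI (_ : 2 != 0 :> C)); first by rewrite pnatr_eq0.
  transitivity (P - P); last by ring.
  by rewrite {1}E1 E2; ring.
by have := h1 (sqrtC s); rewrite sqrtCK e1 mul0r addr0 e0 e2 mulrC.
Qed.

End Weights.

(** * Algebra of the model forms *)

Section ModelForms.
Variables (C : numClosedFieldType) (m : nat).
Local Notation n := (m.+4).
Local Notation k := (m.+4.+1).
Local Notation model := (@model C m).

Definition form (j : 'I_k) (u v : 'rV[C]_n) : C := (u *m model j *m v^t*) 0 0.

Lemma formE j u v : form j u v = model_form j (coord u) (fun i => (coord v i)^* ).
Proof. exact: model_formE. Qed.

Lemma formDl j a u u' v : form j (u + a *: u') v = form j u v + a * form j u' v.
Proof. by rewrite /form !mulmxDl -!scalemxAl mxE [X in _ + X]mxE. Qed.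

Lemma form_conj j u v : (form j u v)^* = form j v u.
Proof.
rewrite !formE model_form_conj; congr model_form.
by apply/funext => i; rewrite conjCK.
Qed.

Lemma formDr j a u v v' : form j u (v + a *: v') = form j u v + a^* * form j u v'.
Proof. by rewrite -form_conj formDl rmorphD rmorphM /= !form_conj. Qed.

Lemma form0l j v : form j 0 v = 0.
Proof. by rewrite /form !mul0mx mxE. Qed.

Lemma form0r j v : form j v 0 = 0.
Proof. by rewrite -form_conj form0l rmorph0. Qed.

Lemma formZl j a u v : form j (a *: u) v = a * form j u v.
Proof. by rewrite -[a *: u]add0r formDl form0l add0r. Qed.

Lemma formZr j a u v : form j u (a *: v) = a^* * form j u v.
Proof. by rewrite -[a *: v]add0r formDr form0r add0r. Qed.

Lemma form_real j u : form j u u \is Num.real.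
Proof. by rewrite CrealE form_conj. Qed.

Lemma bigO_form j d e (u v : C -> 'rV[C]_n) :
  (forall i, bigO d (fun t => u t 0 i)) -> (forall i, bigO e (fun t => v t 0 i)) ->
  bigO (d + e) (fun t => form j (u t) (v t)).
Proof.
move=> hu hv.
have he : near0 (fun t : C => \sum_b (\sum_a u t 0 a * model j a b) * (v t 0 b)^* =
  form j (u t) (v t)).
  exists 1 => // t _ _; rewrite /form mxE; apply: eq_bigr => b _.
  by rewrite !mxE.
apply: bigO_ext he _; apply: bigO_sum => b; apply: bigOM; last exact: bigO_conj.
apply: bigO_sum => a; rewrite -[d]addn0; apply: bigOM => //; exact: bigO_cst.
Qed.

Lemma sesquilinear_eq0 (M : 'M[C]_n) :
  (forall z : 'rV[C]_n, (z *m M *m z^t*) 0 0 = 0) -> M = 0.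
Proof.
move=> h; pose B (u v : 'rV[C]_n) := (u *m M *m v^t*) 0 0.
have Bl a u u' v : B (u + a *: u') v = B u v + a * B u' v.
  by rewrite /B !mulmxDl -!scalemxAl mxE [X in _ + X]mxE.
have Br a u v v' : B u (v + a *: v') = B u v + a^* * B u v'.
  rewrite /B linearD linearZ /= map_mxD map_mxZ mulmxDr -scalemxAr mxE.
  by rewrite [X in _ + X]mxE.
have B0 u v : B u v = 0.
  have e1 : B u v + B v u = 0.
    have := h (u + 1 *: v); rewrite -/(B _ _) !Bl !Br rmorph1 !mul1r.
    by rewrite [B u u]h [B v v]h addr0 add0r.
  have e2 : 'i * (B v u - B u v) = 0.
    have := h (u + 'i *: v); rewrite -/(B _ _) !Bl !Br /= conjCi.
    by rewrite [B u u]h [B v v]h => <-; ring.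
  have e3 : B v u = B u v.
    by apply/eqP; rewrite -subr_eq0; move/eqP: e2; rewrite mulf_eq0 (negbTE (neq0Ci C)).
  by move: e1; rewrite e3 -mulr2n => /eqP; rewrite mulrn_eq0 => /eqP.
apply/matrixP => a b; rewrite mxE -[RHS](B0 (delta_mx 0 a) (delta_mx 0 b)) /B.
rewrite -rowE mxE (bigD1 b) //= big1 => [|i nib].
  by rewrite !mxE !eqxx rmorph1 mulr1 addr0.
by rewrite !mxE (negbTE nib) andbF rmorph0 mulr0.
Qed.

(** The coefficients are complex because the invertibility of [B] below needs this. Entries [(0, 1)]
    and [(1, 0)] together separate forms 2 and 3; a single entry isolates each other form. *)
Lemma model_free (c : 'I_k -> C) : \sum_j c j *: model j = 0 -> forall j, c j = 0.
Proof.
move=> E.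
have ent a b : (a < n)%N -> (b < n)%N ->
    \sum_j c j * model_form j (fun i => (i == a)%:R) (fun i => (i == b)%:R) = 0.
  move=> ha hb; have := congr1 (fun M : 'M[C]_n => M (Ordinal ha) (Ordinal hb)) E.
  rewrite summxE [RHS]mxE => e; rewrite -[RHS]e.
  by apply: eq_bigr => j _; rewrite !mxE.
have c0 : c ord0 = 0.
  have := ent 0%N 0%N isT isT; rewrite !big_ord_recl /= big1 => [|j _];
    last by rewrite !(mul0r, mulr0, addr0).
  by rewrite !(mulr0, mul0r, addr0, add0r, mulr1, mul1r, subr0, oppr0).
have c1 : c (lift ord0 ord0) = 0.
  have := ent 1%N 1%N isT isT; rewrite !big_ord_recl /= big1 => [|j _];
    last by rewrite !(mul0r, mulr0, addr0).
  by rewrite !(mulr0, mul0r, addr0, add0r, mulr1, mul1r, subr0, oppr0).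
pose i2 : 'I_k := lift ord0 (lift ord0 ord0).
pose i3 : 'I_k := lift ord0 (lift ord0 (lift ord0 ord0)).
have c23 : c i2 + c i3 * 'i = 0.
  have := ent 0%N 1%N isT isT; rewrite !big_ord_recl /= big1 => [|j _];
    last by rewrite !(mul0r, mulr0, addr0).
  by rewrite !(mulr0, mul0r, addr0, add0r, mulr1, mul1r, subr0, oppr0).
have c23' : c i2 - c i3 * 'i = 0.
  have := ent 1%N 0%N isT isT; rewrite !big_ord_recl /= big1 => [|j _];
    last by rewrite !(mul0r, mulr0, addr0).
  by rewrite !(mulr0, mul0r, addr0, add0r, mulr1, mul1r, sub0r, mulrN, mulNr).
have c2 : c i2 = 0.
  apply: (mulfI (_ : 2 != 0 :> C)); first by rewrite pnatr_eq0.
  transitivity ((c i2 + c i3 * 'i) + (c i2 - c i3 * 'i)); first by ring.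
  by rewrite c23 c23' addr0 mulr0.
have c3 : c i3 = 0.
  move: c23; rewrite c2 add0r => /eqP; rewrite mulf_eq0 (negbTE (neq0Ci C)) orbF.
  by move/eqP.
have c4 : c (lift ord0 (lift ord0 (lift ord0 (lift ord0 ord0)))) = 0.
  have := ent 2 0%N isT isT; rewrite !big_ord_recl /= big1 => [|j _]; last by rewrite !(mul0r,
    mulr0, addr0).
  by rewrite !(mulr0, mul0r, addr0, add0r, mulr1, mul1r, subr0, oppr0).
have c5 (l : 'I_m) : c (lift ord0 (lift ord0 (lift ord0 (lift ord0 (lift ord0 l))))) = 0.
  have := ent l.+4 0%N (ltn_ord l) isT; rewrite !big_ord_recl /=.
  rewrite !(mulr0, mul0r, addr0, add0r, mulr1, mul1r, subr0, oppr0) (bigD1 l) //=.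
  rewrite eqxx addr0 !mulr1 big1 ?addr0 // => j njl.
  suff -> : ((0 + j).+4 == l.+4)%N = false by rewrite !(mul0r, mulr0, addr0).
  by apply/negbTE; apply: contraNneq njl => -[e]; apply/eqP/val_inj.
move=> j.
case: (unliftP ord0 j) => [{}j ->|-> //]; case: (unliftP ord0 j) => [{}j ->|-> //].
case: (unliftP ord0 j) => [{}j ->|-> //]; case: (unliftP ord0 j) => [{}j ->|-> //].
by case: (unliftP ord0 j) => [{}j ->|-> //].
Qed.

Lemma forms_free (c : 'I_k -> C) :
  (forall z, \sum_j c j * form j z z = 0) -> forall j, c j = 0.
Proof.
move=> h; apply: model_free; apply: sesquilinear_eq0 => z.
rewrite mulmx_sumr mulmx_suml summxE -[RHS](h z); apply: eq_bigr => j _.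
by rewrite -scalemxAr -scalemxAl mxE.
Qed.

Lemma coord_delta a i : (a < n)%N -> (i < n)%N ->
  coord (delta_mx 0 (inord a) : 'rV[C]_n) i = (i == a)%:R.
Proof. by move=> ha hi; rewrite /coord mxE eqxx -val_eqE /= !inordK. Qed.

Lemma model_generic : generic_quadric model.
Proof.
split.
- move=> j; apply/is_hermitianmxP; rewrite expr0 scale1r; apply/matrixP => a b.
  rewrite !mxE model_form_conj; congr model_form; apply/funext => i;
  by rewrite conjC_nat.
- by move=> c _; apply: model_free.
move=> z hz.
have hF j v : form j z v = 0 by rewrite /form hz mul0mx mxE.
pose f j (hj : (j < k)%N) b := hF (Ordinal hj) (delta_mx 0 (inord b)).
have z0 : coord z 0 = 0.
  by have := f 0%N isT 0%N; rewrite formE /= !coord_delta //= rmorph1 mulr1.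
have z1 : coord z 1 = 0.
  by have := f 1%N isT 1%N; rewrite formE /= !coord_delta //= rmorph1 mulr1.
have z2 : coord z 2 = 0.
  have := f 4 isT 0%N; rewrite formE /= !coord_delta //= !rmorph_nat.
  by rewrite !(mulr0, mulr1, addr0).
have z3 : coord z 3 = 0.
  have := f 4 isT 1%N; rewrite formE /= !coord_delta //= !rmorph_nat.
  by rewrite !(mulr0, mulr1, addr0, add0r).
rewrite [z]row_coord; apply/rowP => -[[|[|[|[|j]]]] hj]; rewrite !mxE //.
have hj' : (j.+4.+1 < k)%N by [].
have := f _ hj' 0%N; rewrite formE /= !coord_delta //= !rmorph_nat z0.
by rewrite !(mul0r, mulr1, addr0).
Qed.

End ModelForms.

Section TangentFields.
Variables (C : numClosedFieldType) (m : nat).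
Local Notation n := (m.+4).
Local Notation k := (m.+4.+1).
Local Notation model := (@model C m).

Definition order_ge N d (P : 'rV[C]_N -> C) := forall x,
  exists2 r : C -> C, polyfun r & forall t, P (t *: x) = t ^+ d * r t.

Lemma order_ge0 N d : order_ge d (fun _ : 'rV[C]_N => 0).
Proof. by move=> x; exists (fun=> 0) => [|t]; [exact: polyfun_cst | rewrite mulr0]. Qed.

Lemma polymap0 N : polymap (fun _ : 'rV[C]_N => 0).
Proof. by move=> x _; apply: polyfun_cst. Qed.

Lemma scalar_equation_eq0 (G P0 P1 : 'rV[C]_(n + k) -> C) :
  polymap G -> polymap P0 -> polymap P1 ->
  order_ge 5 G -> order_ge 5 P0 -> order_ge 5 P1 ->
  (forall x, quadric model x ->
    'Im (G x) = 2 * 'Re (P0 x * (coord (lsubmx x) 0)^* + P1 x * (coord (lsubmx x) 1)^* )) ->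
  [/\ forall x, G x = 0, forall x, P0 x = 0 & forall x, P1 x = 0].
Proof.
move=> pG p0 p1 oG o0 o1 h.
have vanish (P : 'rV[C]_(n + k) -> C) x :
    order_ge 5 P -> deg_le 4 (fun t => P (t *: x)) -> P x = 0.
  move=> oP dP; have [r pr e] := oP x.
  by rewrite -[x]scale1r; apply: (deg_le_order0 dP pr e).
by split=> x; apply: vanish => //; have [] := scalar_equation_degree pG p0 p1 h x.
Qed.

(** The order of the components matters: forms 0 and 1 have one unknown each and kill the first two
    components of [P]. Then only conjugates of [z0] and [z1] remain, so each further form gives a
    scalar equation in at most two unknowns. *)
Lemma model_tangent_eq0 (P : 'rV[C]_(n + k) -> 'rV[C]_n) (G : 'rV[C]_(n + k) -> 'rV[C]_k) :
  (forall i, polymap (fun x => P x 0 i)) -> (forall j, polymap (fun x => G x 0 j)) ->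
  (forall i, order_ge 5 (fun x => P x 0 i)) -> (forall j, order_ge 5 (fun x => G x 0 j)) ->
  (forall x, quadric model x -> forall j, 'Im (G x 0 j) = 2 * 'Re (form j (P x) (lsubmx x))) ->
  forall x, P x = 0 /\ G x = 0.
Proof.
move=> pP pG oP oG h.
have sc j (Q0 Q1 : 'rV[C]_(n + k) -> C) : polymap Q0 -> polymap Q1 ->
    order_ge 5 Q0 -> order_ge 5 Q1 ->
    (forall x, form j (P x) (lsubmx x) =
      Q0 x * (coord (lsubmx x) 0)^* + Q1 x * (coord (lsubmx x) 1)^* ) ->
    [/\ forall x, G x 0 j = 0, forall x, Q0 x = 0 & forall x, Q1 x = 0].
  move=> p0 p1 o0 o1 e; apply: scalar_equation_eq0 => // x Mx.
  by rewrite h // e.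
pose P_ i x := P x 0 (inord i).
have pP_ i : polymap (P_ i) by exact: pP.
have oP_ i : order_ge 5 (P_ i) by exact: oP.
have p0 : polymap (fun _ : 'rV[C]_(n + k) => 0 : C) := @polymap0 _.
have o0 : order_ge 5 (fun _ : 'rV[C]_(n + k) => 0) := @order_ge0 _ 5.
have [G0 P0 _] := sc (Ordinal (isT : 0 < k)%N) (P_ 0%N) (fun=> 0) (pP_ _) p0 (oP_ _)
  o0 (fun x => ltac:(by rewrite formE /= mul0r addr0)).
have [G1 _ P1] := sc (Ordinal (isT : 1 < k)%N) (fun=> 0) (P_ 1%N) p0 (pP_ _)
  o0 (oP_ _) (fun x => ltac:(by rewrite formE /= mul0r add0r)).
have c0 x : coord (P x) 0 = 0 by exact: P0.
have c1 x : coord (P x) 1 = 0 by exact: P1.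
have [G2 _ _] := sc (Ordinal (isT : 2 < k)%N) (fun=> 0) (fun=> 0) p0 p0
  o0 o0 (fun x => ltac:(by rewrite formE /= c0 c1 !mul0r)).
have [G3 _ _] := sc (Ordinal (isT : 3 < k)%N) (fun=> 0) (fun=> 0) p0 p0
  o0 o0 (fun x => ltac:(by rewrite formE /= c0 c1 !mul0r subrr mulr0 addr0)).
have [G4 P2 P3] := sc (Ordinal (isT : 4 < k)%N) (P_ 2) (P_ 3) (pP_ _) (pP_ _)
  (oP_ _) (oP_ _) (fun x => ltac:(by rewrite formE /= c0 c1 !mul0r !addr0)).
have tl j (hj : (j.+4.+1 < k)%N) := sc (Ordinal hj) (P_ j.+4) (fun=> 0) (pP_ _) p0
  (oP_ _) o0 (fun x => ltac:(by rewrite formE /= c0 !mul0r)).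
move=> x; split.
  rewrite [P x]row_coord; apply/rowP => -[[|[|[|[|j]]]] hj]; rewrite !mxE //=.
  - exact: P2.
  - exact: P3.
  - by have [_ + _] := tl j hj; apply.
apply/rowP => -[[|[|[|[|[|j]]]]] hj]; rewrite mxE.
- by rewrite -[RHS](G0 x); congr (G x 0 _); apply/val_inj.
- by rewrite -[RHS](G1 x); congr (G x 0 _); apply/val_inj.
- by rewrite -[RHS](G2 x); congr (G x 0 _); apply/val_inj.
- by rewrite -[RHS](G3 x); congr (G x 0 _); apply/val_inj.
- by rewrite -[RHS](G4 x); congr (G x 0 _); apply/val_inj.
by have [+ _ _] := tl j hj; apply.
Qed.

End TangentFields.

Section HpartLinear.
Variables (C : numClosedFieldType) (N : nat) (om : 'I_N -> nat).

Lemma hpart_mulmx (a : vseries C N) (T : 'M[C]_N) d x :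
  hpart om (fun al => a al *m T) d x = hpart om a d x *m T.
Proof.
rewrite /hpart !partial_sumE mulmx_suml; apply: eq_bigr => al _.
by case: eqP => _; rewrite ?mul0mx // scalemxAl.
Qed.

Lemma hpartB (a b : vseries C N) d x :
  hpart om (fun al => a al - b al) d x = hpart om a d x - hpart om b d x.
Proof.
rewrite /hpart !partial_sumE -sumrB; apply: eq_bigr => al _.
by case: eqP => _; rewrite ?subr0 // scalerBr.
Qed.

End HpartLinear.

Section ReIm.
Variable C : numClosedFieldType.

Lemma Im_realM (t z : C) : t \is Num.real -> 'Im (t * z) = t * 'Im z.
Proof. by move=> /conj_Creal ht; rewrite !ImE rmorphM /= ht; ring. Qed.

Lemma Re_realM (t z : C) : t \is Num.real -> 'Re (t * z) = t * 'Re z.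
Proof. by move=> /conj_Creal ht; rewrite !ReE rmorphM /= ht; ring. Qed.

Lemma Im_2iM (z : C) : 'Im (2 * 'i * z) = 2 * 'Re z.
Proof. by rewrite -mulrA Im_realM ?realn // ImMil. Qed.

Lemma Re2E (z : C) : 2 * 'Re z = z + z^*.
Proof. by rewrite ReE; field; rewrite ?pnatr_eq0. Qed.

Lemma bigO_Im d (u : C -> C) : bigO d u -> bigO d (fun t => 'Im (u t)).
Proof.
move=> hu; apply: bigO_ext (bigOZ ('i / 2) (bigOB (bigO_conj hu) hu)).
by exists 1 => // t _ _; rewrite ImE; ring.
Qed.

Lemma bigO_Re d (u : C -> C) : bigO d u -> bigO d (fun t => 'Re (u t)).
Proof.
move=> hu; apply: bigO_ext (bigOZ (2^-1) (bigOD hu (bigO_conj hu))).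
by exists 1 => // t _ _; rewrite ReE mulrC.
Qed.

End ReIm.

(** * Induction on the weight for two germs with the same 4-jet *)

Section Determination.
Variables (C : numClosedFieldType) (m : nat).
Local Notation n := (m.+4).
Local Notation k := (m.+4.+1).
Local Notation model := (@model C m).
Local Notation qw := (@qweight n k).
Local Notation dil := (dilation qw).
Local Notation hp := (hpart qw).

Lemma dilation_quadric t x : 0 < t -> quadric model x -> quadric model (dil t x).
Proof.
move=> t0 Mx j; have tr : t \is Num.real by apply: gtr0_real.
rewrite -[x]hsubmxK dilation_row_mx row_mxKl row_mxKr -/(form j _ _) formZl formZr.
rewrite (conj_Creal tr) mxE Im_realM ?rpredX // (Mx j) -/(form j _ _).
by rewrite mulrA -expr2.
Qed.

Variables F G Gi : 'rV[C]_(n + k) -> 'rV[C]_(n + k).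
Variables a b c : vseries C (n + k).
Hypotheses (hF : has_taylor_series F 0 a) (hG : has_taylor_series G 0 b).
Hypothesis hGi : has_taylor_series Gi (G 0) c.
Hypothesis GiG : \forall x \near (0 : 'rV[C]_(n + k)), Gi (G x) = x.
Hypotheses (FM : maps_into_at 0 (quadric model) F) (GM : maps_into_at 0 (quadric model) G).
Hypothesis jets : forall al, (mdegree al <= 4)%N -> a al = b al.

Let f0 := lsubmx (G 0).

(* Linear part of the automorphism of the quadric that moves [G 0] back to
   [0]. *)
Let T : 'M[C]_(n + k) :=
  block_mx 1%:M (\matrix_(i, j) (- (2 * 'i) * (model j *m f0^t*) i 0)) 0 1%:M.

Let lT (v : 'rV[C]_(n + k)) : lsubmx (v *m T) = lsubmx v.
Proof. by rewrite -[v in LHS]hsubmxK mul_row_block row_mxKl mulmx1 mulmx0 addr0. Qed.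

Let rT (v : 'rV[C]_(n + k)) j : rsubmx (v *m T) 0 j =
  rsubmx v 0 j - 2 * 'i * form j (lsubmx v) f0.
Proof.
rewrite -[v in LHS]hsubmxK mul_row_block row_mxKr mulmx1 mxE addrC; congr (_ + _).
rewrite /form -mulmxA mxE [(_ *m (_ *m _)) 0 0]mxE mulr_sumr -sumrN.
by apply: eq_bigr => i _; rewrite [X in _ * X = _]mxE; ring.
Qed.

Let Tinj (v : 'rV[C]_(n + k)) : v *m T = 0 -> v = 0.
Proof.
move=> vT; have l0 : lsubmx v = 0 by rewrite -lT vT linear0.
rewrite -[v]hsubmxK l0; suff -> : rsubmx v = 0 by rewrite row_mx0.
apply/rowP => j; have := rT v j; rewrite vT l0 form0l mulr0 subr0 linear0.
by move=> <-.
Qed.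

(* Displacements along the curve [t |-> dil t x], where [z] has weight 1 and
   [w] weight 2. *)
Let e t x := (G (dil t x) - G 0) *m T.
Let d t x := (F (dil t x) - G (dil t x)) *m T.

Let M0 : quadric model 0.
Proof. by move=> j; rewrite !linear0 mxE raddf0 !mul0mx mxE. Qed.

Let MG0 : quadric model (G 0).
Proof. exact: (nbhs_singleton GM M0). Qed.

(** Translating [G 0] to the origin and applying [T] preserves the quadric, so the curve [e] stays
    on it. *)
Let Gmodel x : quadric model x -> near0 (fun t => forall j,
  'Im (rsubmx (e t x) 0 j) = form j (lsubmx (e t x)) (lsubmx (e t x))).
Proof.
move=> Mx; apply: near0W (near0_dilation (@qweight_gt0 n k) x GM) => t t0 hM j.
have := hM (dilation_quadric t0 Mx) j; rewrite -/(form j _ _) => E.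
have E0 := MG0 j; rewrite -/(form j _ _) -/f0 in E0.
rewrite rT lT raddfB /= Im_2iM linearB /= [X in 'Im X]mxE [X in 'Im (_ + X)]mxE raddfB /= E E0.
rewrite linearB /= -/f0; set f := lsubmx (G _).
have eN u v : form j (u - f0) v = form j u v - form j f0 v.
  by rewrite -scaleN1r formDl mulN1r.
have eN' u v : form j v (u - f0) = form j v u - form j v f0.
  by rewrite -form_conj eN rmorphB /= !form_conj.
by rewrite Re2E !eN !eN' rmorphB /= !form_conj; ring.
Qed.

(** After the same change of coordinates [F] follows [e + d]; subtracting the equation of [e] leaves
    the cross terms and the term quadratic in [d]. *)
Let Fmodel x : quadric model x -> near0 (fun t => forall j,
  'Im (rsubmx (d t x) 0 j) = 2 * 'Re (form j (lsubmx (d t x)) (lsubmx (e t x)))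
     + form j (lsubmx (d t x)) (lsubmx (d t x))).
Proof.
move=> Mx; apply: near0W (near0_and (near0_dilation (@qweight_gt0 n k) x GM)
  (near0_dilation (@qweight_gt0 n k) x FM)) => t t0 [hG' hF'] j.
have := hG' (dilation_quadric t0 Mx) j; rewrite -/(form j _ _) => E.
have := hF' (dilation_quadric t0 Mx) j; rewrite -/(form j _ _) => E'.
rewrite rT !lT raddfB /= Im_2iM !linearB /= [X in 'Im X]mxE [X in 'Im (_ + X)]mxE raddfB /= E E'.
rewrite -/f0; set f := lsubmx (G _); set f' := lsubmx (F _).
have eN u u' v : form j (u - u') v = form j u v - form j u' v.
  by rewrite -scaleN1r formDl mulN1r.
have eN' u u' v : form j v (u - u') = form j v u - form j v u'.
  by rewrite -form_conj eN rmorphB /= !form_conj.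
by rewrite !Re2E !eN !eN' !rmorphB /= !form_conj; ring.
Qed.

Let a1 : vseries C (n + k) := fun al => (a al - b al) *m T.
Let b1 : vseries C (n + k) := fun al => b al *m T.

Let expansion_mul H (u : vseries C (n + k)) x D i : has_taylor_series H 0 u ->
  bigO D (fun t => (H (dil t x) *m T) 0 i - \sum_(j < D) t ^+ j * (hp u j x *m T) 0 i).
Proof.
move=> hH.
have h l := taylor_expansion (@qweight_gt0 n k) x D l hH.
have := bigO_sum (fun l => bigOZ (T l i) (h l)); apply: bigO_ext.
exists 1 => // t _ _.
have -> : \sum_(j < D) t ^+ j * (hp u j x *m T) 0 i =
    \sum_l \sum_(j < D) t ^+ j * (hp u j x 0 l * T l i).
  by rewrite exchange_big; apply: eq_bigr => j _; rewrite mxE mulr_sumr.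
rewrite add0r mxE -sumrB; apply: eq_bigr => l _; rewrite mulrBr mulrC; congr (_ - _).
by rewrite mulr_sumr; apply: eq_bigr => j _; rewrite mulrCA [T l i * _]mulrC.
Qed.

Let hp0 (u : vseries C (n + k)) x : hp u 0 x = hp u 0 0.
Proof.
have := hpart_dilation qw u 0 (0 : C) x; rewrite expr0 scale1r => <-; congr (hp u 0 _).
apply/rowP => i; rewrite !mxE expr0n eqn0Ngt qweight_gt0 /=.
by rewrite mul0r.
Qed.

Let G0E x : G 0 = hp b 0 x.
Proof.
rewrite hp0; apply/rowP => i; apply/eqP; rewrite -subr_eq0; apply/eqP.
apply: (@bigO_leading _ 0); apply: bigO_ext (taylor_expansion (@qweight_gt0 n k) 0 1 i hG).
exists 1 => // t _ _; rewrite big_ord1 expr0 !mul1r add0r; congr (G _ _ _ - _).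
by apply/rowP => l; rewrite !mxE mulr0.
Qed.

Let exp_d x D i : bigO D (fun t => d t x 0 i - \sum_(j < D) t ^+ j * hp a1 j x 0 i).
Proof.
have := bigOB (expansion_mul x D i hF) (expansion_mul x D i hG); apply: bigO_ext.
exists 1 => // t _ _.
have -> : \sum_(j < D) t ^+ j * hp a1 j x 0 i =
    \sum_(j < D) t ^+ j * (hp a j x *m T) 0 i - \sum_(j < D) t ^+ j * (hp b j x *m T) 0 i.
  rewrite -sumrB; apply: eq_bigr => j _.
  by rewrite /a1 hpart_mulmx hpartB mulmxBl mxE [X in _ * (_ + X)]mxE mulrBr.
have -> : d t x 0 i = (F (dil t x) *m T) 0 i - (G (dil t x) *m T) 0 i.
  by rewrite /d mulmxBl mxE [X in _ + X]mxE.
by ring.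
Qed.

Let exp_e x D i : bigO D.+1 (fun t => e t x 0 i - \sum_(j < D) t ^+ j.+1 * hp b1 j.+1 x 0 i).
Proof.
have := expansion_mul x D.+1 i hG; apply: bigO_ext.
exists 1 => // t _ _.
have -> : e t x 0 i = (G (dil t x) *m T) 0 i - (G 0 *m T) 0 i.
  by rewrite /e mulmxBl mxE [X in _ + X]mxE.
rewrite big_ord_recl expr0 mul1r -G0E opprD addrA; congr (_ - _); apply: eq_bigr => j _.
by rewrite /b1 hpart_mulmx lift0.
Qed.

Let e1 x := lsubmx (hp b1 1 x).
Let E1 x := rsubmx (hp b1 1 x).
Let E2 x := rsubmx (hp b1 2 x).

Let exp_el x i : bigO 2 (fun t => lsubmx (e t x) 0 i - t * e1 x 0 i).
Proof.
have := exp_e x 1 (lshift k i); apply: bigO_ext.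
by exists 1 => // t _ _; rewrite big_ord1 expr1 /e1 !mxE.
Qed.

Let exp_er x j : bigO 3 (fun t => rsubmx (e t x) 0 j - (t * E1 x 0 j + t ^+ 2 * E2 x 0 j)).
Proof.
have := exp_e x 2 (rshift n j); apply: bigO_ext.
by exists 1 => // t _ _; rewrite !big_ord_recl big_ord0 addr0 /= expr1 /E1 /E2 !mxE.
Qed.

Let el_O1 x i : bigO 1 (fun t => lsubmx (e t x) 0 i).
Proof.
have := bigOD (bigOW (isT : 1 <= 2)%N (exp_el x i)) (bigO_monomial 1 (e1 x 0 i)).
by apply: bigO_ext; exists 1 => // t _ _; rewrite expr1 subrK.
Qed.

Let E1_real x j : quadric model x -> 'Im (E1 x 0 j) = 0.
Proof.
move=> Mx; apply: (@bigO_leading _ 1).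
have h2 : bigO 2 (fun t => rsubmx (e t x) 0 j - t * E1 x 0 j).
  apply: bigO_ext (bigOD (bigOW (isT : 2 <= 3)%N (exp_er x j)) (bigO_monomial 2 (E2 x 0 j))).
  by exists 1 => // t _ _; ring.
have := bigOB (bigO_form j (el_O1 x) (el_O1 x)) (bigO_Im h2); apply: bigO_ext.
apply: near0W (Gmodel Mx) => t t0 <-.
by rewrite raddfB /= Im_realM ?gtr0_real // expr1; ring.
Qed.

Let hom_hp (u : vseries C (n + k)) i D t x : hp u D (dil t x) 0 i = t ^+ D * hp u D x 0 i.
Proof. by rewrite hpart_dilation mxE. Qed.

Let lin_hp (u : vseries C (n + k)) i := weight1_linear (hpart_polymap qw u 1 i) (hom_hp u i 1).

Let on_quadric z : quadric model (row_mx z (\row_j ('i * form j z z))).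
Proof.
by move=> j; rewrite row_mxKl row_mxKr mxE ImMil (Creal_ReP _ (form_real j z)).
Qed.

(** [E1] is complex linear in [z] alone, and every [z] lies under a point of the quadric, so its
    imaginary part vanishes at all [z]; passing to ['i z] kills the real part. *)
Let E1_eq0 x j : E1 x 0 j = 0.
Proof.
have [ind lin] := lin_hp b1 (rshift n j).
have E1E z w : E1 (row_mx z w) 0 j = E1 (row_mx z 0) 0 j by rewrite /E1 !mxE ind.
have h z : 'Im (E1 (row_mx z 0) 0 j) = 0.
  by rewrite -(E1E z (\row_j ('i * form j z z))); apply/E1_real/on_quadric.
have hi z : E1 (row_mx ('i *: z) 0) 0 j = 'i * E1 (row_mx z 0) 0 j.
  by rewrite /E1 !mxE; apply: (linear_formZ _ _ lin).
rewrite -[x]hsubmxK E1E; set z := lsubmx x.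
by rewrite [LHS]Crect h mulr0 addr0 -ImMil -hi h.
Qed.

Let E2_form x j : quadric model x -> 'Im (E2 x 0 j) = form j (e1 x) (e1 x).
Proof.
move=> Mx; apply/eqP; rewrite -subr_eq0; apply/eqP; apply: (@bigO_leading _ 2).
have h3 : bigO 3 (fun t => rsubmx (e t x) 0 j - t ^+ 2 * E2 x 0 j).
  apply: bigO_ext (exp_er x j); exists 1 => // t _ _.
  by rewrite E1_eq0 mulr0 add0r.
have eO (u v : 'rV[C]_n) t i : (u - t *: v) 0 i = u 0 i - t * v 0 i.
  by rewrite !mxE.
have r2 i : bigO 2 (fun t => (lsubmx (e t x) - t *: e1 x) 0 i).
  by apply: bigO_ext (exp_el x i); exists 1 => // t _ _; rewrite eO.
have r1 i : bigO 1 (fun t => (t *: e1 x) 0 i).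
  apply: bigO_ext (bigO_monomial 1 (e1 x 0 i)); exists 1 => // t _ _.
  by rewrite expr1 [RHS]mxE.
have := bigOB (bigOD (bigO_form j r2 (el_O1 x)) (bigO_form j r1 r2)) (bigO_Im h3).
apply: bigO_ext; apply: near0W (Gmodel Mx) => t t0 /(_ j) hE.
rewrite raddfB /= hE Im_realM ?rpredX ?gtr0_real //.
set u := lsubmx _; have -> : form j (u - t *: e1 x) u = form j u u - t * form j (e1 x) u.
  by rewrite -scaleNr formDl mulNr.
have -> : form j (t *: e1 x) (u - t *: e1 x) =
  t * form j (e1 x) u - t ^+ 2 * form j (e1 x) (e1 x).
  rewrite -scaleNr formDr !formZl rmorphN /= (conj_Creal (gtr0_real t0)); ring.
ring.
Qed.

Let A : 'M[C]_n := \matrix_(i, j) e1 (row_mx (delta_mx 0 i) 0) 0 j.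

Let e1E z w : e1 (row_mx z w) = z *m A.
Proof.
apply/rowP => i; have [ind lin] := lin_hp b1 (lshift k i).
rewrite mxE ind (linear_form_row lin) [RHS]mxE; apply: eq_bigr => l _.
by congr (_ * _); rewrite !mxE.
Qed.

(** If [z A = 0], then [G] moves only by order [t ^ 2] along the dilates of [(z, 0)]. The inverse
    germ is Lipschitz, so [t z] is itself of order [t ^ 2]. *)
Let A_unit : A \in unitmx.
Proof.
rewrite -row_free_unit; apply: inj_row_free => z zA0.
pose x : 'rV[C]_(n + k) := row_mx z 0.
have e0 i : e1 x 0 i = 0 by rewrite /x e1E zA0 mxE.
have el i : bigO 2 (fun t => lsubmx (e t x) 0 i).
  by apply: bigO_ext (exp_el x i); exists 1 => // t _ _; rewrite e0 mulr0 subr0.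
have er j : bigO 2 (fun t => rsubmx (e t x) 0 j).
  apply: bigO_ext (bigOD (bigOW (isT : 2 <= 3)%N (exp_er x j)) (bigO_monomial 2 (E2 x 0 j))).
  by exists 1 => // t _ _; rewrite E1_eq0 mulr0 add0r subrK.
have hy i : bigO 2 (fun t => (G (dil t x) - G 0) 0 i).
  case: (split_ordP i) => j ->.
    by apply: bigO_ext (el j); exists 1 => // t _ _; rewrite /e lT mxE.
  have ff : forall l, bigO 0 (fun _ : C => f0 0 l) by move=> l; exact: bigO_cst.
  have := bigOD (er j) (bigOZ (2 * 'i) (bigO_form j el ff)); apply: bigO_ext.
  by exists 1 => // t _ _; rewrite /e rT lT subrK mxE.
apply/rowP => i; rewrite mxE; apply: (@bigO_leading _ 1).
have := taylor_lipschitz (isT : 0 < 2)%N hGi hy (lshift k i); apply: bigO_ext.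
have Gi0 : Gi (G 0) = 0 by exact: (nbhs_singleton GiG).
apply: near0W (near0_dilation (@qweight_gt0 n k) x GiG) => t t0 ht.
by rewrite [G 0 + _]addrC subrK ht Gi0 subr0 /x dilation_row_mx row_mxEl mxE expr1.
Qed.

Let B : 'M[C]_k := \matrix_(i, j) E2 (row_mx 0 (delta_mx 0 i)) 0 j.

Let E2_affine z w w' s j :
  E2 (row_mx z (w + s *: w')) 0 j = E2 (row_mx z w) 0 j + s * E2 (row_mx 0 w') 0 j.
Proof.
by rewrite /E2 !mxE (weight2_affine (hpart_polymap qw b1 2 (rshift n j)) (hom_hp b1 (rshift n j) 2)).
Qed.

Let E2E z w j : E2 (row_mx z w) 0 j = E2 (row_mx z 0) 0 j + (w *m B) 0 j.
Proof.
rewrite -[w in LHS]add0r -[w in LHS]scale1r E2_affine mul1r; congr (_ + _).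
have lin : linear_form (fun w : 'rV[C]_k => E2 (row_mx 0 w) 0 j).
  by move=> s w1 w2; rewrite E2_affine.
by rewrite (linear_form_row lin) mxE; apply: eq_bigr => l _; rewrite [B l j]mxE.
Qed.

Let B_real i j : B i j \is Num.real.
Proof.
apply/Creal_ImP; rewrite mxE E2_form; last first.
  move=> l; rewrite row_mxKl row_mxKr !mul0mx [RHS]mxE mxE.
  by apply/Creal_ImP; rewrite realn.
by rewrite e1E mul0mx form0l.
Qed.

Let Im_mulB (w : 'rV[C]_k) j : 'Im ((w *m B) 0 j) = \sum_i 'Im (w 0 i) * B i j.
Proof.
rewrite mxE raddf_sum; apply: eq_bigr => i _ /=.
by rewrite mulrC Im_realM // mulrC.
Qed.

(** This makes [(A, B)] preserve the quadric. The contribution of [E2] at [(z, 0)] changes sign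
    under [z -> 'i z], by homogeneity at the complex parameter ['i], while the forms do not change;
    so it vanishes. *)
Let formA z j : form j (z *m A) (z *m A) = \sum_i form i z z * B i j.
Proof.
have h z' : form j (z' *m A) (z' *m A) = 'Im (E2 (row_mx z' 0) 0 j) + \sum_i form i z' z' * B i j.
  have := E2_form j (on_quadric z'); rewrite e1E => <-.
  rewrite E2E raddfD /= Im_mulB; congr (_ + _); apply: eq_bigr => i _.
  by rewrite mxE ImMil (Creal_ReP _ (form_real i z')).
have ii : 'i * 'i^* = 1 :> C by rewrite conjCi mulrN -expr2 sqrCi opprK.
have hi : E2 (row_mx ('i *: z) 0) 0 j = - E2 (row_mx z 0) 0 j.
  have := hom_hp b1 (rshift n j) 2 'i (row_mx z 0).
  by rewrite dilation_row_mx scaler0 sqrCi mulN1r /E2 !mxE.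
have := h ('i *: z); rewrite hi raddfN /= -scalemxAl formZl formZr mulrA ii mul1r h.
under [X in _ = - _ + X -> _]eq_bigr => i _ do rewrite formZl formZr mulrA ii mul1r.
move=> /addIr /eqP; rewrite -subr_eq0 opprK -mulr2n mulrn_eq0 => /eqP ->.
by rewrite add0r.
Qed.

(** A kernel vector of the transpose is a linear relation among the forms at all points [z A], and
    [A] is onto. *)
Let B_unit : B \in unitmx.
Proof.
rewrite -unitmx_tr -row_free_unit; apply: inj_row_free => r hr.
apply/rowP => l; rewrite mxE; apply: (forms_free (c := fun j => r 0 j)) => z.
rewrite -[z](mulmxKV A_unit); set z' := z *m invmx A.
under eq_bigr => j _ do rewrite formA mulr_sumr.
rewrite exchange_big big1 //= => i _.
have := congr1 (fun M : 'rV[C]_k => M 0 i) hr; rewrite !mxE => hri.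
transitivity (form i z' z' * \sum_j r 0 j * B^T j i); last by rewrite hri mulr0.
by rewrite mulr_sumr; apply: eq_bigr => j _; rewrite [B^T j i]mxE; ring.
Qed.

Let Minv : 'M[C]_(n + k) := block_mx (invmx A) 0 0 (invmx B).

Let MinvE (y : 'rV[C]_(n + k)) : y *m Minv = row_mx (lsubmx y *m invmx A) (rsubmx y *m invmx B).
Proof.
by rewrite -[y in LHS]hsubmxK mul_row_block !mulmx0 addr0 add0r.
Qed.

Let Minv_surj (x : 'rV[C]_(n + k)) : exists y, x = y *m Minv.
Proof.
exists (row_mx (lsubmx x *m A) (rsubmx x *m B)).
by rewrite MinvE row_mxKl row_mxKr !mulmxK // hsubmxK.
Qed.

Let Minv_quadric (y : 'rV[C]_(n + k)) : quadric model y -> quadric model (y *m Minv).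
Proof.
move=> My; rewrite MinvE; set z := _ *m invmx A; set w := _ *m invmx B.
pose r : 'rV[C]_k := \row_j ('Im (w 0 j) - form j z z).
suff r0 : r = 0.
  move=> j; rewrite row_mxKl row_mxKr -/(form j _ _); apply/eqP.
  by rewrite -subr_eq0; have /rowP/(_ j) := r0; rewrite [LHS]mxE [RHS]mxE => ->.
rewrite -[r](mulmxK B_unit) (_ : r *m B = 0) ?mul0mx //; apply/rowP => j.
rewrite mxE [RHS]mxE.
under eq_bigr => i _ do rewrite mxE mulrBl.
rewrite sumrB -Im_mulB -formA /w /z !mulmxKV // (My j) -/(form j _ _).
by rewrite subrr.
Qed.

Let a1_jets al : (mdegree al < 5)%N -> a1 al = 0.
Proof. by move=> h; rewrite /a1 jets // subrr mul0mx. Qed.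

(** The [w]-part runs one weight ahead because tangency pairs weight [D.+1] in [w] with weight [D]
    in [z]. *)
Let vanish D :=
  (forall x j i, (j < D)%N -> hp a1 j x 0 (lshift k i) = 0) /\
  (forall x j i, (j < D.+1)%N -> hp a1 j x 0 (rshift n i) = 0).

(** Weight is at least degree, so terms of weight below 5 belong to the 4-jet. *)
Let vanish4 : vanish 4.
Proof.
have h x j i : (j < 5)%N -> hp a1 j x 0 i = 0.
  move=> hj; rewrite /hpart partial_sumE summxE big1 // => al _.
  case: eqP => [hw|_]; last by rewrite mxE.
  rewrite a1_jets ?scaler0 ?mxE //; apply: leq_ltn_trans hj; rewrite -hw.
  by apply: leq_sum => l _; rewrite leq_pmull // qweight_gt0.
by split=> x j i hj; apply: h => //; apply: ltnW.
Qed.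

(** The coefficient of [t ^ D.+1] in [Fmodel]: replacing [d] and [e] by their leading terms costs
    only order [D.+2]. *)
Let leading_equation D x j : (4 <= D)%N -> vanish D -> quadric model x ->
  'Im (rsubmx (hp a1 D.+1 x) 0 j) = 2 * 'Re (form j (lsubmx (hp a1 D x)) (e1 x)).
Proof.
move=> D4 [vl vr] Mx; set P := lsubmx _; set Q := rsubmx _.
apply/eqP; rewrite -subr_eq0; apply/eqP; apply: (@bigO_leading _ D.+1).
have dl i : bigO D.+1 (fun t => (lsubmx (d t x) - t ^+ D *: P) 0 i).
  have := exp_d x D.+1 (lshift k i); apply: bigO_ext; exists 1 => // t _ _.
  rewrite big_ord_recr /= big1 => [|l _]; last by rewrite vl // mulr0.
  by rewrite add0r /P !mxE.
have dr : bigO D.+2 (fun t => rsubmx (d t x) 0 j - t ^+ D.+1 * Q 0 j).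
  have := exp_d x D.+2 (rshift n j); apply: bigO_ext; exists 1 => // t _ _.
  rewrite big_ord_recr /= big1 => [|l _]; last by rewrite vr // mulr0.
  by rewrite add0r /Q !mxE.
have tP i : bigO D (fun t => (t ^+ D *: P) 0 i).
  by apply: bigO_ext (bigO_monomial D (P 0 i)); exists 1 => // t _ _; rewrite [RHS]mxE.
have el i : bigO 2 (fun t => (lsubmx (e t x) - t *: e1 x) 0 i).
  have rE (u v : 'rV[C]_n) t : (u - t *: v) 0 i = u 0 i - t * v 0 i by rewrite !mxE.
  by apply: bigO_ext (exp_el x i); exists 1 => // t _ _; rewrite rE.
have dO i : bigO D (fun t => lsubmx (d t x) 0 i).
  have rE (u v : 'rV[C]_n) : (u - v) 0 i + v 0 i = u 0 i by rewrite !mxE subrK.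
  by apply: bigO_ext (bigOD (bigOW (leqnSn D) (dl i)) (tP i)); exists 1 => // t _ _; rewrite rE.
have h1 := bigO_form j dl (el_O1 x); rewrite addn1 in h1.
have h2 := bigO_form j tP el; rewrite addn2 in h2.
(* The term quadratic in [d] has order [D + D], which is at least [D + 2]. *)
have h3 : bigO D.+2 (fun t => form j (lsubmx (d t x)) (lsubmx (d t x))).
  by apply: bigOW (bigO_form j dO dO); lia.
have := bigOB (bigOD (bigOZ 2 (bigO_Re (bigOD h1 h2))) h3) (bigO_Im dr).
apply: bigO_ext; apply: near0W (Fmodel Mx) => t t0 /(_ j) hE.
have tr : t ^+ D.+1 \is Num.real by rewrite rpredX // gtr0_real.
rewrite raddfB /= hE Im_realM // mulrBr [t ^+ _ * (2 * _)]mulrCA -(Re_realM (form j P (e1 x)) tr).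
set u := lsubmx (d t x); set v := lsubmx (e t x).
have -> : form j (u - t ^+ D *: P) v = form j u v - t ^+ D * form j P v.
  by rewrite -scaleNr formDl mulNr.
have -> : form j (t ^+ D *: P) (v - t *: e1 x) =
  t ^+ D * form j P v - t ^+ D.+1 * form j P (e1 x).
  rewrite -scaleNr formDr !formZl rmorphN /= (conj_Creal (gtr0_real t0)) exprS.
  by rewrite mulNr mulrA.
by rewrite addrA subrK raddfB /=; ring.
Qed.

(** Composition with [Minv] turns the leading part [e1] into [z] itself, so the leading part of [d]
    becomes a tangent field of the model, of order at least 5 by the hypothesis on jets. *)
Let vanishS D : (4 <= D)%N -> vanish D -> vanish D.+1.
Proof.
move=> D4 vD.
have pm E i : polymap (fun y => hp a1 E (y *m Minv) 0 i).
  move=> y hy; apply: hpart_polymap => l.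
  apply: (@polyfun_ext _ (fun t => \sum_s y t 0 s * Minv s l)).
    by move=> t; rewrite mxE.
  by apply: polyfun_sum => s _; apply: polyfunM (polyfun_cst _).
have om E i : order_ge 5 (fun y => hp a1 E (y *m Minv) 0 i).
  move=> y; have [r pr hr] := hpart_vanishing_order qw E (y *m Minv) i a1_jets.
  by exists r => // t; rewrite -scalemxAl.
have tang : forall y, lsubmx (hp a1 D (y *m Minv)) = 0 /\ rsubmx (hp a1 D.+1 (y *m Minv)) = 0.
  apply: model_tangent_eq0.
  - by move=> i y hy; apply: polyfun_ext (pm D (lshift k i) y hy) => t; rewrite mxE.
  - by move=> i y hy; apply: polyfun_ext (pm D.+1 (rshift n i) y hy) => t; rewrite mxE.
  - by move=> i y; have [r pr hr] := om D (lshift k i) y; exists r => // t; rewrite mxE.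
  - by move=> i y; have [r pr hr] := om D.+1 (rshift n i) y; exists r => // t; rewrite mxE.
  - move=> y My j; rewrite leading_equation //; last exact: Minv_quadric.
    by rewrite MinvE e1E mulmxKV.
have [vl vr] := vD; split=> x j i; rewrite ltnS leq_eqVlt => /orP [/eqP -> | lt].
- have [y ->] := Minv_surj x; have [/rowP/(_ i) + _] := tang y.
  by rewrite !mxE.
- exact: vl.
- have [y ->] := Minv_surj x; have [_ /rowP/(_ i)] := tang y.
  by rewrite !mxE.
- exact: vr.
Qed.

Lemma jets_same_germ : same_germ 0 F G.
Proof.
have vD D : vanish (D + 4).
  by elim: D => [|D IH]; [exact: vanish4 | apply: vanishS IH; rewrite leq_addl].
have a10 al : a1 al = 0.
  apply/rowP => i; rewrite [RHS]mxE.
  apply: (hpart_eq0 (@qweight_gt0 n k) _ (erefl (weight qw al))) => x.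
  have [vl vr] := vD (weight qw al).+1.
  by case: (split_ordP i) => j ->; [apply: vl | apply: vr];
    rewrite ?ltnS ?leq_addr // leqW // leq_addr.
have ab : a = b.
  by apply/funext => al; apply/eqP; rewrite -subr_eq0; apply/eqP/Tinj/a10.
rewrite /same_germ; move: hF hG; rewrite /has_taylor_series ab.
apply: filterS2 => x [_ h1] [_ h2].
by apply: (cvg_unique _ h1 h2); apply: norm_hausdorff.
Qed.

End Determination.

(** * An automorphism with trivial 3-jet *)

Section PolynomialMaps.
Variables (C : numClosedFieldType) (N : nat).
Implicit Types (s : seq ('rV[C]_N * multi_index N)).

Lemma near_always (p : 'rV[C]_N) (P : 'rV[C]_N -> Prop) :
  (forall x, P x) -> \forall x \near p, P x.
Proof. by move=> h; apply/nbhs_ballP; exists 1 => //= x _; exact: h. Qed.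

Definition poly_map s (x : 'rV[C]_N) := \sum_(u <- s) monomial u.2 x *: u.1.

Definition poly_series s : vseries C N := fun al => \sum_(u <- s | u.2 == al) u.1.

Lemma poly_map_taylor s (F : 'rV[C]_N -> 'rV[C]_N) :
  F =1 poly_map s -> has_taylor_series F 0 (poly_series s).
Proof.
move=> hF.
have [b hb] : exists b, forall u, u \in s -> u.2 \in box N b.
  exists (\sum_(u <- s) \sum_i u.2 i).+1 => u us; rewrite mem_box; apply/forallP => i.
  by rewrite ltnS (big_rem u) //= (bigD1 i) //= -!addnA leq_addr.
have supp al : poly_series s al != 0 -> forall i, (al i < b)%N.
  rewrite /poly_series big_seq_cond => nz i.
  suff /hasP [u us /eqP <-] : has (fun u => u.2 == al) s.
    by have := hb u us; rewrite mem_box => /forallP.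
  apply: contraNT nz => /hasPn h; rewrite big1 // => u /andP [us /eqP e].
  by have := h u us; rewrite e eqxx.
apply: near_always => x; rewrite subr0.
have eventually_cst (V : normedModType C) (u : multi_index N -> V) :
    (forall al, poly_series s al = 0 -> u al = 0) ->
    partial_sum u @ \oo --> partial_sum u b.
  move=> hu; apply: cvg_near_cst; apply: filterS (nbhs_infty_ge b) => j bj.
  apply: partial_sum_widen => // al nz; apply: supp; apply: contraNneq nz => e.
  by rewrite hu.
split.
  apply/cvg_ex; exists (partial_sum (fun al => `|monomial al x *: poly_series s al|) b).
  by apply: eventually_cst => al ->; rewrite scaler0 normr0.
have -> : F x = partial_sum (fun al => monomial al x *: poly_series s al) b.
  rewrite hF /poly_map partial_sumE.
  under [RHS]eq_bigr => al _ do rewrite /poly_series scaler_sumr big_mkcond.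
  rewrite exchange_big /= big_seq [RHS]big_seq; apply: eq_bigr => u us.
  rewrite (bigD1_seq u.2) ?box_uniq ?hb //= eqxx big1 ?addr0 // => al.
  by rewrite eq_sym => /negbTE ->.
by apply: eventually_cst => al ->; rewrite scaler0.
Qed.

Definition hpoly (d : nat) (P : 'rV[C]_N -> C) :=
  exists2 s : seq (C * multi_index N), all (fun u => mdegree u.2 == d) s &
    forall x, P x = \sum_(u <- s) u.1 * monomial u.2 x.

Lemma hpolyD d P Q : hpoly d P -> hpoly d Q -> hpoly d (fun x => P x + Q x).
Proof.
move=> [s hs eP] [s' hs' eQ]; exists (s ++ s'); first by rewrite all_cat hs.
by move=> x; rewrite big_cat eP eQ.
Qed.

Lemma hpolyM d d' P Q : hpoly d P -> hpoly d' Q -> hpoly (d + d') (fun x => P x * Q x).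
Proof.
move=> [s /allP hs eP] [s' /allP hs' eQ].
pose mul (u v : C * multi_index N) : C * multi_index N :=
  (u.1 * v.1, [ffun i => u.2 i + v.2 i]%N).
exists (allpairs mul s s').
  apply/allP => _ /allpairsP [[u v] /= [us vs ->]] /=.
  rewrite -(eqP (hs u us)) -(eqP (hs' v vs)) /mdegree -big_split /=.
  by apply/eqP/eq_bigr => i _; rewrite ffunE.
move=> x; rewrite big_allpairs_dep eP eQ big_distrl; apply: eq_bigr => u _ /=.
rewrite big_distrr; apply: eq_bigr => v _ /=; rewrite mulrACA; congr (_ * _).
by rewrite /monomial -big_split; apply: eq_bigr => i _; rewrite ffunE exprD.
Qed.

Lemma hpoly_cst c : hpoly 0 (fun=> c).
Proof.
exists [:: (c, [ffun=> 0%N])].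
  by rewrite /= /mdegree big1 // => i _; rewrite ffunE.
move=> x; rewrite big_seq1 /monomial big1 ?mulr1 // => i _.
by rewrite ffunE.
Qed.

Lemma hpoly_entry i : hpoly 1 (fun x => x 0 i).
Proof.
exists [:: (1, [ffun j => (j == i) : nat])].
  rewrite /= andbT /mdegree (bigD1 i) //= ffunE eqxx big1 // => j /negbTE nj.
  by rewrite ffunE nj.
move=> x; rewrite big_seq1 mul1r /monomial (bigD1 i) //= ffunE eqxx big1 ?mulr1 // => j.
by rewrite ffunE => /negbTE ->.
Qed.

Lemma hpolyZ d c P : hpoly d P -> hpoly d (fun x => c * P x).
Proof. exact: (hpolyM (hpoly_cst c)). Qed.

Lemma hpolyB d P Q : hpoly d P -> hpoly d Q -> hpoly d (fun x => P x - Q x).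
Proof.
move=> hP hQ; have [s hs e] := hpolyD hP (hpolyZ (-1) hQ).
by exists s => // x; rewrite -e mulN1r.
Qed.

Definition hmap (d : nat) (F : 'rV[C]_N -> 'rV[C]_N) :=
  exists2 s, all (fun u => mdegree u.2 == d) s & F =1 poly_map s.

Lemma hmap_scale d P v : hpoly d P -> hmap d (fun x => P x *: v).
Proof.
move=> [s hs e]; exists [seq (u.1 *: v, u.2) | u <- s]; first by rewrite all_map.
move=> x; rewrite /poly_map big_map e scaler_suml; apply: eq_bigr => u _ /=.
by rewrite scalerA mulrC.
Qed.

Lemma hmapD d F G : hmap d F -> hmap d G -> hmap d (fun x => F x + G x).
Proof.
move=> [s hs eF] [s' hs' eG]; exists (s ++ s'); first by rewrite all_cat hs.
by move=> x; rewrite /poly_map big_cat eF eG.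
Qed.

Lemma hmap_id : hmap 1 id.
Proof.
have h (r : seq 'I_N) : hmap 1 (fun x => \sum_(i <- r) x 0 i *: delta_mx 0 i).
  elim: r => [|i r [s hs e]].
    by exists [::] => // x; rewrite /poly_map !big_nil.
  have [s' hs' e'] := hmapD (hmap_scale (delta_mx 0 i) (hpoly_entry i)) (ex_intro2 _ _ s hs e).
  by exists s' => // x; rewrite big_cons -e'.
have [s hs e] := h (index_enum 'I_N).
by exists s => // x; rewrite -e; exact: row_sum_delta.
Qed.

Lemma hmapZ d c F : hmap d F -> hmap d (fun x => c *: F x).
Proof.
move=> [s hs e]; exists [seq (c *: u.1, u.2) | u <- s]; first by rewrite all_map.
move=> x; rewrite /poly_map big_map e scaler_sumr; apply: eq_bigr => u _ /=.
by rewrite !scalerA mulrC.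
Qed.

Lemma same_jet_perturbation d X : hmap d.+1 X -> same_jet d 0 (fun x => x + X x) id.
Proof.
move=> [s hs eX]; have [s1 _ e1] := hmap_id.
exists (poly_series (s1 ++ s)), (poly_series s1); split.
- by apply: poly_map_taylor => x;
  rewrite /poly_map big_cat -/(poly_map s1 x) -/(poly_map s x) -e1 -eX.
- exact: poly_map_taylor.
move=> al hal; rewrite /poly_series big_cat /= [X in _ + X]big_seq_cond.
rewrite [X in _ + X]big1 ?addr0 // => u /andP [us /eqP e].
have /allP/(_ u us) /eqP := hs; rewrite e => hd.
by move: hal; rewrite hd ltnn.
Qed.

Lemma holomorphic_perturbation d X : hmap d X -> holomorphic_at (fun x => x + X x) 0.
Proof.
move=> [s hs eX]; have [s1 _ e1] := hmap_id.
exists (poly_series (s1 ++ s)).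
by apply: poly_map_taylor => x;
  rewrite /poly_map big_cat -/(poly_map s1 x) -/(poly_map s x) -e1 -eX.
Qed.

(** [X] is unchanged by its own displacement, so [x - X x] is a two-sided inverse. *)
Lemma biholomorphic_perturbation d X : hmap d X -> X 0 = 0 ->
  (forall x, X (x + X x) = X x) -> (forall x, X (x - X x) = X x) ->
  biholomorphic_at (fun x => x + X x) 0.
Proof.
move=> hX X0 h1 h2; split; first exact: holomorphic_perturbation hX.
exists (fun x => x - X x); split.
- rewrite X0 addr0.
  have := holomorphic_perturbation (hmapZ (-1) hX).
  by rewrite (_ : (fun x => x + -1 *: X x) = fun x => x - X x) //; apply/funext => x;
    rewrite scaleN1r.
- by apply: near_always => x; rewrite h1 addrK.
- by apply: near_always => x; rewrite h2 subrK.
Qed.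

End PolynomialMaps.

(** * The field of degree 4 on the model quadric *)

Section Perturbation.
Variables (C : numClosedFieldType) (m : nat).
Local Notation n := (m.+4).
Local Notation k := (m.+4.+1).
Local Notation model := (@model C m).
Implicit Types x : 'rV[C]_(n + k).

Definition zcoord (i : nat) x := coord (lsubmx x) i.
Definition wcoord (j : nat) x := coord (rsubmx x) j.
Local Notation z := zcoord.
Local Notation w := wcoord.

Definition wdet x := w 0 x * w 1 x - (w 2 x + 'i * w 3 x) * (w 2 x - 'i * w 3 x) / 4.

(* With [W = [[w0, (w2 - 'i w3) / 2], [(w2 + 'i w3) / 2, w1]]], so that
   [W - W^* = 2 'i zeta zeta^*] on the quadric for the column [zeta = (z0, z1)], the perturbation is the field
   [det W (adj W zeta) d/d eta + (det W)^2 d/d w4]. *)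
Definition perturbation x : 'rV[C]_(n + k) :=
  (wdet x * (w 1 x * z 0 x - (w 2 x - 'i * w 3 x) / 2 * z 1 x)) *: delta_mx 0 (lshift k (inord 2)) +
  (wdet x * (w 0 x * z 1 x - (w 2 x +
    'i * w 3 x) / 2 * z 0 x)) *: delta_mx 0 (lshift k (inord 3)) +
  wdet x ^+ 2 *: delta_mx 0 (rshift n (inord 4)).

Let hz i : hpoly 1 (z i).
Proof. by have [s hs e] := @hpoly_entry C (n + k) (lshift k (inord i)); exists s => // x;
  rewrite -e /zcoord /coord mxE. Qed.

Let hw j : hpoly 1 (w j).
Proof. by have [s hs e] := @hpoly_entry C (n + k) (rshift n (inord j)); exists s => // x;
  rewrite -e /wcoord /coord mxE. Qed.

Lemma hmap_perturbation : hmap 4 perturbation.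
Proof.
have hdet : hpoly 2 wdet.
  apply: hpolyB; first exact: (hpolyM (hw 0) (hw 1)).
  rewrite [X in hpoly X](_ : 2 = 2 + 0)%N //; apply: hpolyM (hpoly_cst _ _).
  apply: (@hpolyM _ _ 1 1); [apply: hpolyD|apply: hpolyB] => //; exact: hpolyZ.
have hh (P : 'rV[C]_(n + k) -> C) j : hpoly 1 P -> hpoly 2 (fun x => P x / 2 * z j x).
  move=> hP; apply: (@hpolyM _ _ 1 1) => //; rewrite [X in hpoly X](_ : 1 = 1 + 0)%N //.
  by apply: hpolyM hP (hpoly_cst _ _).
apply: hmapD; first apply: hmapD; apply: hmap_scale.
- apply: (@hpolyM _ _ 2 2) => //; apply: hpolyB; first exact: (@hpolyM _ _ 1 1).
  by apply: hh; apply: hpolyB => //; apply: hpolyZ.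
- apply: (@hpolyM _ _ 2 2) => //; apply: hpolyB; first exact: (@hpolyM _ _ 1 1).
  by apply: hh; apply: hpolyD => //; apply: hpolyZ.
- by have [s hs e] := hpolyM hdet hdet; exists s.
Qed.

Let delta_lr (N1 N2 : nat) (i : 'I_N1) : lsubmx (delta_mx 0 (lshift N2 i) : 'rV[C]_(N1 + N2)) =
  delta_mx 0 i.
Proof. by apply/rowP => l; rewrite !mxE (inj_eq (@lshift_inj _ _)). Qed.

Let delta_rr (N1 N2 : nat) (i : 'I_N1) : rsubmx (delta_mx 0 (lshift N2 i) : 'rV[C]_(N1 + N2)) = 0.
Proof. by apply/rowP => l; rewrite !mxE eq_rlshift andbF. Qed.

Let delta_ll (N1 N2 : nat) (i : 'I_N2) : lsubmx (delta_mx 0 (rshift N1 i) : 'rV[C]_(N1 + N2)) = 0.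
Proof. by apply/rowP => l; rewrite !mxE eq_lrshift andbF. Qed.

Let delta_rl (N1 N2 : nat) (i : 'I_N2) : rsubmx (delta_mx 0 (rshift N1 i) : 'rV[C]_(N1 + N2)) =
  delta_mx 0 i.
Proof. by apply/rowP => l; rewrite !mxE (inj_eq (@rshift_inj _ _)). Qed.

Let X := perturbation.

Let zX i x : (i < n)%N -> z i (X x) =
  if i == 2%N then wdet x * (w 1 x * z 0 x - (w 2 x - 'i * w 3 x) / 2 * z 1 x)
  else if i == 3%N then wdet x * (w 0 x * z 1 x - (w 2 x + 'i * w 3 x) / 2 * z 0 x) else 0.
Proof.
move=> hi; rewrite {1}/zcoord /X /perturbation !linearD !linearZ /= !delta_lr delta_ll scaler0 addr0.
rewrite /coord mxE [X in X + _]mxE [X in _ +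
  X]mxE -/(coord (delta_mx _ _) i) -/(coord (delta_mx _ _) i).
rewrite !coord_delta //; case: (i =P 2%N) => [->|_]; first by rewrite mulr1 mulr0 addr0.
by rewrite mulr0 add0r; case: (i =P 3%N) => _; rewrite ?mulr1 ?mulr0.
Qed.

Let wX j x : (j < k)%N -> w j (X x) = if j == 4%N then wdet x ^+ 2 else 0.
Proof.
move=> hj; rewrite {1}/wcoord /X /perturbation !linearD !linearZ /= !delta_rr delta_rl !scaler0 !add0r.
rewrite /coord mxE mxE eqxx -val_eqE /= !inordK //.
by case: (j == 4%N); rewrite ?mulr1 ?mulr0.
Qed.

Let zD i x y : z i (x + y) = z i x + z i y.
Proof. by rewrite /zcoord /coord linearD mxE. Qed.

Let wD j x y : w j (x + y) = w j x + w j y.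
Proof. by rewrite /wcoord /coord linearD mxE. Qed.

Let zZ i a x : z i (a *: x) = a * z i x.
Proof. by rewrite /zcoord /coord linearZ mxE. Qed.

Let wZ j a x : w j (a *: x) = a * w j x.
Proof. by rewrite /wcoord /coord linearZ mxE. Qed.

(** The field moves only [z2], [z3] and [w4], and its coefficients involve none of them. *)
Let XDX a x : X (x + a *: X x) = X x.
Proof.
have zE i : (i < 2)%N -> z i (x + a *: X x) = z i x.
  move=> hi; rewrite zD zZ zX; last by apply: leq_trans hi _.
  by case: i hi => [|[|]] // _; rewrite mulr0 addr0.
have wE i : (i < 4)%N -> w i (x + a *: X x) = w i x.
  move=> hi; rewrite wD wZ wX; last by apply: leq_trans hi _.
  by rewrite ltn_eqF // mulr0 addr0.
by rewrite /X /perturbation /wdet !wE // !zE.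
Qed.

Let X0 : X 0 = 0.
Proof.
have w0 j : w j 0 = 0 by rewrite /wcoord linear0 /coord mxE.
have d0 : wdet 0 = 0 by rewrite /wdet !w0 !(mul0r, mulr0, addr0, subr0).
by rewrite /X /perturbation d0 !mul0r expr0n /= !scale0r !addr0.
Qed.

Let quadric_coord x : quadric model x <-> forall j, (j < k)%N ->
  'Im (w j x) = model_form j (fun i => z i x) (fun i => (z i x)^* ).
Proof.
split=> [Mx j hj|h j].
  have := Mx (Ordinal hj); rewrite -/(form _ _ _) formE => <-.
  by rewrite /wcoord /coord; congr ('Im (rsubmx x 0 _)); apply/val_inj; rewrite /= inordK.
rewrite -/(form _ _ _) formE -[RHS](h _ (ltn_ord j)) /wcoord /coord; congr ('Im (rsubmx x 0 _)).
by rewrite inord_val.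
Qed.

Let X_quadric x : quadric model x -> quadric model (x + X x).
Proof.
move=> /quadric_coord Mx; apply/quadric_coord => j hj.
have cw i : (i < k)%N ->
    (w i x)^* = w i x - 2 * 'i * model_form i (fun l => z l x) (fun l => (z l x)^* ).
  move=> /Mx <-; rewrite {2}[w i x]Crect [X in X^*]Crect rmorphD rmorphM /= conjCi.
  by rewrite !(conj_Creal (Creal_Re _)) !(conj_Creal (Creal_Im _)); ring.
rewrite wD wX // raddfD /= Mx //.
have z0 : z 0 (x + X x) = z 0 x by rewrite zD zX // addr0.
have z1 : z 1 (x + X x) = z 1 x by rewrite zD zX // addr0.
case: j hj => [|[|[|[|[|j]]]]] hj; rewrite /= ?z0 ?z1 ?raddf0 ?addr0 //; last first.
  by rewrite zD zX //= addr0.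
rewrite !(zD _ x (X x)) !zX //=.
set P := w 2 x + 'i * w 3 x; set Q := w 2 x - 'i * w 3 x.
set a := z 0 x * (z 1 x)^*; set b := z 1 x * (z 0 x)^*.
have ii : 'i * 'i = -1 :> C by rewrite -expr2 sqrCi.
have cP : P^* = Q - 4 * 'i * a.
  rewrite rmorphD rmorphM /= conjCi !cw //= /Q.
  transitivity (w 2 x - 'i * w 3 x - 2 * 'i * (a + b) + 'i * 'i * (2 * 'i) * (a - b)).
    by rewrite /a /b; ring.
  by rewrite ii; ring.
have cQ : Q^* = P - 4 * 'i * b.
  rewrite rmorphB rmorphM /= conjCi !cw //= /P.
  transitivity (w 2 x + 'i * w 3 x - 2 * 'i * (a + b) - 'i * 'i * (2 * 'i) * (a - b)).
    by rewrite /a /b; ring.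
  by rewrite ii; ring.
(* This is [zeta^* adj W zeta]. As [W - W^*] has rank one, [det W] and its conjugate differ by
   exactly [2 'i E], and [E] is real. *)
pose E := w 1 x * (z 0 x * (z 0 x)^* ) + w 0 x * (z 1 x * (z 1 x)^* ) - Q / 2 * b - P / 2 * a.
have cD : (wdet x)^* = wdet x - 2 * 'i * E.
  rewrite /wdet -/P -/Q rmorphB !rmorphM /= fmorphV rmorph_nat cP cQ !cw //= /E /a /b.
  by field; rewrite ?pnatr_eq0.
have cE : E^* = E.
  rewrite /E !rmorphB rmorphD !rmorphM /= fmorphV rmorph_nat !conjCK cP cQ !cw //= /a /b.
  by field; rewrite ?pnatr_eq0.
set p0 := wdet x * (_ - Q / 2 * _); set p1 := wdet x * (_ - P / 2 * _).
have pE : p0 * (z 0 x)^* + p1 * (z 1 x)^* = wdet x * E by rewrite /p0 /p1 /E /a /b; ring.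
have pE' : z 0 x * p0^* + z 1 x * p1^* = (wdet x)^* * E.
  by rewrite -cE -rmorphM -pE rmorphD !rmorphM /= !conjCK; ring.
have -> : 'Im (wdet x ^+ 2) = wdet x * E + (wdet x)^* * E.
  rewrite ImE rmorphXn /= cD.
  transitivity (- ('i * 'i) * (wdet x * E + (wdet x - 2 * 'i * E) * E)); last first.
    by rewrite ii opprK mul1r.
  by field; rewrite ?pnatr_eq0.
by rewrite -pE -pE' !rmorphD; ring.
Qed.

Lemma biholo_perturbation : biholo_germ_into (quadric model) (fun x => x + perturbation x).
Proof.
split.
  apply: (biholomorphic_perturbation hmap_perturbation X0) => x.
    by have := XDX 1 x; rewrite scale1r.
  by have := XDX (-1) x; rewrite scaleN1r.
by apply: near_always => x; exact: X_quadric.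
Qed.

Lemma biholo_id : biholo_germ_into (quadric model) id.
Proof.
split; last exact: near_always.
have := @biholomorphic_perturbation C (n + k) 0 (fun=> 0) _ erefl (fun=> erefl) (fun=> erefl).
rewrite (_ : (fun x => x + 0) = id); last by apply/funext => x; rewrite addr0.
by apply; exists [::] => // x; rewrite /poly_map big_nil.
Qed.

Lemma perturbation_neq : ~ same_germ 0 (fun x => x + perturbation x) id.
Proof.
move=> /near0_dilation h.
(* At [z = 0], [w0 = w1 = 1] the determinant is 1; after dilation it is [t ^ 4], so the [w4]
   component of the field is nonzero. *)
pose y : 'rV[C]_(n + k) := row_mx 0 (\row_(j < k) (j < 2)%N%:R).
have [e e0 he] := h (@qweight n k) (@qweight_gt0 n k) y.
have e20 : 0 < e / 2 by rewrite divr_gt0 ?ltr0n.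
have := he (e / 2) e20; rewrite ltr_pdivrMr ?ltr0n // ltr_pMr // ltr1n => /(_ isT).
set t := e / 2; set x := dilation _ _ _ => hx.
have Xx : X x = 0 by apply: (addrI x); rewrite addr0.
have wx j : (j < k)%N -> w j x = t ^+ 2 * (j < 2)%N%:R.
  by move=> hj; rewrite /wcoord /x /y dilation_row_mx row_mxKr /coord !mxE inordK.
have := wX x (isT : 4 < k)%N; rewrite Xx /wcoord linear0 /coord mxE /= => /esym /eqP.
rewrite expf_eq0 /= /wdet !wx //= !(mulr0, mulr1, addr0, subr0, mul0r).
by rewrite mulf_eq0 orbb expf_eq0 /= gt_eqF.
Qed.

End Perturbation.

(** The dimensions are variables tied to [m] by equations, so that [k - 1] and [k] can be
    substituted inside the types, with [m = k - 5]. *)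
Lemma generic_quadric_4jets (C : numClosedFieldType) (n k m : nat) :
  n = m.+4 -> k = m.+4.+1 ->
  exists H : 'I_k -> 'M[C]_n,
    [/\ generic_quadric H, jets_determine 4 (quadric H)
      & exists F G : 'rV[C]_(n + k) -> 'rV[C]_(n + k),
          [/\ biholo_germ_into (quadric H) F, biholo_germ_into (quadric H) G,
              same_jet 3 0 F G & ~ same_germ 0 F G]].
Proof.
move=> -> ->; exists (@model C m); split; first exact: model_generic.
  move=> F G [_ FM] [[_ [Gi [[c hGi] GiG _]]] GM] [a [b [hF hG jets]]].
  exact: jets_same_germ hF hG hGi GiG FM GM jets.
exists (fun x => x + perturbation x), id; split.
- exact: biholo_perturbation.
- exact: biholo_id.
- exact: same_jet_perturbation (hmap_perturbation _ _).
- exact: perturbation_neq.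
Qed.

Theorem theorem15 (R : realType) (k : nat) (hk : (5 < k)%N) :
  exists H : 'I_k -> 'M[R[i]]_(k - 1),
    [/\ generic_quadric H,
        jets_determine 4 (quadric H)
      & exists F G : 'rV[R[i]]_(k - 1 + k) -> 'rV[R[i]]_(k - 1 + k),
          [/\ biholo_germ_into (quadric H) F, biholo_germ_into (quadric H) G,
              same_jet 3 0 F G & ~ same_germ 0 F G]].
Proof.
by apply: (@generic_quadric_4jets _ _ _ (k - 5)); lia.
Qed.
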